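(* Let $\Gamma=(\mathbb{Z}_2)^n$ with $n\ge1$, let $A$ be a $\Gamma$-commutative algebra, let $M$ be a free graded $A$-module of rank $\mathbf{r}$ with standard basis $\{e_i\}_{i=1,\dots,r}$, let $\pi\in\Gamma$ be odd with associated parity functor $\Pi$, let $\mathcal{K}=S^\bullet_A(\Pi M\oplus M^* )$ with differential $d$ = left multiplication by $\sum_i\Pi e_i\,\varepsilon^i$, and let $\Phi:\mathsf{GL}^0(\mathbf{r};A)\to\operatorname{Aut}^0(H^r(\mathcal{K}^\bullet))$ be the group morphism given by the induced action of degree-preserving automorphisms of $M$ on $H^r(\mathcal{K}^{\bullet})$, i.e. $\Phi(T)([\xi_1\cdots\xi_r])=[\hat\varphi_T(\xi_1\cdots\xi_r)]$. Then for all $T\in\mathsf{GL}^0(\mathbf{r};A)$, $\Phi(T)$ is the operator of right multiplication by $\Gamma\mathrm{Ber}(T)$.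
   Context: Grading: $\Gamma=(\mathbb{Z}_2)^n$ with $\langle x,y\rangle=\sum_i x_iy_i\in\mathbb{Z}_2$. An element $\gamma$ is even if $\langle\gamma,\gamma\rangle=0$ and odd if $\langle\gamma,\gamma\rangle=1$. The $N=2^n$ elements are enumerated $\gamma_1,\dots,\gamma_N$: first the $q=2^{n-1}$ even ones in lexicographic order, then the odd ones in lexicographic order. The degree of a homogeneous element $a$ is written $\tilde a$. A $\Gamma$-commutative algebra $A=\bigoplus_{\gamma}A^\gamma$ is an associative unital $\Gamma$-graded algebra over a field of characteristic $0$ with $ab=(-1)^{\langle\tilde a,\tilde b\rangle}ba$ for homogeneous $a,b$. Graded left $A$-modules are also right modules via $ma=(-1)^{\langle\tilde a,\tilde m\rangle}am$. $A$-linear maps $\ell$ of degree $\gamma$ are additive maps raising degree by $\gamma$ with $\ell(ma)=\ell(m)a$. A free graded module of rank $\mathbf{r}=(r_1,\dots,r_N)$ has a homogeneous basis with $r_i$ elements of degree $\gamma_i$; a standard basis $\{e_i\}_{i=1,\dots,r}$ ($r=\sum_i r_i$) is such a basis ordered so that the first $r_1$ elements have degree $\gamma_1$, the next $r_2$ degree $\gamma_2$, etc. Put $r'=\sum_{i=1}^q r_i$. The dual $M^*$ is the graded module of all $A$-linear maps $M\to A$ (direct sum over degrees), with $(\ell\cdot a)(m)=\ell(am)$, and dual basis $\varepsilon^i(e_j)=\delta^i_j$, $\tilde{\varepsilon^i}=\tilde e_i$. Parity functor: for an odd $\pi\in\Gamma$, $(\Pi M)^\alpha=M^{\alpha+\pi}$,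 with $\Pi(m+m')=\Pi m+\Pi m'$ and $\Pi(am)=(-1)^{\langle\pi,\tilde a\rangle}a\,\Pi m$; so $\Pi m$ has degree $\tilde m+\pi$. $S_A^\bullet(P)$ is the graded symmetric algebra of a graded $A$-module $P$: the quotient of the tensor algebra over $A$ by the ideal generated by $m\otimes m'-(-1)^{\langle\tilde m,\tilde m'\rangle}m'\otimes m$; it is $\Gamma$-commutative. Variables: $x_i=\varepsilon^i$ and $\xi_i=\Pi e_i$ for $1\le i\le r'$; $x_i=\Pi e_i$ and $\xi_i=-(-1)^{\langle\tilde e_i,\pi\rangle}\varepsilon^i$ for $r'<i\le r$. The $x_i$ are even, the $\xi_i$ odd, and $\mathcal{K}=A[x,\xi]$ is the $\Gamma$-commutative polynomial algebra in these variables. $\mathcal{K}^k$ is the set of polynomials of total degree $k$ in the $\xi$'s; $d$ is left multiplication by $\sum_i\xi_ix_i$, $d^2=0$, and $\ker d/\operatorname{im}d=\bigoplus_kH^k(\mathcal{K}^\bullet)=H^r(\mathcal{K}^\bullet)=[\xi_1\cdots\xi_r]\cdot A$. $\mathsf{GL}^0(\mathbf{r};A)$ is the group of invertible degree-$0$ graded matrices $T=(t^j_{\ i})$: matrices divided into blocks $T_{uv}$ of size $r_u\times r_v$ with entries in $A^{\gamma_u+\gamma_v}$. Such $T$ represents the degree-preserving automorphism $\varphi$ of $M$ with $\varphi(e_i)=\sum_je_j\,t^j_{\ i}$. The action: $\varphi$ induces $\varphi^\Pi:\Pi M\to\Pi M$, $\varphi^\Pi(\Pi m)=\Pi(\varphi(m))$,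 and $(\varphi^{*})^{-1}:M^*\to M^*$, where $\varphi^*(\alpha)=\alpha\circ\varphi$; these extend to a unique $A$-algebra automorphism $\hat\varphi_T$ of $\mathcal{K}=S_A^\bullet(\Pi M\oplus M^* )$, equal to $\varphi^\Pi$ on $\Pi M$ and to $(\varphi^* )^{-1}$ on $M^*$. It commutes with $d$, hence induces an automorphism of $\ker d/\operatorname{im}d=H^r(\mathcal{K}^\bullet)$; this automorphism is $\Phi(T)$ (with classes taken in $\ker d/\operatorname{im}d$). The graded Berezinian $\Gamma\mathrm{Ber}:\mathsf{GL}^0(\mathbf{r};A)\to(A^0)^\times$ is (by a known theorem) the unique group homomorphism such that $\Gamma\mathrm{Ber}(X)=\prod_{u=1}^{q}\det(X_{uu})\cdot\prod_{u=q+1}^{N}\det(X_{uu})^{-1}$ for block-diagonal $X$, and $\Gamma\mathrm{Ber}(X)=1$ for every lower or upper block-unitriangular $X$.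
   Formalization: The graded Berezinian need not be the only homomorphism with its listed properties over a fixed A; so it is stated that Φ(T) is right multiplication by B(T) for some homomorphism B with these properties, and by ΓBer(T) whenever ΓBer is the unique such homomorphism. *)

(* Defs.v *)
From HB Require Import structures.
From mathcomp Require Import all_boot all_order all_algebra.
From mathcomp Require Import generic_quotient ring_quotient.
From mathcomp Require Import boolp classical_sets.

Set Implicit Arguments.
Unset Strict Implicit.
Unset Printing Implicit Defensive.

Import Order.TTheory GRing.Theory.
Local Open Scope ring_scope.
Local Open Scope quotient_scope.

Section GradingGroup.
Variable n : nat.
Implicit Types x y z : 'rV['F_2]_n.

Definition dotp x y : 'F_2 := \sum_i x ord0 i * y ord0 i.

(* The sign (-1)^<x,y>, via the representative 0 or 1 of <x,y>. *)
Definition ksgn (R : pzRingType) x y : R := (-1) ^+ (dotp x y : nat).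

Definition lexle x y : bool :=
  (x == y) ||
  [exists i : 'I_n, [forall j : 'I_n, (j < i)%N ==> (x ord0 j == y ord0 j)]
                    && ((x ord0 i : nat) < (y ord0 i : nat))%N].

(* gamma_1, ..., gamma_N: the even degrees, then the odd ones. *)
Definition degrees : seq 'rV['F_2]_n :=
  sort lexle [seq g <- enum 'rV['F_2]_n | dotp g g == 0]
  ++ sort lexle [seq g <- enum 'rV['F_2]_n | dotp g g == 1].

Lemma dotpC x y : dotp x y = dotp y x.
Proof. by apply: eq_bigr => i _; rewrite mulrC. Qed.

Lemma dotpDl x y z : dotp (x + y) z = dotp x z + dotp y z.
Proof. by rewrite -big_split; apply: eq_bigr => i _; rewrite mxE mulrDl. Qed.

Lemma addgg x : x + x = 0.
Proof.
apply/rowP => i; rewrite !mxE -mulr2n -mulr_natr.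
by rewrite (_ : 2%:R = 0 :> 'F_2) ?mulr0 //; apply/val_inj.
Qed.

Lemma addKg x y : x + (x + y) = y.
Proof. by rewrite addrA addgg add0r. Qed.

Lemma addgK x y : y + x + x = y.
Proof. by rewrite -addrA addgg addr0. Qed.

Lemma ksgnC R x y : ksgn R x y = ksgn R y x.
Proof. by rewrite /ksgn dotpC. Qed.

Lemma ksgnDl R x y z : ksgn R (x + y) z = ksgn R x z * ksgn R y z.
Proof.
rewrite /ksgn -exprD dotpDl -signr_odd -[RHS]signr_odd; congr (_ ^+ _).
by case: (dotp x z) (dotp y z) => [[|[|?]] ?] [[|[|?]] ?].
Qed.

Lemma ksgnDr R x y z : ksgn R x (y + z) = ksgn R x y * ksgn R x z.
Proof. by rewrite ksgnC ksgnDl !(ksgnC _ x). Qed.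

Lemma ksgn_sq R x y : ksgn R x y * ksgn R x y = 1.
Proof. by rewrite -ksgnDl addgg /ksgn /dotp big1 // => i _; rewrite mxE mul0r. Qed.

Lemma ksgn0l R x : ksgn R 0 x = 1.
Proof. by rewrite -(addgg x) ksgnDl ksgn_sq. Qed.

Lemma ksgn_comm (R : pzRingType) x y (a : R) : ksgn R x y * a = a * ksgn R x y.
Proof. by rewrite /ksgn (commr_sign a). Qed.

End GradingGroup.

(* A grading is given by its projections onto the homogeneous components, so   *)
(* that V is the direct sum of the V^g := {x | gcomp g x = x}.                 *)
HB.mixin Record isGraded (n : nat) V of GRing.Nmodule V := {
  gcomp : 'rV['F_2]_n -> V -> V;
  gcompD : forall g x y, gcomp g (x + y) = gcomp g x + gcomp g y;
  gcompI : forall g h x, gcomp g (gcomp h x) = if g == h then gcomp h x else 0;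
  gcomp_sum : forall x, \sum_g gcomp g x = x
}.

HB.structure Definition GradedNmod (n : nat) :=
  {V of GRing.Nmodule V & isGraded n V}.

#[short(type="gradedType")]
HB.structure Definition Graded (n : nat) := {V of GRing.Zmodule V & isGraded n V}.

(* This structure and the next are joins that the hierarchy builder requires.  *)
HB.structure Definition GradedLSemiModule (n : nat) (R : pzSemiRingType) :=
  {V of GRing.LSemiModule R V & GradedNmod n V}.

HB.structure Definition GradedLmodule (n : nat) (R : pzRingType) :=
  {V of GRing.Lmodule R V & Graded n V}.

Definition homog n (V : gradedType n) (g : 'rV['F_2]_n) (x : V) : Prop :=
  gcomp g x = x.

HB.mixin Record isGammaCommutative (n : nat) (k : fieldType) A
    of GRing.Algebra k A & Graded n A := {
  gcompZ : forall g (c : k) (a : A), gcomp g (c *: a) = c *: gcomp g a;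
  homogM : forall g h (a b : A), homog g a -> homog h b -> homog (g + h) (a * b);
  gammaC : forall g h (a b : A), homog g a -> homog h b ->
    a * b = ksgn A g h * (b * a)
}.

#[short(type="gcAlgType")]
HB.structure Definition GammaCommutative (n : nat) (k : fieldType) :=
  {A of GRing.Algebra k A & Graded n A & isGammaCommutative n k A}.

HB.mixin Record isGradedModule (n : nat) (k : fieldType) (A : gcAlgType n k) M
    of GRing.Lmodule A M & Graded n M := {
  homogZ : forall g h (a : A) (m : M),
    homog g a -> homog h m -> homog (g + h) (a *: m)
}.

#[short(type="gmodType")]
HB.structure Definition GradedModule (n : nat) (k : fieldType) (A : gcAlgType n k) :=
  {M of GRing.Lmodule A M & Graded n M & isGradedModule n k A M}.

Arguments homogM {n k s} [g h a b].
Arguments gammaC {n k s} [g h a b].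
Arguments homogZ {n k A s} [g h a m].

Section GradedTheory.
Variables (n : nat) (V : gradedType n).
Implicit Types (x y : V) (g h : 'rV['F_2]_n).

Lemma gcomp0 g : gcomp g 0 = 0 :> V.
Proof. by apply: (addIr (gcomp g 0)); rewrite -gcompD !add0r. Qed.

Lemma gcompN g x : gcomp g (- x) = - gcomp g x.
Proof. by apply/eqP; rewrite -addr_eq0 -gcompD addNr gcomp0. Qed.

Lemma gcomp_bigsum g I (s : seq I) (P : pred I) (F : I -> V) :
  gcomp g (\sum_(i <- s | P i) F i) = \sum_(i <- s | P i) gcomp g (F i).
Proof. exact: (big_morph _ (gcompD g) (gcomp0 g)). Qed.

Lemma homog_gcomp g x : homog g (gcomp g x).
Proof. by rewrite /homog gcompI eqxx. Qed.

Lemma homog_comp g h x : homog h x -> gcomp g x = if g == h then x else 0.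
Proof. by move=> <-; rewrite gcompI. Qed.

Lemma homog0 g : homog g (0 : V).
Proof. exact: gcomp0. Qed.

Lemma homogD g x y : homog g x -> homog g y -> homog g (x + y).
Proof. by rewrite /homog gcompD => -> ->. Qed.

Lemma homog_sum g I (s : seq I) (P : pred I) (F : I -> V) :
  (forall i, P i -> homog g (F i)) -> homog g (\sum_(i <- s | P i) F i).
Proof.
by move=> h; apply: big_ind => //; [exact: homog0 | exact: homogD].
Qed.

Lemma homog_ind (P : V -> Prop) :
  (forall x y, P x -> P y -> P (x + y)) -> (forall g x, homog g x -> P x) ->
  forall x, P x.
Proof.
move=> PD Ph x; rewrite -(gcomp_sum (n := n) x).
apply: big_ind => // [|g _]; first exact/(Ph 0)/homog0.
exact/Ph/homog_gcomp.
Qed.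

Lemma gcomp_eq_dec (f : 'rV['F_2]_n -> V) g :
  (forall h, homog h (f h)) -> gcomp g (\sum_h f h) = f g.
Proof.
move=> hf; rewrite gcomp_bigsum (bigD1 g) //= (hf g) big1 ?addr0 // => h hg.
by rewrite (homog_comp _ (hf h)) eq_sym (negPf hg).
Qed.

End GradedTheory.

Section AlgebraTheory.
Variables (n : nat) (k : fieldType) (A : gcAlgType n k).
Implicit Types (a b : A) (g h : 'rV['F_2]_n).

Lemma homog1 : homog 0 (1 : A).
Proof.
have h1 (g : 'rV['F_2]_n) : gcomp g (1 : A) * gcomp 0 (1 : A) = gcomp g (1 : A).
  have : gcomp g (gcomp g (1 : A) * \sum_h gcomp h (1 : A)) = gcomp g (1 : A).
    by rewrite gcomp_sum mulr1 gcompI eqxx.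
  rewrite mulr_sumr gcomp_bigsum (bigD1 0) //= big1 ?addr0 => [|h h0].
    by rewrite (homog_comp _ (homogM (homog_gcomp g _) (homog_gcomp 0 _))) addr0 eqxx.
  rewrite (homog_comp _ (homogM (homog_gcomp g _) (homog_gcomp h _))).
  by rewrite -[X in X == _]addr0 (inj_eq (addrI g)) eq_sym (negPf h0).
rewrite /homog -[LHS]mul1r -{1}(gcomp_sum (n := n) (1 : A)) mulr_suml.
by rewrite (eq_bigr _ (fun g _ => h1 g)) gcomp_sum.
Qed.

Lemma homogN1 : homog 0 (-1 : A).
Proof. by rewrite /homog gcompN homog1. Qed.

Lemma homog_ksgn g h : homog 0 (ksgn A g h).
Proof.
rewrite /ksgn -signr_odd; case: (odd _); first exact: homogN1.
exact: homog1.
Qed.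

Lemma homog_ksgnM g g' h a : homog h a -> homog h (ksgn A g g' * a).
Proof. by move=> ha; have := homogM (homog_ksgn g g') ha; rewrite add0r. Qed.

Definition twist g a : A := \sum_h ksgn A g h * gcomp h a.

Lemma twistD g : {morph twist g : a b / a + b}.
Proof.
by move=> a b; rewrite -big_split; apply: eq_bigr => h _; rewrite gcompD mulrDr.
Qed.

Lemma twist_homog g h a : homog h a -> twist g a = ksgn A g h * a.
Proof.
move=> ha; rewrite /twist (bigD1 h) //= ha big1 ?addr0 // => h' hh'.
by rewrite (homog_comp _ ha) (negPf hh') mulr0.
Qed.

Lemma twist0 g : twist g 0 = 0.
Proof. by rewrite (twist_homog g (homog0 A 0)) mulr0. Qed.

Lemma twist1 g : twist g 1 = 1.
Proof. by rewrite (twist_homog g homog1) ksgnC ksgn0l mulr1. Qed.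

Lemma twistM g : {morph twist g : a b / a * b}.
Proof.
move=> a b; move: a; apply: (homog_ind (n := n)) => [x y hx hy|h a ha].
  by rewrite mulrDl !twistD hx hy mulrDl.
move: b; apply: (homog_ind (n := n)) => [x y hx hy|h' b hb].
  by rewrite mulrDr !twistD hx hy mulrDr.
rewrite (twist_homog g (homogM ha hb)) !(twist_homog g ha, twist_homog g hb).
by rewrite ksgnDr !mulrA; congr (_ * _); rewrite -!mulrA; congr (_ * _); rewrite ksgn_comm.
Qed.

Lemma homog_twist g h a : homog h a -> homog h (twist g a).
Proof. by move=> ha; rewrite (twist_homog g ha); apply: homog_ksgnM. Qed.

Section RightAction.
Variable M : gmodType A.
Implicit Types m : M.

Definition ract m a : M :=
  \sum_g \sum_h ksgn A g h *: (gcomp g a *: gcomp h m).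

Lemma ractDl m m' a : ract (m + m') a = ract m a + ract m' a.
Proof.
rewrite -big_split; apply: eq_bigr => g _; rewrite -big_split.
by apply: eq_bigr => h _; rewrite gcompD !scalerDr.
Qed.

Lemma ractDr m a b : ract m (a + b) = ract m a + ract m b.
Proof.
rewrite -big_split; apply: eq_bigr => g _; rewrite -big_split.
by apply: eq_bigr => h _; rewrite gcompD scalerDl scalerDr.
Qed.

Lemma ract_homog g h m a :
  homog g a -> homog h m -> ract m a = ksgn A g h *: (a *: m).
Proof.
move=> ha hm; rewrite /ract (bigD1 g) //= [X in _ + X]big1 => [|g' gg'].
  rewrite addr0 (bigD1 h) //= big1 => [|h' hh'].
    by rewrite addr0 ha hm.
  by rewrite (homog_comp _ hm) (negPf hh') !scaler0.
by apply: big1 => h' _; rewrite (homog_comp _ ha) (negPf gg') scale0r scaler0.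
Qed.

Lemma ract0l a : ract 0 a = 0.
Proof. by apply: (addIr (ract 0 a)); rewrite -ractDl !add0r. Qed.

Lemma ract0r m : ract m 0 = 0.
Proof. by apply: (addIr (ract m 0)); rewrite -ractDr !add0r. Qed.

Lemma ractZ a m b : ract (a *: m) b = a *: ract m b.
Proof.
move: m a b; apply: (homog_ind (n := n)) => [x y hx hy|h m hm] a b.
  by rewrite scalerDr !ractDl hx hy scalerDr.
move: a; apply: (homog_ind (n := n)) => [x y hx hy|g a ha].
  by rewrite scalerDl ractDl hx hy scalerDl.
move: b; apply: (homog_ind (n := n)) => [x y hx hy|g' b hb].
  by rewrite !ractDr hx hy scalerDr.
rewrite (ract_homog hb (homogZ ha hm)) (ract_homog hb hm) !scalerA.
congr (_ *: _); rewrite ksgnDr -!mulrA (gammaC hb ha).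
rewrite (mulrA (ksgn A g' h)) (ksgn_comm g' h (ksgn A g' g)) -mulrA.
by rewrite (mulrA (ksgn A g' g)) ksgn_sq mul1r !mulrA ksgn_comm.
Qed.

Lemma ractA m a b : ract (ract m a) b = ract m (a * b).
Proof.
move: m; apply: (homog_ind (n := n)) => [x y hx hy|h m hm].
  by rewrite !ractDl hx hy.
move: a; apply: (homog_ind (n := n)) => [x y hx hy|g a ha].
  by rewrite mulrDl !(ractDr, ractDl) hx hy.
move: b; apply: (homog_ind (n := n)) => [x y hx hy|g' b hb].
  by rewrite mulrDr !(ractDr, ractDl) hx hy.
rewrite (ract_homog ha hm) !ractZ (ract_homog hb hm) (ract_homog (homogM ha hb) hm).
rewrite !scalerA; congr (_ *: _); rewrite ksgnDl -!mulrA; congr (_ * _).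
by rewrite !mulrA ksgn_comm.
Qed.

Lemma ract1 m : ract m 1 = m.
Proof.
move: m; apply: (homog_ind (n := n)) => [x y hx hy|h m hm].
  by rewrite ractDl hx hy.
by rewrite (ract_homog homog1 hm) ksgn0l !scale1r.
Qed.

Lemma homog_ract g h m a : homog g a -> homog h m -> homog (g + h) (ract m a).
Proof.
move=> ha hm; rewrite (ract_homog ha hm).
by have := homogZ (homog_ksgn g h) (homogZ ha hm); rewrite add0r.
Qed.

Lemma ract_suml I (s : seq I) (P : pred I) (F : I -> M) a :
  ract (\sum_(i <- s | P i) F i) a = \sum_(i <- s | P i) ract (F i) a.
Proof. by apply: (big_morph (fun m => ract m a)) => [x y|]; rewrite ?ractDl ?ract0l. Qed.

Lemma ract_sumr I (s : seq I) (P : pred I) (F : I -> A) m :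
  ract m (\sum_(i <- s | P i) F i) = \sum_(i <- s | P i) ract m (F i).
Proof. by apply: (big_morph (ract m)) => [x y|]; rewrite ?ractDr ?ract0r. Qed.

End RightAction.

(* Degree-preserving A-linear maps; in degree 0, linearity on the left and on  *)
(* the right agree (see [gmap_ract]).                                          *)
Definition gmap (M N : gmodType A) (f : M -> N) : Prop :=
  [/\ forall x y, f (x + y) = f x + f y,
      forall a x, f (a *: x) = a *: f x
    & forall g x, homog g x -> homog g (f x)].

Lemma gmap_ract (M N : gmodType A) (f : M -> N) m a :
  gmap f -> f (ract m a) = ract (f m) a.
Proof.
move=> [fD fZ fh].
move: m; apply: (homog_ind (n := n)) => [x y hx hy|h m hm].
  by rewrite !(ractDl, fD) hx hy.
move: a; apply: (homog_ind (n := n)) => [x y hx hy|g a ha].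
  by rewrite !(ractDr, fD) hx hy.
by rewrite (ract_homog ha hm) (ract_homog ha (fh _ _ hm)) !fZ.
Qed.

Lemma gmap_sum (M N : gmodType A) (f : M -> N) I (s : seq I) (P : pred I) F :
  gmap f -> f (\sum_(i <- s | P i) F i) = \sum_(i <- s | P i) f (F i).
Proof.
move=> [fD _ _]; apply: (big_morph f) => //.
by apply: (addIr (f 0)); rewrite -fD !add0r.
Qed.

(* The carrier of the shifted module; p only selects its structure. *)
Definition parity (p : 'rV['F_2]_n) (M : gmodType A) : Type := M.

Section Parity.
Variables (p : 'rV['F_2]_n) (M : gmodType A).
Local Notation parity := (parity p M).

Definition Par (m : M) : parity := m.
HB.instance Definition _ := GRing.Zmodule.on parity.

Definition parity_scale (a : A) (m : parity) : parity :=
  Par (twist p a *: (m : M)).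
Definition parity_comp (g : 'rV['F_2]_n) (m : parity) : parity :=
  Par (gcomp (g + p) (m : M)).

Fact parity_scaleA a b m :
  parity_scale a (parity_scale b m) = parity_scale (a * b) m.
Proof. by rewrite /parity_scale /Par twistM scalerA. Qed.
Fact parity_scale1 : left_id 1 parity_scale.
Proof. by move=> m; rewrite /parity_scale /Par twist1 scale1r. Qed.
Fact parity_scaleDr : right_distributive parity_scale +%R.
Proof. by move=> a m m'; exact: scalerDr. Qed.
Fact parity_scaleDl m : {morph parity_scale^~ m : a b / a + b}.
Proof. by move=> a b; rewrite /parity_scale /Par twistD; exact: scalerDl. Qed.
HB.instance Definition _ := GRing.Zmodule_isLmodule.Build A parity
  parity_scaleA parity_scale1 parity_scaleDr parity_scaleDl.

Fact parity_compD g x y : parity_comp g (x + y) = parity_comp g x + parity_comp g y.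
Proof. exact: gcompD. Qed.
Fact parity_compI g h x :
  parity_comp g (parity_comp h x) = if g == h then parity_comp h x else 0.
Proof. by rewrite /parity_comp /Par gcompI (inj_eq (addIr p)). Qed.
Fact parity_comp_sum x : \sum_g parity_comp g x = x.
Proof.
rewrite -[RHS](gcomp_sum (n := n) (x : M)).
by rewrite [RHS](reindex_inj (addIr p)).
Qed.
HB.instance Definition _ := isGraded.Build n parity
  parity_compD parity_compI parity_comp_sum.

Fact parity_homogZ g h (a : A) (m : parity) :
  homog g a -> homog h m -> homog (g + h) (a *: m).
Proof.
move=> ha hm; rewrite /homog /gcomp /= /parity_comp -addrA.
by apply: (homogZ (s := M)) => //; apply: homog_twist.
Qed.
HB.instance Definition _ := isGradedModule.Build n k A parity parity_homogZ.

Lemma Par_homog g (m : M) : homog g m -> homog (g + p) (Par m).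
Proof. by move=> hm; rewrite /homog /gcomp /= /parity_comp addgK. Qed.

Lemma ParD (m m' : M) : Par (m + m') = Par m + Par m'.
Proof. by []. Qed.

Lemma Par_scale g (a : A) (m : M) :
  homog g a -> Par (a *: m) = ksgn A p g *: (a *: Par m).
Proof.
move=> ha; rewrite scalerA.
rewrite [RHS](_ : _ = Par (twist p (ksgn A p g * a) *: m)) //; congr (Par (_ *: _)).
by rewrite (twist_homog p (homog_ksgnM p g ha)) mulrA ksgn_sq mul1r.
Qed.

Lemma Par_ract (m : M) (a : A) : Par (ract m a) = ract (Par m) a.
Proof.
move: m; apply: (homog_ind (n := n)) => [x y hx hy|h m hm].
  by rewrite ractDl !ParD ractDl hx hy.
move: a; apply: (homog_ind (n := n)) => [x y hx hy|g a ha].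
  by rewrite !ractDr ParD hx hy.
rewrite (ract_homog ha hm) (ract_homog ha (Par_homog hm)).
rewrite scalerA (Par_scale _ (homog_ksgnM g h ha)) !scalerA.
by congr (_ *: _); rewrite ksgnDr (ksgnC A p g) mulrA -ksgn_comm -mulrA.
Qed.

End Parity.
End AlgebraTheory.

Section DirectSum.
Variables (n : nat) (k : fieldType) (A : gcAlgType n k) (M N : gmodType A).
Implicit Type x : (M * N)%type.

Definition pair_comp (g : 'rV['F_2]_n) x : M * N := (gcomp g x.1, gcomp g x.2).

Fact pair_compD g x y : pair_comp g (x + y) = pair_comp g x + pair_comp g y.
Proof. by rewrite /pair_comp !gcompD. Qed.
Fact pair_compI g h x :
  pair_comp g (pair_comp h x) = if g == h then pair_comp h x else 0.
Proof. by rewrite /pair_comp /= !gcompI; case: eqP. Qed.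
Fact pair_comp_sum x : \sum_g pair_comp g x = x.
Proof.
case: x => x y; rewrite -[in RHS](gcomp_sum (n := n) x) -[in RHS](gcomp_sum (n := n) y).
by elim/big_rec3: _ => // g a b c _ ->.
Qed.
HB.instance Definition _ := isGraded.Build n (M * N)%type
  pair_compD pair_compI pair_comp_sum.

Lemma homog_pair g (x : M) (y : N) : homog g (x, y) <-> homog g x /\ homog g y.
Proof. by split=> [[]|[gx gy]] //; apply: (congr2 pair gx gy). Qed.

Fact pair_homogZ g h (a : A) x :
  homog g a -> homog h x -> homog (g + h) (a *: x).
Proof.
by case: x => x y ha /homog_pair[hx hy]; apply/homog_pair; split; apply: homogZ.
Qed.
HB.instance Definition _ := isGradedModule.Build n k A (M * N)%type pair_homogZ.

Lemma ract_pair (x : M) (y : N) a :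
  ract ((x, y) : (M * N)%type) a = (ract x a, ract y a).
Proof.
rewrite [LHS]surjective_pairing; congr pair; apply: gmap_ract.
  by split=> // g [x' y'] /homog_pair[].
by split=> // g [x' y'] /homog_pair[].
Qed.

End DirectSum.

Section Dual.
Variables (n : nat) (k : fieldType) (A : gcAlgType n k) (M : gmodType A).

(* As the grading group is finite, every additive map l with l (m a) = l(m) a  *)
(* is a finite sum of homogeneous ones, its components being [dual_comp g l].  *)
Record dual := Dual {
  dual_fun :> M -> A;
  dualD : forall x y, dual_fun (x + y) = dual_fun x + dual_fun y;
  dual_ract : forall x a, dual_fun (ract x a) = dual_fun x * a }.

Implicit Types (l : dual).

Lemma dual_ext l l' : (forall x, l x = l' x) -> l = l'.
Proof.
case: l l' => [f fD fr] [f' fD' fr'] /= /funext ff'; move: fD fr; rewrite ff'.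
by move=> fD fr; congr Dual; apply: Prop_irrelevance.
Qed.

HB.instance Definition _ := gen_eqMixin dual.
HB.instance Definition _ := gen_choiceMixin dual.

Program Definition dual_zero := @Dual (fun=> 0) _ _.
Next Obligation. by rewrite addr0. Qed.
Next Obligation. by rewrite mul0r. Qed.
Program Definition dual_add l l' := @Dual (fun x => l x + l' x) _ _.
Next Obligation. by rewrite !dualD addrACA. Qed.
Next Obligation. by rewrite !dual_ract mulrDl. Qed.
Program Definition dual_opp l := @Dual (fun x => - l x) _ _.
Next Obligation. by rewrite !dualD opprD. Qed.
Next Obligation. by rewrite !dual_ract mulNr. Qed.
Program Definition dual_scale (a : A) l := @Dual (fun x => a * l x) _ _.
Next Obligation. by rewrite !dualD mulrDr. Qed.
Next Obligation. by rewrite !dual_ract mulrA. Qed.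

Fact dual_addA : associative dual_add.
Proof. by move=> x y z; apply: dual_ext => m /=; rewrite addrA. Qed.
Fact dual_addC : commutative dual_add.
Proof. by move=> x y; apply: dual_ext => m /=; rewrite addrC. Qed.
Fact dual_add0 : left_id dual_zero dual_add.
Proof. by move=> x; apply: dual_ext => m /=; rewrite add0r. Qed.
Fact dual_addN : left_inverse dual_zero dual_opp dual_add.
Proof. by move=> x; apply: dual_ext => m /=; rewrite addNr. Qed.
HB.instance Definition _ := GRing.isZmodule.Build dual
  dual_addA dual_addC dual_add0 dual_addN.

Lemma dualDE l l' x : (l + l') x = l x + l' x. Proof. by []. Qed.
Lemma dual0E x : (0 : dual) x = 0. Proof. by []. Qed.

Lemma dual_sumE I (s : seq I) (P : pred I) (F : I -> dual) x :
  (\sum_(i <- s | P i) F i) x = \sum_(i <- s | P i) F i x.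
Proof. exact: (big_morph (fun l : dual => l x)). Qed.

Fact dual_scaleA a b l : dual_scale a (dual_scale b l) = dual_scale (a * b) l.
Proof. by apply: dual_ext => m /=; rewrite mulrA. Qed.
Fact dual_scale1 : left_id 1 dual_scale.
Proof. by move=> l; apply: dual_ext => m /=; rewrite mul1r. Qed.
Fact dual_scaleDr : right_distributive dual_scale +%R.
Proof. by move=> a l l'; apply: dual_ext => m /=; rewrite mulrDr. Qed.
Fact dual_scaleDl l : {morph dual_scale^~ l : a b / a + b}.
Proof. by move=> a b; apply: dual_ext => m /=; rewrite mulrDl. Qed.
(* The left action belonging to the right action (l . a) m = l (a m); see      *)
(* [dual_ractE].                                                               *)
HB.instance Definition _ := GRing.Zmodule_isLmodule.Build A dual
  dual_scaleA dual_scale1 dual_scaleDr dual_scaleDl.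

Lemma dualZE a l x : (a *: l) x = a * l x. Proof. by []. Qed.

Lemma dual0 l : l 0 = 0.
Proof. by apply: (addIr (l 0)); rewrite -dualD !add0r. Qed.

Lemma dual_sum l I (s : seq I) (P : pred I) (F : I -> M) :
  l (\sum_(i <- s | P i) F i) = \sum_(i <- s | P i) l (F i).
Proof. exact: (big_morph l (dualD l) (dual0 l)). Qed.

Definition dual_comp_fun (g : 'rV['F_2]_n) l (x : M) : A :=
  \sum_h gcomp (g + h) (l (gcomp h x)).

Fact dual_comp_funD g l x y :
  dual_comp_fun g l (x + y) = dual_comp_fun g l x + dual_comp_fun g l y.
Proof.
by rewrite -big_split; apply: eq_bigr => h _; rewrite gcompD dualD gcompD.
Qed.

Lemma dual_comp_fun_homog g h l x :
  homog h x -> dual_comp_fun g l x = gcomp (g + h) (l x).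
Proof.
move=> hx; rewrite /dual_comp_fun (bigD1 h) //= hx big1 ?addr0 // => h' hh'.
by rewrite (homog_comp _ hx) (negPf hh') dual0 gcomp0.
Qed.

Lemma gcompMr g h (a b : A) : homog h b -> gcomp (g + h) (a * b) = gcomp g a * b.
Proof.
move=> hb; move: a; apply: (homog_ind (n := n)) => [x y hx hy|h' a ha].
  by rewrite mulrDl !gcompD hx hy mulrDl.
rewrite (homog_comp _ (homogM ha hb)) (homog_comp _ ha) (inj_eq (addIr h)).
by case: eqP; rewrite ?mul0r.
Qed.

Fact dual_comp_fun_ract g l x a :
  dual_comp_fun g l (ract x a) = dual_comp_fun g l x * a.
Proof.
move: x; apply: (homog_ind (n := n)) => [x y hx hy|h x hx].
  by rewrite ractDl !dual_comp_funD hx hy mulrDl.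
move: a; apply: (homog_ind (n := n)) => [a b ha hb|g' a ha].
  by rewrite ractDr dual_comp_funD ha hb mulrDr.
rewrite (dual_comp_fun_homog g l (homog_ract ha hx)) (dual_comp_fun_homog g l hx).
by rewrite dual_ract (addrC g') addrA gcompMr.
Qed.

Definition dual_comp g l : dual :=
  Dual (dual_comp_funD g l) (dual_comp_fun_ract g l).

Fact dual_compD g l l' : dual_comp g (l + l') = dual_comp g l + dual_comp g l'.
Proof.
by apply: dual_ext => x; rewrite dualDE -big_split; apply: eq_bigr => h _;
  rewrite dualDE gcompD.
Qed.

Lemma dual_homog_ext l l' : (forall g x, homog g x -> l x = l' x) -> l = l'.
Proof.
move=> ll'; apply: dual_ext; apply: (homog_ind (n := n)) => [x y hx hy|].
  by rewrite !dualD hx hy.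
exact: ll'.
Qed.

Fact dual_compI g h l :
  dual_comp g (dual_comp h l) = if g == h then dual_comp h l else 0.
Proof.
apply: dual_homog_ext => h' x hx /=.
rewrite (dual_comp_fun_homog g _ hx) /= (dual_comp_fun_homog h _ hx) gcompI.
rewrite (inj_eq (addIr h')); case: eqP => // _.
by rewrite /= (dual_comp_fun_homog h _ hx).
Qed.

Fact dual_comp_sum l : \sum_g dual_comp g l = l.
Proof.
apply: dual_homog_ext => h x hx; rewrite dual_sumE.
rewrite -[RHS](gcomp_sum (n := n)) [RHS](reindex_inj (addIr h)).
by apply: eq_bigr => g _; rewrite /= (dual_comp_fun_homog g _ hx).
Qed.

HB.instance Definition _ := isGraded.Build n dual
  dual_compD dual_compI dual_comp_sum.

Lemma homog_dualP g l :
  homog g l <-> forall h x, homog h x -> homog (g + h) (l x).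
Proof.
split=> [gl h x hx|gl].
  by rewrite -gl /= (dual_comp_fun_homog g _ hx); apply: homog_gcomp.
apply: dual_homog_ext => h x hx /=.
by rewrite (dual_comp_fun_homog g _ hx); apply: gl.
Qed.

Fact dual_homogZ g h (a : A) l :
  homog g a -> homog h l -> homog (g + h) (a *: l).
Proof.
move=> ha /homog_dualP hl; apply/homog_dualP => h' x hx.
by rewrite -addrA; apply: homogM => //; apply: hl.
Qed.
HB.instance Definition _ := isGradedModule.Build n k A dual dual_homogZ.

Lemma dual_ractE l a x : ract l a x = l (a *: x).
Proof.
move: l; apply: (homog_ind (n := n)) => [l l' hl hl'|h l hl].
  by rewrite ractDl !dualDE hl hl'.
move: a; apply: (homog_ind (n := n)) => [a b ha hb|g a ha].
  by rewrite ractDr dualDE ha hb scalerDl dualD.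
move: x; apply: (homog_ind (n := n)) => [x y hx hy|h' x hx].
  by rewrite !(scalerDr, dualD) hx hy.
have -> : a *: x = ract x (ksgn A g h' * a).
  rewrite (ract_homog (homog_ksgnM g h' ha) hx) scalerA mulrA ksgn_sq mul1r.
  by [].
rewrite (ract_homog ha hl) dual_ract !dualZE.
have /homog_dualP/(_ _ _ hx) hlx := hl.
rewrite (gammaC ha hlx) ksgnDr !mulrA ksgn_sq mul1r.
by rewrite ksgn_comm.
Qed.

End Dual.

Section TensorAlgebra.
Variables (n : nat) (k : fieldType) (A : gcAlgType n k) (P : gmodType A).

(* The tensor algebra over A of the A-bimodule P, presented as the quotient of *)
(* the ring expressions in A and P by the congruence generated by the ring     *)
(* axioms, the ring operations of A, and the bimodule operations of P.         *)
Inductive tterm : Type :=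
  | TScal of A
  | TGen of P
  | TAdd of tterm & tterm
  | TMul of tterm & tterm.

Inductive tcong : tterm -> tterm -> Prop :=
  | tc_refl t : tcong t t
  | tc_sym t u : tcong t u -> tcong u t
  | tc_trans t u v : tcong t u -> tcong u v -> tcong t v
  | tc_add t t' u u' : tcong t t' -> tcong u u' -> tcong (TAdd t u) (TAdd t' u')
  | tc_mul t t' u u' : tcong t t' -> tcong u u' -> tcong (TMul t u) (TMul t' u')
  | tc_addA t u v : tcong (TAdd t (TAdd u v)) (TAdd (TAdd t u) v)
  | tc_addC t u : tcong (TAdd t u) (TAdd u t)
  | tc_add0 t : tcong (TAdd (TScal 0) t) t
  | tc_addN t : tcong (TAdd (TMul (TScal (-1)) t) t) (TScal 0)
  | tc_mulA t u v : tcong (TMul t (TMul u v)) (TMul (TMul t u) v)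
  | tc_mul1l t : tcong (TMul (TScal 1) t) t
  | tc_mul1r t : tcong (TMul t (TScal 1)) t
  | tc_mulDl t u v : tcong (TMul (TAdd t u) v) (TAdd (TMul t v) (TMul u v))
  | tc_mulDr t u v : tcong (TMul t (TAdd u v)) (TAdd (TMul t u) (TMul t v))
  | tc_scalD a b : tcong (TAdd (TScal a) (TScal b)) (TScal (a + b))
  | tc_scalM a b : tcong (TMul (TScal a) (TScal b)) (TScal (a * b))
  | tc_genD p q : tcong (TAdd (TGen p) (TGen q)) (TGen (p + q))
  | tc_genl a p : tcong (TMul (TScal a) (TGen p)) (TGen (a *: p))
  | tc_genr a p : tcong (TMul (TGen p) (TScal a)) (TGen (ract p a)).

HB.instance Definition _ := gen_eqMixin tterm.
HB.instance Definition _ := gen_choiceMixin tterm.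

Definition trel (t u : tterm) : bool := `[< tcong t u >].

Fact trel_equiv : equiv_class_of trel.
Proof.
split=> [t|t u|u t v].
- exact/asboolP/tc_refl.
- by apply: asbool_equiv_eq; split; apply: tc_sym.
- by move=> /asboolP tu /asboolP uv; apply/asboolP; apply: tc_trans uv.
Qed.

Canonical trel_equivRel := EquivRelPack trel_equiv.
Canonical trel_encModRel := defaultEncModRel trel.

Definition tensalg := {eq_quot trel}.
HB.instance Definition _ := Choice.on tensalg.
HB.instance Definition _ : EqQuotient tterm trel tensalg := EqQuotient.on tensalg.

Definition tpi (t : tterm) : tensalg := \pi_tensalg t.

Lemma tpiP t u : tpi t = tpi u <-> tcong t u.
Proof.
rewrite /tpi; split=> [/eqP|tu]; first by rewrite eqmodE => /asboolP.
by apply/eqmodP/asboolP.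
Qed.

Lemma tpi_repr (x : tensalg) : tpi (repr x) = x.
Proof. exact: reprK. Qed.

Lemma repr_tpi t : tcong (repr (tpi t)) t.
Proof. by apply/tpiP; rewrite tpi_repr. Qed.

Definition tens_add (x y : tensalg) := tpi (TAdd (repr x) (repr y)).
Definition tens_mul (x y : tensalg) := tpi (TMul (repr x) (repr y)).
Definition tens_opp (x : tensalg) := tpi (TMul (TScal (-1)) (repr x)).

Fact tpi_add t u : tpi (TAdd t u) = tens_add (tpi t) (tpi u).
Proof. by apply/tpiP/tc_sym/tc_add; apply: repr_tpi. Qed.
Fact tpi_mul t u : tpi (TMul t u) = tens_mul (tpi t) (tpi u).
Proof. by apply/tpiP/tc_sym/tc_mul; apply: repr_tpi. Qed.
Fact tens_oppE x : tens_opp x = tens_mul (tpi (TScal (-1))) x.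
Proof. by rewrite -{2}[x]tpi_repr -tpi_mul. Qed.

Fact tens_addA : associative tens_add.
Proof.
move=> x y z; rewrite -[x]tpi_repr -[y]tpi_repr -[z]tpi_repr -!tpi_add.
exact/tpiP/tc_addA.
Qed.
Fact tens_addC : commutative tens_add.
Proof.
by move=> x y; rewrite -[x]tpi_repr -[y]tpi_repr -!tpi_add; apply/tpiP/tc_addC.
Qed.
Fact tens_add0 : left_id (tpi (TScal 0)) tens_add.
Proof. by move=> x; rewrite -[x]tpi_repr -tpi_add; apply/tpiP/tc_add0. Qed.
Fact tens_addN : left_inverse (tpi (TScal 0)) tens_opp tens_add.
Proof.
move=> x; rewrite tens_oppE -[x]tpi_repr -tpi_mul -tpi_add.
exact/tpiP/tc_addN.
Qed.
Fact tens_mulA : associative tens_mul.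
Proof.
move=> x y z; rewrite -[x]tpi_repr -[y]tpi_repr -[z]tpi_repr -!tpi_mul.
exact/tpiP/tc_mulA.
Qed.
Fact tens_mul1l : left_id (tpi (TScal 1)) tens_mul.
Proof. by move=> x; rewrite -[x]tpi_repr -tpi_mul; apply/tpiP/tc_mul1l. Qed.
Fact tens_mul1r : right_id (tpi (TScal 1)) tens_mul.
Proof. by move=> x; rewrite -[x]tpi_repr -tpi_mul; apply/tpiP/tc_mul1r. Qed.
Fact tens_mulDl : left_distributive tens_mul tens_add.
Proof.
move=> x y z; rewrite -[x]tpi_repr -[y]tpi_repr -[z]tpi_repr.
by rewrite -!(tpi_add, tpi_mul); apply/tpiP/tc_mulDl.
Qed.
Fact tens_mulDr : right_distributive tens_mul tens_add.
Proof.
move=> x y z; rewrite -[x]tpi_repr -[y]tpi_repr -[z]tpi_repr.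
by rewrite -!(tpi_add, tpi_mul); apply/tpiP/tc_mulDr.
Qed.

HB.instance Definition _ := GRing.isPzRing.Build tensalg
  tens_addA tens_addC tens_add0 tens_addN tens_mulA tens_mul1l tens_mul1r
  tens_mulDl tens_mulDr.

Definition tscal (a : A) : tensalg := tpi (TScal a).
Definition tgen (p : P) : tensalg := tpi (TGen p).

Lemma tscalD a b : tscal (a + b) = tscal a + tscal b.
Proof. by rewrite [RHS](esym (tpi_add _ _)); apply/tpiP/tc_sym/tc_scalD. Qed.
Lemma tscalM a b : tscal (a * b) = tscal a * tscal b.
Proof. by rewrite [RHS](esym (tpi_mul _ _)); apply/tpiP/tc_sym/tc_scalM. Qed.
Lemma tscal1 : tscal 1 = 1. Proof. by []. Qed.
Lemma tgenD p q : tgen (p + q) = tgen p + tgen q.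
Proof. by rewrite [RHS](esym (tpi_add _ _)); apply/tpiP/tc_sym/tc_genD. Qed.
Lemma tgenZ a p : tgen (a *: p) = tscal a * tgen p.
Proof. by rewrite [RHS](esym (tpi_mul _ _)); apply/tpiP/tc_sym/tc_genl. Qed.
Lemma tgen_ract a p : tgen (ract p a) = tgen p * tscal a.
Proof. by rewrite [RHS](esym (tpi_mul _ _)); apply/tpiP/tc_sym/tc_genr. Qed.

Section Lift.
Variables (R : pzRingType) (s : A -> R) (f : P -> R).

Fixpoint tterm_eval (t : tterm) : R :=
  match t with
  | TScal a => s a
  | TGen p => f p
  | TAdd t u => tterm_eval t + tterm_eval u
  | TMul t u => tterm_eval t * tterm_eval u
  end.

Definition tens_lift (x : tensalg) : R := tterm_eval (repr x).

Hypotheses (sD : forall a b, s (a + b) = s a + s b)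
  (sM : forall a b, s (a * b) = s a * s b) (s1 : s 1 = 1)
  (fD : forall p q, f (p + q) = f p + f q)
  (fZ : forall a p, f (a *: p) = s a * f p)
  (fR : forall a p, f (ract p a) = f p * s a).

Fact tterm_eval_cong t u : tcong t u -> tterm_eval t = tterm_eval u.
Proof.
have s0 : s 0 = 0 by apply: (addIr (s 0)); rewrite -sD !add0r.
have sN1 : s (-1) = -1 by apply/eqP; rewrite -addr_eq0 -[X in _ + X]s1 -sD addNr s0.
elim=> //=.
- by move=> ? ? ? _ -> _ ->.
- by move=> ? ? ? ? _ -> _ ->.
- by move=> ? ? ? ? _ -> _ ->.
- by move=> *; rewrite addrA.
- by move=> *; rewrite addrC.
- by move=> *; rewrite s0 add0r.
- by move=> v; rewrite sN1 mulN1r addNr s0.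
- by move=> *; rewrite mulrA.
- by move=> *; rewrite s1 mul1r.
- by move=> *; rewrite s1 mulr1.
- by move=> *; rewrite mulrDl.
- by move=> *; rewrite mulrDr.
Qed.

Lemma tens_lift_pi t : tens_lift (tpi t) = tterm_eval t.
Proof. exact/tterm_eval_cong/repr_tpi. Qed.

Lemma tens_liftD x y : tens_lift (x + y) = tens_lift x + tens_lift y.
Proof.
rewrite -[x]tpi_repr -[y]tpi_repr -[X in tens_lift X]tpi_add.
by rewrite !tens_lift_pi.
Qed.
Lemma tens_liftM x y : tens_lift (x * y) = tens_lift x * tens_lift y.
Proof.
rewrite -[x]tpi_repr -[y]tpi_repr -[X in tens_lift X]tpi_mul.
by rewrite !tens_lift_pi.
Qed.
Lemma tens_lift_scal a : tens_lift (tscal a) = s a.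
Proof. exact: tens_lift_pi. Qed.
Lemma tens_lift_gen p : tens_lift (tgen p) = f p.
Proof. exact: tens_lift_pi. Qed.

End Lift.
End TensorAlgebra.

Section RingQuotient.
Variables (R : pzRingType) (X : R -> Prop).

Inductive gen_ideal : R -> Prop :=
  | gi_gen x : X x -> gen_ideal x
  | gi_0 : gen_ideal 0
  | gi_add x y : gen_ideal x -> gen_ideal y -> gen_ideal (x + y)
  | gi_mull a x : gen_ideal x -> gen_ideal (a * x)
  | gi_mulr a x : gen_ideal x -> gen_ideal (x * a).

Definition gen_ideal_pred : {pred R} := fun x => `[< gen_ideal x >].

Fact gen_ideal_zmod : zmod_closed gen_ideal_pred.
Proof.
split=> [|x y /asboolP hx /asboolP hy]; first exact/asboolP/gi_0.
by apply/asboolP/gi_add => //; rewrite -mulN1r; apply: gi_mull.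
Qed.
HB.instance Definition _ := GRing.isZmodClosed.Build R gen_ideal_pred gen_ideal_zmod.

Definition ringquot : Type := (Quotient.quot gen_ideal_pred).
HB.instance Definition _ := GRing.Zmodule.on ringquot.
Definition rqpi (x : R) : ringquot := \pi_(Quotient.quot gen_ideal_pred) x.
Definition rqrepr (x : ringquot) : R := repr (x : (Quotient.quot gen_ideal_pred)).

Lemma rqpiP x y : rqpi x = rqpi y <-> gen_ideal (x - y).
Proof.
split=> [/eqP|h]; first by rewrite /rqpi -Quotient.idealrBE => /asboolP.
by apply/eqP; rewrite /rqpi -Quotient.idealrBE; apply/asboolP.
Qed.

Lemma rqpi_repr x : rqpi (rqrepr x) = x.
Proof. exact: reprK. Qed.

Lemma rqrepr_pi x : gen_ideal (rqrepr (rqpi x) - x).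
Proof. by apply/rqpiP; rewrite rqpi_repr. Qed.

Lemma rqpiD x y : rqpi (x + y) = rqpi x + rqpi y.
Proof. exact: Quotient.pi_add. Qed.

Lemma rqpi0 : rqpi 0 = 0.
Proof. by apply: (addIr (rqpi 0)); rewrite -rqpiD !add0r. Qed.

Definition rq_mul (x y : ringquot) : ringquot := rqpi (rqrepr x * rqrepr y).

Fact rqpi_mul x y : rqpi (x * y) = rq_mul (rqpi x) (rqpi y).
Proof.
apply/esym/rqpiP; set x' := rqrepr _; set y' := rqrepr _.
have -> : x' * y' - x * y = (x' - x) * y' + x * (y' - y).
  by rewrite mulrBl mulrBr addrA subrK.
by apply: gi_add; [apply: gi_mulr | apply: gi_mull]; apply: rqrepr_pi.
Qed.

Fact rq_mulA : associative rq_mul.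
Proof.
move=> x y z; rewrite -[x]rqpi_repr -[y]rqpi_repr -[z]rqpi_repr.
by rewrite -!rqpi_mul mulrA.
Qed.
Fact rq_mul1l : left_id (rqpi 1) rq_mul.
Proof. by move=> x; rewrite -[x]rqpi_repr -rqpi_mul mul1r. Qed.
Fact rq_mul1r : right_id (rqpi 1) rq_mul.
Proof. by move=> x; rewrite -[x]rqpi_repr -rqpi_mul mulr1. Qed.
Fact rq_mulDl : left_distributive rq_mul +%R.
Proof.
move=> x y z; rewrite -[x]rqpi_repr -[y]rqpi_repr -[z]rqpi_repr.
by rewrite -rqpiD -!rqpi_mul -rqpiD mulrDl.
Qed.
Fact rq_mulDr : right_distributive rq_mul +%R.
Proof.
move=> x y z; rewrite -[x]rqpi_repr -[y]rqpi_repr -[z]rqpi_repr.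
by rewrite -rqpiD -!rqpi_mul -rqpiD mulrDr.
Qed.
HB.instance Definition _ := GRing.Zmodule_isPzRing.Build ringquot
  rq_mulA rq_mul1l rq_mul1r rq_mulDl rq_mulDr.

Lemma rqpiM x y : rqpi (x * y) = rqpi x * rqpi y.
Proof. exact: rqpi_mul. Qed.
Lemma rqpi1 : rqpi 1 = 1. Proof. by []. Qed.

End RingQuotient.

Section SymmetricAlgebra.
Variables (n : nat) (k : fieldType) (A : gcAlgType n k) (P : gmodType A).

Definition sym_relator (t : tensalg P) : Prop :=
  exists g h (p q : P), [/\ homog g p, homog h q &
    t = tgen p * tgen q - ksgn _ g h * (tgen q * tgen p)].

Definition symalg := ringquot sym_relator.
HB.instance Definition _ := GRing.PzRing.on symalg.

Definition symscal (a : A) : symalg := rqpi sym_relator (tscal P a).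
Definition symgen (p : P) : symalg := rqpi sym_relator (tgen p).

Lemma symscalD a b : symscal (a + b) = symscal a + symscal b.
Proof. by rewrite /symscal tscalD rqpiD. Qed.
Lemma symscalM a b : symscal (a * b) = symscal a * symscal b.
Proof. by rewrite /symscal tscalM rqpiM. Qed.
Lemma symscal1 : symscal 1 = 1. Proof. by []. Qed.
Lemma symgenD p q : symgen (p + q) = symgen p + symgen q.
Proof. by rewrite /symgen tgenD rqpiD. Qed.
Lemma symgenZ a p : symgen (a *: p) = symscal a * symgen p.
Proof. by rewrite /symgen tgenZ rqpiM. Qed.
Lemma symgen_ract a p : symgen (ract p a) = symgen p * symscal a.
Proof. by rewrite /symgen tgen_ract rqpiM. Qed.

Lemma symgen_sum I (s : seq I) (Q : pred I) (F : I -> P) :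
  symgen (\sum_(i <- s | Q i) F i) = \sum_(i <- s | Q i) symgen (F i).
Proof.
apply: (big_morph symgen symgenD).
by apply: (addIr (symgen 0)); rewrite -symgenD !add0r.
Qed.

Lemma rqpi_ksgn (g h : 'rV['F_2]_n) : rqpi sym_relator (ksgn _ g h) = ksgn _ g h.
Proof.
rewrite /ksgn -signr_odd -[RHS]signr_odd; case: odd => //.
rewrite !expr1; apply/eqP; rewrite -addr_eq0; apply/eqP.
by rewrite -[X in _ + X](rqpi1 sym_relator) -rqpiD addNr rqpi0.
Qed.

Lemma symgenC g h p q : homog g p -> homog h q ->
  symgen p * symgen q = ksgn _ g h * (symgen q * symgen p).
Proof.
move=> hp hq; rewrite /symgen -rqpi_ksgn.
rewrite -(rqpiM _ (tgen q) (tgen p)) -(rqpiM _ (tgen p) (tgen q)).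
rewrite -(rqpiM _ (ksgn _ g h)); apply/rqpiP/gi_gen.
by exists g, h, p, q.
Qed.

Lemma symalg_ind (Q : symalg -> Prop) :
  (forall a, Q (symscal a)) -> (forall p, Q (symgen p)) ->
  (forall x y, Q x -> Q y -> Q (x + y)) ->
  (forall x y, Q x -> Q y -> Q (x * y)) -> forall x, Q x.
Proof.
move=> Qs Qg QD QM x; rewrite -[x]rqpi_repr -[rqrepr x]tpi_repr.
elim: (repr _) => [a|p|t ht u hu|t ht u hu]; [exact: Qs|exact: Qg|..].
- by have := QD _ _ ht hu; rewrite -rqpiD -[X in rqpi _ X]tpi_add.
- by have := QM _ _ ht hu; rewrite -rqpiM -[X in rqpi _ X]tpi_mul.
Qed.

Section Map.
Variable f : P -> P.

Definition symmap (x : symalg) : symalg :=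
  tens_lift symscal (fun p => symgen (f p)) (rqrepr x).

Hypothesis fg : gmap f.
Let fD p q : symgen (f (p + q)) = symgen (f p) + symgen (f q).
Proof. by case: fg => fD _ _; rewrite fD symgenD. Qed.
Let fZ a p : symgen (f (a *: p)) = symscal a * symgen (f p).
Proof. by case: fg => _ fZ _; rewrite fZ symgenZ. Qed.
Let fR a p : symgen (f (ract p a)) = symgen (f p) * symscal a.
Proof. by rewrite gmap_ract // symgen_ract. Qed.
Local Notation lift := (tens_lift symscal (fun p => symgen (f p))).
Let liftD := tens_liftD symscalD symscalM symscal1 fD fZ fR.
Let liftM := tens_liftM symscalD symscalM symscal1 fD fZ fR.
Let lift_scal := tens_lift_scal symscalD symscalM symscal1 fD fZ fR.
Let lift_gen := tens_lift_gen symscalD symscalM symscal1 fD fZ fR.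

Let lift0 : lift 0 = 0.
Proof. by apply: (addIr (lift 0)); rewrite -liftD !add0r. Qed.
Let liftN x : lift (- x) = - lift x.
Proof. by apply/eqP; rewrite -addr_eq0 -liftD addNr lift0. Qed.
Let lift_ksgn (g h : 'rV['F_2]_n) : lift (ksgn _ g h) = ksgn _ g h.
Proof.
have lift1 : lift 1 = 1 by rewrite -(tscal1 P) lift_scal.
rewrite /ksgn -signr_odd -[RHS]signr_odd; case: odd => //.
by rewrite !expr1 liftN lift1.
Qed.

Let lift_ideal x : gen_ideal sym_relator x -> lift x = 0.
Proof.
elim=> {x} [x|| x y _ hx _ hy| a x _ hx | a x _ hx].
- move=> [g [h [p [q [hp hq ->]]]]].
  rewrite liftD liftN !liftM !lift_gen lift_ksgn.
  case: fg => _ _ fh.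
  by rewrite (symgenC (fh _ _ hp) (fh _ _ hq)) subrr.
- exact: lift0.
- by rewrite liftD hx hy addr0.
- by rewrite liftM hx mulr0.
- by rewrite liftM hx mul0r.
Qed.

Lemma symmap_pi x : symmap (rqpi sym_relator x) = lift x.
Proof.
apply/eqP; rewrite -subr_eq0 -liftN -liftD; apply/eqP/lift_ideal.
exact: rqrepr_pi.
Qed.

Lemma symmapD x y : symmap (x + y) = symmap x + symmap y.
Proof.
rewrite -[x]rqpi_repr -[y]rqpi_repr -rqpiD !symmap_pi.
exact: liftD.
Qed.
Lemma symmapM x y : symmap (x * y) = symmap x * symmap y.
Proof.
rewrite -[x]rqpi_repr -[y]rqpi_repr -rqpiM !symmap_pi.
exact: liftM.
Qed.
Lemma symmap_scal a : symmap (symscal a) = symscal a.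
Proof. by rewrite symmap_pi lift_scal. Qed.
Lemma symmap_gen p : symmap (symgen p) = symgen (f p).
Proof. by rewrite symmap_pi lift_gen. Qed.

Lemma symmap0 : symmap 0 = 0.
Proof. by apply: (addIr (symmap 0)); rewrite -symmapD !add0r. Qed.

Lemma symmap_sum I (s : seq I) (Q : pred I) (F : I -> symalg) :
  symmap (\sum_(i <- s | Q i) F i) = \sum_(i <- s | Q i) symmap (F i).
Proof. exact: (big_morph symmap symmapD symmap0). Qed.

End Map.
End SymmetricAlgebra.

Section Rank.
Variables (n : nat) (r : 'I_(2 ^ n) -> nat).

Definition rdeg (u : 'I_(2 ^ n)) : 'rV['F_2]_n := nth 0 (degrees n) u.

(* tagnat.sig1 is the block of an index of \sum_u r u, in increasing order, so  *)
(* that a family with degrees bdeg is a standard one.                          *)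
Definition bdeg (i : 'I_(\sum_u r u)) : 'rV['F_2]_n := rdeg (tagnat.sig1 i).

End Rank.

Section FreeModule.
Variables (n : nat) (k : fieldType) (A : gcAlgType n k) (r : 'I_(2 ^ n) -> nat).

(* The coordinates are those of the left module; they are determined by the    *)
(* family of vectors.                                                          *)
Record stdBasis (M : gmodType A) := StdBasis {
  sb_vec :> 'I_(\sum_u r u) -> M;
  sb_coord : M -> 'I_(\sum_u r u) -> A;
  sb_homog : forall i, homog (bdeg i) (sb_vec i);
  sb_span : forall m, m = \sum_i sb_coord m i *: sb_vec i;
  sb_free : forall c i, sb_coord (\sum_j c j *: sb_vec j) i = c i }.

Definition deg0_mx (T : 'M[A]_(\sum_u r u)) : Prop :=
  forall i j, homog (bdeg i + bdeg j) (T i j).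

Record gl0 := GL0 {
  gl0_mx :> 'M[A]_(\sum_u r u);
  gl0_inv : 'M[A]_(\sum_u r u);
  gl0_deg : deg0_mx gl0_mx;
  gl0_inv_deg : deg0_mx gl0_inv;
  gl0_mulV : gl0_mx *m gl0_inv = 1%:M;
  gl0_Vmul : gl0_inv *m gl0_mx = 1%:M }.

Fact deg0_mulmx (S T : 'M[A]_(\sum_u r u)) :
  deg0_mx S -> deg0_mx T -> deg0_mx (S *m T).
Proof.
move=> hS hT i j; rewrite mxE; apply: homog_sum => l _.
by have := homogM (hS i l) (hT l j); rewrite -addrA addKg.
Qed.

Program Definition gl0_mul (S T : gl0) : gl0 :=
  @GL0 (S *m T) (gl0_inv T *m gl0_inv S)
    (deg0_mulmx (gl0_deg S) (gl0_deg T))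
    (deg0_mulmx (gl0_inv_deg T) (gl0_inv_deg S)) _ _.
Next Obligation. by rewrite mulmxA -(mulmxA S) gl0_mulV mulmx1 gl0_mulV. Qed.
Next Obligation.
by rewrite mulmxA -(mulmxA (gl0_inv T)) gl0_Vmul mulmx1 gl0_Vmul.
Qed.

(* The inverse of a if a is invertible (and 0 otherwise). *)
Definition rinv (a : A) : A := xget 0 [set b | a * b = 1 /\ b * a = 1]%classic.

Record is_gber (B : gl0 -> A) : Prop := IsGBer {
  gber_unit : forall T, homog 0 (B T) /\
    exists b, [/\ homog 0 b, B T * b = 1 & b * B T = 1];
  gber_mul : forall S T, B (gl0_mul S T) = B S * B T;
  gber_diag : forall X : gl0,
    (forall u v, u != v -> submxblock X u v = 0) ->
    B X = (\prod_(u : 'I_(2 ^ n) | (u < 2 ^ n.-1)%N) \det (submxblock X u u))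
          * (\prod_(u : 'I_(2 ^ n) | (2 ^ n.-1 <= u)%N) rinv (\det (submxblock X u u)));
  gber_lower : forall X : gl0,
    (forall u, submxblock X u u = 1%:M) ->
    (forall u v : 'I_(2 ^ n), (u < v)%N -> submxblock X u v = 0) -> B X = 1;
  gber_upper : forall X : gl0,
    (forall u, submxblock X u u = 1%:M) ->
    (forall u v : 'I_(2 ^ n), (v < u)%N -> submxblock X u v = 0) -> B X = 1 }.

Section Basis.
Variables (M : gmodType A) (e : stdBasis M).
Implicit Types (m : M) (i j : 'I_(\sum_u r u)).

Lemma sb_coord_eq m c : m = \sum_j c j *: e j -> forall i, sb_coord e m i = c i.
Proof. by move=> -> i; rewrite sb_free. Qed.

Lemma sb_coordD m m' i : sb_coord e (m + m') i = sb_coord e m i + sb_coord e m' i.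
Proof.
apply: (sb_coord_eq (c := fun i => sb_coord e m i + sb_coord e m' i)).
rewrite [RHS](eq_bigr _ (fun i _ => scalerDl _ _ _)).
by rewrite [RHS]big_split /= -!sb_span.
Qed.

Lemma sb_coordZ a m i : sb_coord e (a *: m) i = a * sb_coord e m i.
Proof.
apply: (sb_coord_eq (c := fun i => a * sb_coord e m i)).
rewrite [RHS](eq_bigr _ (fun i _ => esym (scalerA _ _ _))).
by rewrite -scaler_sumr -sb_span.
Qed.

Lemma sb_coord_vec i j : sb_coord e (e j) i = (i == j)%:R.
Proof.
apply: (sb_coord_eq (c := fun i => (i == j)%:R)).
rewrite (bigD1 j) //= eqxx scale1r big1 ?addr0 // => l /negPf ->.
by rewrite scale0r.
Qed.

Lemma sb_coord_homog g m i :
  homog g m -> homog (g + bdeg i) (sb_coord e m i).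
Proof.
move=> hm; apply/esym.
apply: (sb_coord_eq (c := fun i => gcomp (g + bdeg i) (sb_coord e m i))).
rewrite -[LHS]hm {1}(sb_span e m). rewrite gcomp_bigsum; apply: eq_bigr => j _.
rewrite -{1}(gcomp_sum (n := n) (sb_coord e m j)) scaler_suml gcomp_bigsum.
rewrite (bigD1 (g + bdeg j)) //= big1 => [|h hh].
  have := homogZ (homog_gcomp (g + bdeg j) (sb_coord e m j)) (sb_homog e j).
  by rewrite addgK addr0.
have hz := homogZ (homog_gcomp h (sb_coord e m j)) (sb_homog e j).
rewrite (homog_comp _ hz); case: eqP => // gE.
by case/eqP: hh; rewrite gE addgK.
Qed.

Definition dual_vec_fun i m : A := twist (bdeg i) (sb_coord e m i).

Fact dual_vec_funD i m m' :
  dual_vec_fun i (m + m') = dual_vec_fun i m + dual_vec_fun i m'.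
Proof. by rewrite /dual_vec_fun sb_coordD twistD. Qed.

Fact dual_vec_fun_ract i m a :
  dual_vec_fun i (ract m a) = dual_vec_fun i m * a.
Proof.
move: m; apply: (homog_ind (n := n)) => [x y hx hy|h m hm].
  by rewrite ractDl !dual_vec_funD hx hy mulrDl.
move: a; apply: (homog_ind (n := n)) => [a b ha hb|g a ha].
  by rewrite ractDr dual_vec_funD ha hb mulrDr.
rewrite (ract_homog ha hm) scalerA /dual_vec_fun sb_coordZ.
have hc := sb_coord_homog i hm; set c := sb_coord e m i in hc *.
rewrite twistM (twist_homog _ (homog_ksgnM g h ha)) (twist_homog _ hc).
rewrite -[in RHS]mulrA (gammaC hc ha) (ksgnC A (h + _)) (ksgnDr A g h).
rewrite (ksgnC A (bdeg i) g) !mulrA.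
set s1 := ksgn A g _; set s2 := ksgn A g h; set s3 := ksgn A _ _.
congr (_ * c); rewrite (ksgn_comm g (bdeg i)) -!mulrA.
by rewrite !mulrA -/s1 -[RHS]mulrA -[RHS]mulrA [RHS](ksgn_comm (bdeg i)) !mulrA.
Qed.

(* The dual basis vector, see [dual_vecE]; the twist converts the left         *)
(* coordinates m = sum_i c_i e_i into the right ones m = sum_i e_i c'_i.       *)
Definition dual_vec i : dual M :=
  Dual (dual_vec_funD i) (dual_vec_fun_ract i).

Lemma dual_vecE i j : dual_vec i (e j) = (i == j)%:R.
Proof.
rewrite /= /dual_vec_fun sb_coord_vec; case: eqP => _ /=.
  exact: twist1.
exact: twist0.
Qed.

Lemma homog_dual_vec i : homog (bdeg i) (dual_vec i).
Proof.
apply/homog_dualP => h m hm; rewrite addrC.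
exact/homog_twist/sb_coord_homog.
Qed.

Lemma sb_span_ract m : m = \sum_i ract (e i) (dual_vec i m).
Proof.
rewrite {1}(sb_span e m); apply: eq_bigr => i _; rewrite /= /dual_vec_fun.
move: (sb_coord e m i); apply: (homog_ind (n := n)) => [x y hx hy|h a ha].
  by rewrite twistD ractDr -hx -hy scalerDl.
rewrite (twist_homog _ ha) (ract_homog (homog_ksgnM _ _ ha) (sb_homog e i)).
by rewrite scalerA mulrA ksgnC ksgn_sq mul1r.
Qed.

(* The map with e_i |-> sum_j e_j t_ji, see [phiE]. *)
Definition phi (T : 'M[A]_(\sum_u r u)) m : M :=
  \sum_i sb_coord e m i *: \sum_j ract (e j) (T j i).

Lemma phi_gmap T : deg0_mx T -> gmap (phi T).
Proof.
move=> hT; split=> [x y|a x|g m hm].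
- by rewrite -big_split; apply: eq_bigr => i _; rewrite sb_coordD scalerDl.
- by rewrite scaler_sumr; apply: eq_bigr => i _; rewrite sb_coordZ scalerA.
- apply: homog_sum => i _.
  have hi : homog (bdeg i) (\sum_j ract (e j) (T j i)).
    apply: homog_sum => j _; have := homog_ract (hT j i) (sb_homog e j).
    by rewrite (addrC (bdeg j)) addgK.
  by have := homogZ (sb_coord_homog i hm) hi; rewrite addgK.
Qed.

Lemma phiE T i : phi T (e i) = \sum_j ract (e j) (T j i).
Proof.
rewrite /phi (bigD1 i) //= sb_coord_vec eqxx scale1r [X in _ + X]big1 ?addr0 //.
move=> j /negPf ji.
by rewrite sb_coord_vec ji scale0r.
Qed.

Lemma phi_ext T (f : M -> M) : deg0_mx T -> gmap f ->
  (forall i, f (e i) = \sum_j ract (e j) (T j i)) -> forall m, f m = phi T m.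
Proof.
move=> hT hf fe m; rewrite {1}(sb_span e m) (gmap_sum _ _ _ hf).
by apply: eq_bigr => i _; case: hf => _ -> _; rewrite fe.
Qed.

Lemma phi_mul S T m : deg0_mx S -> deg0_mx T -> phi S (phi T m) = phi (S *m T) m.
Proof.
move=> hS hT; have [SD SZ Sh] := phi_gmap hS; have [TD TZ Th] := phi_gmap hT.
apply: (phi_ext (f := fun m => phi S (phi T m))); first exact: deg0_mulmx.
  by split=> [x y|a x|g x hx]; rewrite ?TD ?SD ?TZ ?SZ //; apply/Sh/Th.
move=> i; rewrite phiE (gmap_sum _ _ _ (phi_gmap hS)).
transitivity (\sum_l \sum_j ract (ract (e j) (S j l)) (T l i)).
  apply: eq_bigr => l _.
  by rewrite (gmap_ract _ _ (phi_gmap hS)) phiE ract_suml.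
rewrite exchange_big; apply: eq_bigr => j _; rewrite mxE ract_sumr.
by apply: eq_bigr => l _; rewrite ractA.
Qed.

Lemma phi1 m : phi 1%:M m = m.
Proof.
rewrite {2}(sb_span e m); apply: eq_bigr => i _; congr (_ *: _).
rewrite (bigD1 i) //= mxE eqxx ract1 big1 ?addr0 // => j /negPf ji.
by rewrite mxE ji ract0r.
Qed.

Lemma phiK (T : gl0) : cancel (phi T) (phi (gl0_inv T)).
Proof.
by move=> m; rewrite phi_mul ?gl0_Vmul ?phi1 //; [apply: gl0_inv_deg|apply: gl0_deg].
Qed.

Lemma phiVK (T : gl0) : cancel (phi (gl0_inv T)) (phi T).
Proof.
by move=> m; rewrite phi_mul ?gl0_mulV ?phi1 //; [apply: gl0_deg|apply: gl0_inv_deg].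
Qed.

End Basis.

Section Pullback.
Variables (M : gmodType A) (f : M -> M).
Hypothesis fg : gmap f.

Fact pullbackD (l : dual M) x y : l (f (x + y)) = l (f x) + l (f y).
Proof. by case: fg => fD _ _; rewrite fD dualD. Qed.
Fact pullback_ract (l : dual M) x a : l (f (ract x a)) = l (f x) * a.
Proof. by rewrite gmap_ract // dual_ract. Qed.

Definition pullback (l : dual M) : dual M :=
  @Dual _ _ _ M (fun x => l (f x)) (pullbackD l) (pullback_ract l).

End Pullback.

Section Koszul.
Variables (p : 'rV['F_2]_n) (M : gmodType A) (e : stdBasis M).

Local Notation P := (parity p M * dual M)%type.
Definition koszul : Type := symalg P.
HB.instance Definition _ := GRing.PzRing.on koszul.
Implicit Types (z : koszul) (T : gl0).

Definition kscal (a : A) : koszul := symscal P a.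
Definition kpar (m : M) : koszul := symgen ((Par p m, 0) : P).
Definition kdual (l : dual M) : koszul := symgen ((0, l) : P).

(* sum_i Pi(e_i) eps^i, which is sum_i xi_i x_i for xi_i = Pi(e_i),            *)
(* x_i = eps^i (e_i even) and xi_i = -(-1)^<deg e_i, p> eps^i, x_i = Pi(e_i)   *)
(* (e_i odd).                                                                  *)
Definition omega : koszul := \sum_i kpar (e i) * kdual (dual_vec e i).
Definition kd z : koszul := omega * z.

(* phi^Pi on the parity shift, and (phi^* )^-1 = (phi^-1)^* on the dual.        *)
Definition hat_gen T (x : P) : P :=
  (Par p (phi e T x.1), pullback (phi_gmap e (gl0_inv_deg T)) x.2).

Fact hat_gen_gmap T : gmap (hat_gen T).
Proof.
have [phD phZ phh] := phi_gmap e (gl0_deg T).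
have [_ _ phVh] := phi_gmap e (gl0_inv_deg T).
split=> [[m l] [m' l']|a [m l]|g [m l] /homog_pair[hm /homog_dualP hl]].
- by congr pair; [apply: phD|apply: dual_ext].
- by congr pair; [apply: phZ|apply: dual_ext].
- apply/homog_pair; split; last first.
    by apply/homog_dualP => h x hx; apply/hl/phVh.
  have hm' : homog (g + p) (m : M) by exact: hm.
  by have := Par_homog p (phh _ _ hm'); rewrite addgK.
Qed.

Definition hat T : koszul -> koszul := symmap (hat_gen T).

Lemma hatD T z z' : hat T (z + z') = hat T z + hat T z'.
Proof. exact/symmapD/hat_gen_gmap. Qed.
Lemma hatM T z z' : hat T (z * z') = hat T z * hat T z'.
Proof. exact/symmapM/hat_gen_gmap. Qed.
Lemma hat_scal T a : hat T (kscal a) = kscal a.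
Proof. exact/symmap_scal/hat_gen_gmap. Qed.
Lemma hat_par T m : hat T (kpar m) = kpar (phi e T m).
Proof.
rewrite /hat symmap_gen; last exact: hat_gen_gmap.
by congr symgen; congr pair; apply: dual_ext.
Qed.
Lemma hat_dual T (l : dual M) :
  hat T (kdual l) = kdual (pullback (phi_gmap e (gl0_inv_deg T)) l).
Proof.
rewrite /hat symmap_gen; last exact: hat_gen_gmap.
congr symgen; congr pair; rewrite /= /Par.
have [phD _ _] := phi_gmap e (gl0_deg T).
by apply: (addIr (phi e T 0)); rewrite -phD !add0r.
Qed.

Lemma kpar_sum I (s : seq I) (Q : pred I) (F : I -> M) :
  kpar (\sum_(i <- s | Q i) F i) = \sum_(i <- s | Q i) kpar (F i).
Proof.
apply: (big_morph kpar) => [x y|].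
  by rewrite /kpar -symgenD; congr symgen; congr pair; rewrite addr0.
by apply: (addIr (symgen (0 : P))); rewrite -symgenD !add0r.
Qed.

Lemma kdual_sum I (s : seq I) (Q : pred I) (F : I -> dual M) :
  kdual (\sum_(i <- s | Q i) F i) = \sum_(i <- s | Q i) kdual (F i).
Proof.
apply: (big_morph kdual) => [x y|].
  by rewrite /kdual -symgenD; congr symgen; congr pair; rewrite addr0.
by apply: (addIr (symgen (0 : P))); rewrite -symgenD !add0r.
Qed.

Lemma kpar_ract m a : kpar (ract m a) = kpar m * kscal a.
Proof.
by rewrite /kpar /kscal -symgen_ract ract_pair ract0l Par_ract.
Qed.

Lemma kdualZ a (l : dual M) : kdual (a *: l) = kscal a * kdual l.
Proof.
by rewrite /kdual /kscal -symgenZ; congr symgen; congr pair; rewrite scaler0.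
Qed.

Lemma hat_omega T : hat T omega = omega.
Proof.
have hg := hat_gen_gmap T.
rewrite /omega /hat (symmap_sum hg) -/(hat T).
transitivity (\sum_i \sum_j kpar (e j) * kdual (T j i *:
    pullback (phi_gmap e (gl0_inv_deg T)) (dual_vec e i))).
  apply: eq_bigr => i _; rewrite -/(hat T _) hatM hat_par hat_dual phiE.
  rewrite kpar_sum mulr_suml; apply: eq_bigr => j _.
  by rewrite kpar_ract -mulrA -kdualZ.
rewrite exchange_big; apply: eq_bigr => j _; rewrite -mulr_sumr; congr (_ * _).
rewrite -kdual_sum; congr kdual; apply: dual_ext => m.
rewrite dual_sumE -[in RHS](phiVK e T m).
set m' := phi e (gl0_inv T) m.
rewrite {1}(sb_span_ract e m') (gmap_sum _ _ _ (phi_gmap e (gl0_deg T))) dual_sum.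
apply: eq_bigr => i _; rewrite (gmap_ract _ _ (phi_gmap e (gl0_deg T))) dual_ract.
rewrite dualZE phiE dual_sum; congr (_ * _).
rewrite (bigD1 j) //= [X in _ + X]big1 => [|l lj].
  by rewrite addr0 -[dual_vec_fun e j _]/(dual_vec e j _) dual_ract dual_vecE eqxx mul1r.
rewrite -[dual_vec_fun e j _]/(dual_vec e j _) dual_ract dual_vecE.
by rewrite eq_sym (negPf lj) mul0r.
Qed.

Lemma hat_kd T z : hat T (kd z) = kd (hat T z).
Proof. by rewrite /kd hatM hat_omega. Qed.

Definition kcycle_pred : {pred koszul} := fun z => kd z == 0.

Fact kcycle_zmod : zmod_closed kcycle_pred.
Proof.
split=> [|x y /eqP hx /eqP hy]; first by apply/eqP; rewrite /kd mulr0.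
by apply/eqP; rewrite /kd mulrBr [_ * x]hx [_ * y]hy subrr.
Qed.
HB.instance Definition _ := GRing.isZmodClosed.Build koszul kcycle_pred kcycle_zmod.

Record kcycle := KCycle {kcycle_val :> koszul; _ : kcycle_val \in kcycle_pred}.
HB.instance Definition _ := [isSub for kcycle_val].
HB.instance Definition _ := [Choice of kcycle by <:].
HB.instance Definition _ := [SubChoice_isSubZmodule of kcycle by <:].

Definition kboundary_pred : {pred kcycle} :=
  fun z : kcycle => `[< exists y, kcycle_val z = kd y >].

Fact kboundary_zmod : zmod_closed kboundary_pred.
Proof.
split=> [|x y /asboolP[x' hx] /asboolP[y' hy]]; apply/asboolP.
  by exists 0; rewrite /kd mulr0.
by exists (x' - y'); rewrite /kd mulrBr -![omega * _]/(kd _) -hx -hy.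
Qed.
HB.instance Definition _ := GRing.isZmodClosed.Build kcycle kboundary_pred kboundary_zmod.

Definition cohom : Type := Quotient.quot kboundary_pred.
HB.instance Definition _ := GRing.Zmodule.on cohom.
Definition kclass (z : kcycle) : cohom := \pi_(Quotient.quot kboundary_pred) z.
Definition krep (h : cohom) : kcycle := repr (h : Quotient.quot kboundary_pred).

Lemma kclassP (z z' : kcycle) :
  kclass z = kclass z' <-> exists y, kcycle_val z - kcycle_val z' = kd y.
Proof.
split=> [/eqP|h]; first by rewrite /kclass -Quotient.idealrBE => /asboolP.
by apply/eqP; rewrite /kclass -Quotient.idealrBE; apply/asboolP.
Qed.

Lemma krepK h : kclass (krep h) = h.
Proof. exact: reprK. Qed.

Fact kcycle_hat T (z : kcycle) : hat T (kcycle_val z) \in kcycle_pred.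
Proof.
case: z => z /= /eqP hz; apply/eqP.
by rewrite -hat_kd hz /hat symmap0 //; apply: hat_gen_gmap.
Qed.

Fact kcycle_mulr (z : kcycle) a : kcycle_val z * kscal a \in kcycle_pred.
Proof. by case: z => z /= /eqP hz; apply/eqP; rewrite /kd mulrA [_ * z]hz mul0r. Qed.

(* Both operators are defined on representatives; see [PhiE] and [hractE] for  *)
(* the independence of the representative.                                     *)
Definition Phi T (h : cohom) : cohom := kclass (KCycle (kcycle_hat T (krep h))).
Definition hract (h : cohom) (a : A) : cohom :=
  kclass (KCycle (kcycle_mulr (krep h) a)).

Lemma PhiE T (z : kcycle) : Phi T (kclass z) = kclass (KCycle (kcycle_hat T z)).
Proof.
apply/kclassP; have /kclassP[y hy] := krepK (kclass z); exists (hat T y) => /=.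
rewrite -hat_kd -hy hatD; congr (_ + _); apply/eqP; rewrite eq_sym -addr_eq0.
by rewrite -hatD addNr /hat symmap0 //; apply: hat_gen_gmap.
Qed.

Lemma hractE (z : kcycle) a : hract (kclass z) a = kclass (KCycle (kcycle_mulr z a)).
Proof.
apply/kclassP; have /kclassP[y hy] := krepK (kclass z); exists (y * kscal a) => /=.
by rewrite -mulrBl hy /kd mulrA.
Qed.

End Koszul.
End FreeModule.

(* Main.v *)
(* Contraction with a functional of degree g is a skew derivation of the        *)
(* symmetric algebra K, defined by its universal property. The second-order     *)
(* operator sum_i d/dx_i d/dxi_i is a homotopy whose anticommutator with d      *)
(* multiplies a monomial by r + deg_x - deg_xi; in characteristic 0 every cycle *)
(* is therefore cohomologous to some xi_1 ... xi_r a. The coefficient a is      *)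
(* recovered by setting x = 0 after d/dxi_r ... d/dxi_1, which kills im d.      *)
(* Hence the action of T on cohomology is multiplication by the coefficient of  *)
(* T(xi_1 ... xi_r), and this is multiplicative in T. For block-diagonal T it   *)
(* is a product of Grassmann determinants, of the blocks of T on the even part  *)
(* and of T^-1 on the odd part; for block-unitriangular T, the action modulo x  *)
(* is unitriangular for a suitable order of the xi_i, which gives 1.            *)
From HB Require Import structures.
Require Import Defs.
From mathcomp Require Import all_boot all_order all_algebra.
From mathcomp Require Import fingroup perm.
From mathcomp Require classical_sets.

Set Implicit Arguments.
Unset Strict Implicit.
Unset Printing Implicit Defensive.

Import GRing.Theory.
Local Open Scope ring_scope.

(** * The universal property of the symmetric algebra *)

(** The class of $\xi_1\cdots\xi_r$ generates the cohomology over $A$, so $\Phi(T)$ is known from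
    the coefficient [cber T] of that monomial in $\hat\varphi_T(\xi_1\cdots\xi_r)$. This coefficient
    has degree 0, hence is central in $A$, and [Phi_cber] concludes that $\Phi(T)$ is right
    multiplication by it. It remains to recognize [cber] as the graded Berezinian, and [cber_gber]
    checks the properties that characterize the latter.

    Generation: the anticommutator $\Delta$ of $d$ with $\sum_i\partial_{x_i}\partial_{\xi_i}$
    multiplies a monomial by the integer $r+\deg_x-\deg_\xi$, which vanishes only on scalar
    multiples of $\xi_1\cdots\xi_r$. On a cycle, $\Delta$ yields a boundary. Applied to a cycle with
    its top part removed, $\prod_{i\le B}(\Delta-i)$ is therefore both 0 and $\pm B!$ times the
    cycle modulo boundaries; dividing by $B!$ gives [cycle_decomposition]. The coefficient is
    recovered by [top_coef], which vanishes on boundaries ([top_coef_kom]).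

    Recognition: [cber_mul] expresses that $T\mapsto\hat\varphi_T$ is an action. An even $e_i$
    contributes $\xi_i=\Pi e_i$, which transforms by $T$; an odd one contributes $\varepsilon^i$,
    which transforms by $T^{-1}$. For block-diagonal $T$ the product of the transformed $\xi_i$ is a
    product of Grassmann determinants ([cber_blockdiag]); for block-unitriangular $T$ the
    corrections vanish modulo the $x_i$ ([cber_unitri]). *)

Section Signs.
Variables (n : nat) (R : pzRingType).
Implicit Types (g h : 'rV['F_2]_n) (x y : R).

Lemma ksgnK g h x : ksgn R g h * (ksgn R g h * x) = x.
Proof. by rewrite mulrA ksgn_sq mul1r. Qed.

Lemma ksgnCA g h x y : x * (ksgn R g h * y) = ksgn R g h * (x * y).
Proof. by rewrite !mulrA (ksgn_comm g h x). Qed.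

Lemma ksgnN g h x : ksgn R g h * - x = - (ksgn R g h * x).
Proof. exact: mulrN. Qed.

End Signs.

Section SymmetricLift.
Variables (n : nat) (k : fieldType) (A : gcAlgType n k) (P : gmodType A).
Variables (R : pzRingType) (s : A -> R) (f : P -> R).
Hypotheses (sD : forall a b, s (a + b) = s a + s b)
  (sM : forall a b, s (a * b) = s a * s b) (s1 : s 1 = 1)
  (fD : forall p q, f (p + q) = f p + f q)
  (fZ : forall a p, f (a *: p) = s a * f p)
  (fR : forall a p, f (ract p a) = f p * s a)
  (fC : forall g h p q, homog g p -> homog h q ->
    f p * f q = ksgn R g h * (f q * f p)).

Local Notation lift := (tens_lift s f).
Let liftD := tens_liftD sD sM s1 fD fZ fR.
Let liftM := tens_liftM sD sM s1 fD fZ fR.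
Let lift_scal := tens_lift_scal sD sM s1 fD fZ fR.
Let lift_gen := tens_lift_gen sD sM s1 fD fZ fR.

Let lift0 : lift 0 = 0.
Proof. by apply: (addIr (lift 0)); rewrite -liftD !add0r. Qed.

Let liftN x : lift (- x) = - lift x.
Proof. by apply/eqP; rewrite -addr_eq0 -liftD addNr lift0. Qed.

Let lift_ksgn (g h : 'rV['F_2]_n) : lift (ksgn _ g h) = ksgn _ g h.
Proof.
have lift1 : lift 1 = 1 by rewrite -(tscal1 P) lift_scal.
by rewrite /ksgn -signr_odd -[RHS]signr_odd; case: odd; rewrite ?expr1 ?liftN ?lift1.
Qed.

Let lift_ideal x : gen_ideal (@sym_relator n k A P) x -> lift x = 0.
Proof.
elim=> {x} [x [g [h [p [q [hp hq ->]]]]]|| x y _ hx _ hy| a x _ hx | a x _ hx].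
- by rewrite liftD liftN !liftM !lift_gen lift_ksgn (fC hp hq) subrr.
- exact: lift0.
- by rewrite liftD hx hy addr0.
- by rewrite liftM hx mulr0.
- by rewrite liftM hx mul0r.
Qed.

(** The target ring need not be commutative: it is $A$ for the augmentation, and a ring of
    $2\times2$ matrices for the contractions. *)
Definition symlift (x : symalg P) : R := lift (rqrepr x).

Let symlift_pi x : symlift (rqpi (@sym_relator n k A P) x) = lift x.
Proof. by apply/eqP; rewrite -subr_eq0 -liftN -liftD; apply/eqP/lift_ideal/rqrepr_pi. Qed.

Lemma symliftD x y : symlift (x + y) = symlift x + symlift y.
Proof.
rewrite -[x]rqpi_repr -[y]rqpi_repr -rqpiD !symlift_pi.
exact: liftD.
Qed.

Lemma symliftM x y : symlift (x * y) = symlift x * symlift y.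
Proof.
rewrite -[x]rqpi_repr -[y]rqpi_repr -rqpiM !symlift_pi.
exact: liftM.
Qed.

Lemma symlift_scal a : symlift (symscal P a) = s a.
Proof. by rewrite symlift_pi lift_scal. Qed.

Lemma symlift_gen p : symlift (symgen p) = f p.
Proof. by rewrite symlift_pi lift_gen. Qed.

End SymmetricLift.

(** * Sign twists of algebras and modules *)

Section Twist.
Variables (n : nat) (k : fieldType) (A : gcAlgType n k).
Implicit Types (g h : 'rV['F_2]_n) (a b : A).

Lemma rmorph_ksgn (R S : pzRingType) (f : R -> S) g h :
  (forall x, f (- x) = - f x) -> f 1 = 1 -> f (ksgn R g h) = ksgn S g h.
Proof.
move=> fN f1; rewrite /ksgn -signr_odd -[RHS]signr_odd.
by case: odd; rewrite ?expr1 ?fN ?f1.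
Qed.

(* [gammaC] with the ring structure of A in canonical form, for rewriting. *)
Lemma gcC g h a b : homog g a -> homog h b -> a * b = ksgn A g h * (b * a).
Proof. exact: gammaC. Qed.

Variable M : gmodType A.

(** The sign automorphism relative to which a contraction of degree [g] is a skew derivation; the
    counterpart of [twist] on modules. *)
Definition mtwist g (m : M) : M := \sum_h ksgn A g h *: gcomp h m.

Lemma mtwistD g : {morph mtwist g : x y / x + y}.
Proof.
by move=> x y; rewrite -big_split; apply: eq_bigr => h _; rewrite gcompD scalerDr.
Qed.

Lemma mtwist_homog g h m : homog h m -> mtwist g m = ksgn A g h *: m.
Proof.
move=> hm; rewrite /mtwist (bigD1 h) //= hm big1 ?addr0 // => h' hh'.
by rewrite (homog_comp _ hm) (negPf hh') scaler0.
Qed.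

Lemma mtwistZ g a m : mtwist g (a *: m) = twist g a *: mtwist g m.
Proof.
move: a; apply: (homog_ind (n := n)) => [x y hx hy|h a ha].
  by rewrite scalerDl mtwistD hx hy twistD scalerDl.
move: m; apply: (homog_ind (n := n)) => [x y hx hy|h' m hm].
  by rewrite scalerDr !mtwistD hx hy scalerDr.
rewrite (mtwist_homog g (homogZ ha hm)) (twist_homog g ha) (mtwist_homog g hm).
rewrite !scalerA; congr (_ *: _); rewrite ksgnDr -!mulrA; congr (_ * _).
exact: ksgn_comm.
Qed.

Lemma mtwist_ract g m a : mtwist g (ract m a) = ract (mtwist g m) (twist g a).
Proof.
move: a; apply: (homog_ind (n := n)) => [x y hx hy|h a ha].
  by rewrite ractDr mtwistD hx hy twistD ractDr.
move: m; apply: (homog_ind (n := n)) => [x y hx hy|h' m hm].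
  by rewrite ractDl !mtwistD hx hy ractDl.
have hm' : homog h' (ksgn A g h' *: m).
  by have := homogZ (homog_ksgn A g h') hm; rewrite add0r.
rewrite (twist_homog g ha) (mtwist_homog g hm) (mtwist_homog g (homog_ract ha hm)).
rewrite (ract_homog ha hm) (ract_homog (homog_ksgnM g h ha) hm').
rewrite !scalerA; congr (_ *: _); rewrite ksgnDr.
rewrite -(ksgn_comm g h' (_ * _)) !mulrA; congr (_ * a).
by rewrite -!mulrA ksgn_comm -mulrA.
Qed.

End Twist.

Section Triangular.
Variable R : pzRingType.

Definition tri (a b c : R) : 'M[R]_2 :=
  \matrix_(i, j) (if (i : nat) == 0%N then if (j : nat) == 0%N then a else b
                  else if (j : nat) == 0%N then 0 else c).

Lemma triD a b c a' b' c' :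
  tri a b c + tri a' b' c' = tri (a + a') (b + b') (c + c').
Proof. by apply/matrixP => i j; rewrite !mxE; do 2!case: eqP => // _; rewrite addr0. Qed.

Lemma triM a b c a' b' c' :
  tri a b c * tri a' b' c' = tri (a * a') (a * b' + b * c') (c * c').
Proof.
apply/matrixP => i j; rewrite mxE !big_ord_recl big_ord0 !mxE /= addr0.
by do 2!case: eqP => // _; rewrite ?(mulr0, mul0r, addr0, add0r).
Qed.

Lemma tri1 : tri 1 0 1 = 1.
Proof. by apply/matrixP => -[[|[|?]] ?] [[|[|?]] ?]; rewrite !mxE. Qed.

Lemma triN a b c : - tri a b c = tri (- a) (- b) (- c).
Proof. by apply/matrixP => i j; rewrite !mxE; do 2!case: eqP => // _; rewrite oppr0. Qed.

Lemma tri_ksgn n (g h : 'rV['F_2]_n) a b c :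
  ksgn _ g h * tri a b c = tri (ksgn _ g h * a) (ksgn _ g h * b) (ksgn _ g h * c).
Proof.
rewrite /ksgn -signr_odd -[(-1) ^+ dotp g h in RHS]signr_odd.
by case: odd; rewrite ?expr1 ?expr0 ?mulN1r ?mul1r // triN.
Qed.

End Triangular.

(** * Homogeneity and contractions *)

Section KoszulHomogeneous.
Variables (n : nat) (k : fieldType) (A : gcAlgType n k) (P : gmodType A).
Local Notation K := (symalg P).
Implicit Types (g h : 'rV['F_2]_n) (z w : K) (a : A) (y : P).

Lemma symscal_ksgn g h : symscal P (ksgn A g h) = ksgn K g h.
Proof.
apply: rmorph_ksgn => // x; apply: (addIr (symscal P x)); rewrite -symscalD !addNr.
by apply: (addIr (symscal P 0)); rewrite -symscalD !add0r.
Qed.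

Lemma symscal0 : symscal P 0 = 0.
Proof. by apply: (addIr (symscal P 0)); rewrite -symscalD !add0r. Qed.

Lemma symscal_genC g h a y : homog g a -> homog h y ->
  symscal P a * symgen y = ksgn _ g h * (symgen y * symscal P a).
Proof.
move=> ha hy; rewrite -symgen_ract (ract_homog ha hy) !symgenZ symscal_ksgn.
by rewrite [RHS]mulrA ksgn_sq mul1r.
Qed.

(** No grading of [K] is constructed: homogeneity is generated from scalars and generators, so that
    sign rules follow by induction on derivations. *)
Inductive khomog : 'rV['F_2]_n -> K -> Prop :=
  | khomog_scal g a : homog g a -> khomog g (symscal P a)
  | khomog_gen g y : homog g y -> khomog g (symgen y)
  | khomogD g z w : khomog g z -> khomog g w -> khomog g (z + w)
  | khomogM g h z w : khomog g z -> khomog h w -> khomog (g + h) (z * w).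

Lemma khomog1 : khomog 0 1.
Proof. exact/(khomog_scal (homog1 A)). Qed.

Lemma khomog0 g : khomog g 0.
Proof. by rewrite -symscal0; apply/khomog_scal/homog0. Qed.

Lemma khomog_ksgn g h h' z : khomog g z -> khomog g (ksgn _ h h' * z).
Proof.
move=> hz; rewrite -symscal_ksgn -[g]add0r.
exact/(khomogM _ hz)/khomog_scal/homog_ksgn.
Qed.

Lemma khomog_sum g I (s : seq I) (Q : pred I) (F : I -> K) :
  (forall i, Q i -> khomog g (F i)) -> khomog g (\sum_(i <- s | Q i) F i).
Proof. by move=> h; apply: big_ind => //; [exact: khomog0 | exact: khomogD]. Qed.

Lemma khomogC g h z w : khomog g z -> khomog h w ->
  z * w = ksgn _ g h * (w * z).
Proof.
(* A sign rule against $w'$ passes from two factors to their product; [flip] lets the same step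
   serve the second argument. *)
have mulC g1 g2 h' z1 z2 w' : z1 * w' = ksgn _ g1 h' * (w' * z1) ->
    z2 * w' = ksgn _ g2 h' * (w' * z2) ->
    z1 * z2 * w' = ksgn _ (g1 + g2) h' * (w' * (z1 * z2)).
  move=> e1 e2; rewrite -mulrA e2 [LHS]mulrA -[z1 * _]ksgn_comm -[LHS]mulrA.
  rewrite (mulrA z1) e1 -[in LHS](mulrA _ _ z2) [LHS]mulrA -(mulrA w') ksgnDl.
  by rewrite -[ksgn _ g2 h' * _]ksgn_comm.
have flip g' h' z' w' : z' * w' = ksgn _ g' h' * (w' * z') ->
    w' * z' = ksgn _ h' g' * (z' * w').
  by move=> ->; rewrite mulrA ksgnC ksgn_sq mul1r.
move=> hz; elim: hz h w => {g z} [g a ha|g y hy|g z z' _ hz _ hz'|g g' z z' _ hz _ hz'] h w hw.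
- elim: hw => {h w} [h b hb|h y hy|h w w' _ hw _ hw'|h h' w w' _ hw _ hw'].
  + by rewrite -!symscalM (gcC ha hb) [in LHS]symscalM symscal_ksgn.
  + exact: symscal_genC.
  + by rewrite mulrDr hw hw' mulrDl mulrDr.
  + by apply/flip/mulC; apply/flip.
- elim: hw => {h w} [h b hb|h x hx|h w w' _ hw _ hw'|h h' w w' _ hw _ hw'].
  + exact/flip/symscal_genC.
  + exact: symgenC.
  + by rewrite mulrDr hw hw' mulrDl mulrDr.
  + by apply/flip/mulC; apply/flip.
- by rewrite mulrDl (hz _ _ hw) (hz' _ _ hw) mulrDr mulrDr.
- by apply: mulC; [apply: hz | apply: hz'].
Qed.

(** Homogeneous elements are normal, since every element is built from homogeneous pieces commuting
    with [z] up to sign. One-sided multiples of [z] thus form two-sided ideals. *)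
Lemma khomog_normr g z : khomog g z -> forall w, exists w', w * z = z * w'.
Proof.
move=> hz; apply: symalg_ind => [a|y|w1 w2 [w1' h1] [w2' h2]|w1 w2 [w1' h1] [w2' h2]].
- move: a; apply: (homog_ind (n := n)) => [a b [u hu] [v hv]|h a ha].
    by exists (u + v); rewrite symscalD mulrDl hu hv mulrDr.
  exists (ksgn _ h g * symscal P a).
  by rewrite (khomogC (khomog_scal ha) hz) mulrA ksgn_comm -mulrA.
- move: y; apply: (homog_ind (n := n)) => [a b [u hu] [v hv]|h a ha].
    by exists (u + v); rewrite symgenD mulrDl hu hv mulrDr.
  exists (ksgn _ h g * symgen a).
  by rewrite (khomogC (khomog_gen ha) hz) mulrA ksgn_comm -mulrA.
- by exists (w1' + w2'); rewrite mulrDl h1 h2 mulrDr.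
- by exists (w1' * w2'); rewrite -mulrA h2 mulrA h1 mulrA.
Qed.

Lemma khomog_norml g z : khomog g z -> forall w, exists w', z * w = w' * z.
Proof.
move=> hz; apply: symalg_ind => [a|y|w1 w2 [w1' h1] [w2' h2]|w1 w2 [w1' h1] [w2' h2]].
- move: a; apply: (homog_ind (n := n)) => [a b [u hu] [v hv]|h a ha].
    by exists (u + v); rewrite symscalD mulrDr hu hv mulrDl.
  exists (ksgn _ g h * symscal P a).
  by rewrite (khomogC hz (khomog_scal ha)) mulrA.
- move: y; apply: (homog_ind (n := n)) => [a b [u hu] [v hv]|h a ha].
    by exists (u + v); rewrite symgenD mulrDr hu hv mulrDl.
  exists (ksgn _ g h * symgen a).
  by rewrite (khomogC hz (khomog_gen ha)) mulrA.
- by exists (w1' + w2'); rewrite mulrDr h1 h2 mulrDl.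
- by exists (w1' * w2'); rewrite mulrA h1 -mulrA h2 mulrA.
Qed.

Lemma khomog0_central z w : khomog 0 z -> z * w = w * z.
Proof.
move=> hz; move: w; apply: symalg_ind => [a|y|w1 w2 h1 h2|w1 w2 h1 h2].
- move: a; apply: (homog_ind (n := n)) => [a b ha hb|h a ha].
    by rewrite symscalD mulrDr ha hb mulrDl.
  by rewrite (khomogC hz (khomog_scal ha)) ksgn0l mul1r.
- move: y; apply: (homog_ind (n := n)) => [a b ha hb|h a ha].
    by rewrite symgenD mulrDr ha hb mulrDl.
  by rewrite (khomogC hz (khomog_gen ha)) ksgn0l mul1r.
- by rewrite mulrDr h1 h2 mulrDl.
- by rewrite mulrA h1 -mulrA h2 mulrA.
Qed.

Section Contraction.
Variables (g : 'rV['F_2]_n) (l : dual P).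
Hypothesis hl : homog g l.

(** Carrying [a] past a functional of degree [g] costs a sign; this makes [ctr_gen] compatible with
    the left action. *)
Lemma dual_twist a y : l (a *: y) = twist g a * l y.
Proof.
move: a; apply: (homog_ind (n := n)) => [x x' hx hx'|h a ha].
  by rewrite scalerDl dualD hx hx' twistD mulrDl.
move: y; apply: (homog_ind (n := n)) => [x x' hx hx'|h' y hy].
  by rewrite scalerDr !dualD hx hx' mulrDr.
have -> : a *: y = ract y (ksgn A h h' * a).
  by rewrite (ract_homog (homog_ksgnM h h' ha) hy) scalerA mulrA ksgn_sq mul1r.
have /homog_dualP/(_ _ _ hy) hly := hl.
rewrite dual_ract (twist_homog g ha) mulrA -(ksgn_comm h h' (l y)) -mulrA.
rewrite (gcC hly ha) -[ksgn A g h * a * _]mulrA !mulrA; congr (_ * _ * _).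
by rewrite ksgnDl (ksgnC _ h' h) ksgn_comm mulrA ksgn_sq mul1r.
Qed.

(* A skew derivation D relative to an automorphism t is the same thing as a    *)
(* ring morphism z |-> [[t z, D z], [0, z]].                                    *)
Definition ctr_scal a : 'M[K]_2 := tri (symscal P (twist g a)) 0 (symscal P a).
Definition ctr_gen y : 'M[K]_2 :=
  tri (symgen (mtwist g y)) (symscal P (l y)) (symgen y).
Definition ctr_mx z : 'M[K]_2 := symlift ctr_scal ctr_gen z.

Fact ctr_scalD a b : ctr_scal (a + b) = ctr_scal a + ctr_scal b.
Proof. by rewrite /ctr_scal twistD !symscalD triD addr0. Qed.
Fact ctr_scalM a b : ctr_scal (a * b) = ctr_scal a * ctr_scal b.
Proof. by rewrite /ctr_scal twistM !symscalM triM mulr0 mul0r addr0. Qed.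
Fact ctr_scal1 : ctr_scal 1 = 1.
Proof. by rewrite /ctr_scal twist1 -tri1. Qed.
Fact ctr_genD x y : ctr_gen (x + y) = ctr_gen x + ctr_gen y.
Proof. by rewrite /ctr_gen mtwistD dualD symscalD !symgenD triD. Qed.
Fact ctr_genZ a y : ctr_gen (a *: y) = ctr_scal a * ctr_gen y.
Proof.
by rewrite /ctr_gen mtwistZ dual_twist symscalM !symgenZ triM mul0r addr0.
Qed.
Fact ctr_gen_ract a y : ctr_gen (ract y a) = ctr_gen y * ctr_scal a.
Proof.
by rewrite /ctr_gen mtwist_ract dual_ract symscalM !symgen_ract triM mulr0 add0r.
Qed.
Fact ctr_genC h h' x y : homog h x -> homog h' y ->
  ctr_gen x * ctr_gen y = ksgn _ h h' * (ctr_gen y * ctr_gen x).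
Proof.
move=> hx hy; rewrite /ctr_gen !(mtwist_homog g hx, mtwist_homog g hy).
rewrite !triM tri_ksgn !symgenZ !symscal_ksgn.
have /homog_dualP/(_ _ _ hx) hlx := hl; have /homog_dualP/(_ _ _ hy) hly := hl.
congr tri.
- rewrite -!mulrA (ksgnCA g h' (symgen x)) (ksgnCA g h (symgen y)) (symgenC hx hy).
  by rewrite (ksgnCA h h' (ksgn _ g h')) (ksgnCA h h' (ksgn _ g h)) (ksgnCA g h' (ksgn _ g h)).
- rewrite mulrDr addrC; congr (_ + _).
    by rewrite (symscal_genC hlx hy) ksgnDl -!mulrA (ksgnCA h h').
  by rewrite (symscal_genC hly hx) ksgnDl -!mulrA (ksgnC _ h' h) (ksgnCA h h') ksgnK.
- exact: symgenC.
Qed.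

Let ctr_mxD z w : ctr_mx (z + w) = ctr_mx z + ctr_mx w.
Proof.
exact: (symliftD ctr_scalD ctr_scalM ctr_scal1 ctr_genD ctr_genZ
  ctr_gen_ract ctr_genC).
Qed.
Let ctr_mxM z w : ctr_mx (z * w) = ctr_mx z * ctr_mx w.
Proof.
exact: (symliftM ctr_scalD ctr_scalM ctr_scal1 ctr_genD ctr_genZ
  ctr_gen_ract ctr_genC).
Qed.
Let ctr_mx_scal a : ctr_mx (symscal P a) = ctr_scal a.
Proof.
exact: (symlift_scal ctr_scalD ctr_scalM ctr_scal1 ctr_genD ctr_genZ
  ctr_gen_ract ctr_genC).
Qed.
Let ctr_mx_gen y : ctr_mx (symgen y) = ctr_gen y.
Proof.
exact: (symlift_gen ctr_scalD ctr_scalM ctr_scal1 ctr_genD ctr_genZ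
  ctr_gen_ract ctr_genC).
Qed.

Definition contract z : K := ctr_mx z ord0 (lift ord0 ord0).
Definition ktwist z : K := ctr_mx z ord0 ord0.

Let ctr_mxE z : ctr_mx z = tri (ktwist z) (contract z) z.
Proof.
apply: (symalg_ind (Q := fun z => ctr_mx z = tri (ktwist z) (contract z) z)).
- by move=> a; rewrite /ktwist /contract ctr_mx_scal !mxE.
- by move=> y; rewrite /ktwist /contract ctr_mx_gen !mxE.
- move=> x y hx hy; rewrite /ktwist /contract ctr_mxD.
  by rewrite hx hy triD !mxE.
- move=> x y hx hy; rewrite /ktwist /contract ctr_mxM.
  by rewrite hx hy triM !mxE.
Qed.

Lemma contractD z w : contract (z + w) = contract z + contract w.
Proof. by rewrite {1}/contract ctr_mxD !mxE. Qed.

Lemma contract_scal a : contract (symscal P a) = 0.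
Proof. by rewrite /contract ctr_mx_scal !mxE. Qed.

Lemma contract_gen y : contract (symgen y) = symscal P (l y).
Proof. by rewrite /contract ctr_mx_gen !mxE. Qed.

Lemma ktwist_khomog h z : khomog h z -> ktwist z = ksgn _ g h * z.
Proof.
elim=> {h z} [h a ha|h y hy|h z w _ hz _ hw|h h' z w _ hz _ hw].
- by rewrite /ktwist ctr_mx_scal !mxE (twist_homog g ha) symscalM symscal_ksgn.
- by rewrite /ktwist ctr_mx_gen !mxE (mtwist_homog g hy) symgenZ symscal_ksgn.
- by rewrite {1}/ktwist ctr_mxD mxE -!/(ktwist _) hz hw mulrDr.
- rewrite {1}/ktwist ctr_mxM !ctr_mxE triM mxE /= hz hw ksgnDr -!mulrA.
  by rewrite ksgnCA.
Qed.

(** The skew Leibniz rule is the upper right entry of a product of triangular matrices. *)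
Lemma contractM h z w : khomog h z ->
  contract (z * w) = contract z * w + ksgn _ g h * (z * contract w).
Proof.
move=> hz; rewrite {1}/contract ctr_mxM !ctr_mxE triM mxE /=.
by rewrite (ktwist_khomog hz) mulrA addrC.
Qed.

Lemma contract_genM h y w : homog h y ->
  contract (symgen y * w) = symscal P (l y) * w + ksgn _ g h * (symgen y * contract w).
Proof. by move=> hy; rewrite (contractM _ (khomog_gen hy)) contract_gen. Qed.

Lemma contract_scalr z a : contract (z * symscal P a) = contract z * symscal P a.
Proof.
rewrite {1}/contract ctr_mxM !ctr_mxE triM mxE /=.
by rewrite contract_scal mulr0 add0r.
Qed.

Lemma contract0 : contract 0 = 0.
Proof. by apply: (addIr (contract 0)); rewrite -contractD !add0r. Qed.

Lemma contract_sum I (s : seq I) (Q : pred I) (F : I -> K) :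
  contract (\sum_(i <- s | Q i) F i) = \sum_(i <- s | Q i) contract (F i).
Proof. exact: (big_morph contract contractD contract0). Qed.

Lemma contract_ksgn h h' z : contract (ksgn _ h h' * z) = ksgn _ h h' * contract z.
Proof.
rewrite -symscal_ksgn (contractM _ (khomog_scal (homog_ksgn _ _ _))) contract_scal.
by rewrite mul0r add0r ksgnC ksgn0l mul1r.
Qed.

Lemma contract_khomog h z : khomog h z -> khomog (g + h) (contract z).
Proof.
elim=> {h z} [h a ha|h y hy|h z w _ hz _ hw|h h' z w hz hz' hw hw'].
- by rewrite contract_scal; apply: khomog0.
- by rewrite contract_gen; apply: khomog_scal; move/homog_dualP: hl; apply.
- by rewrite contractD; apply: khomogD.
- rewrite (contractM _ hz); apply: khomogD; first by rewrite addrA; apply: khomogM.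
  by apply: khomog_ksgn; rewrite addrCA; apply: khomogM.
Qed.

End Contraction.

Definition augment z : A := symlift id (fun _ : P => 0 : A) z.

Lemma augmentD z w : augment (z + w) = augment z + augment w.
Proof. by apply: symliftD => // *; rewrite ?(addr0, mulr0, mul0r). Qed.

Lemma augmentM z w : augment (z * w) = augment z * augment w.
Proof. by apply: symliftM => // *; rewrite ?(addr0, mulr0, mul0r). Qed.

Lemma augment_scal a : augment (symscal P a) = a.
Proof. by apply: symlift_scal => // *; rewrite ?(addr0, mulr0, mul0r). Qed.

Lemma augment_gen y : augment (symgen y) = 0.
Proof. by apply: symlift_gen => // *; rewrite ?(addr0, mulr0, mul0r). Qed.

Lemma augment_khomog g z : khomog g z -> homog g (augment z).
Proof.
elim=> {g z} [g a ha|g y hy|g z w _ hz _ hw|g h z w _ hz _ hw].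
- by rewrite augment_scal.
- by rewrite augment_gen; apply: homog0.
- by rewrite augmentD; apply: homogD.
- by rewrite augmentM; apply: homogM.
Qed.

End KoszulHomogeneous.

Lemma ksgn_even n (R : pzRingType) (g : 'rV['F_2]_n) : dotp g g = 0 -> ksgn R g g = 1.
Proof. by rewrite /ksgn => ->. Qed.

Lemma ksgn_odd n (R : pzRingType) (g : 'rV['F_2]_n) : dotp g g = 1 -> ksgn R g g = -1.
Proof. by rewrite /ksgn => ->. Qed.

(** * The Koszul differential *)

Section KoszulFrame.
Variables (n : nat) (k : fieldType) (A : gcAlgType n k) (P : gmodType A).
Variables (I : finType) (p : 'rV['F_2]_n).

(* [kX i] and [kXi i] are x_i and xi_i, of degrees [dX i] and [dXi i]; [lX i]   *)
(* and [lXi i] are the dual functionals.                                        *)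
Record koszul_frame := KoszulFrame {
  kX : I -> P; kXi : I -> P;
  dX : I -> 'rV['F_2]_n; dXi : I -> 'rV['F_2]_n;
  lX : I -> dual P; lXi : I -> dual P;
  homog_kX : forall i, homog (dX i) (kX i);
  homog_kXi : forall i, homog (dXi i) (kXi i);
  homog_lX : forall i, homog (dX i) (lX i);
  homog_lXi : forall i, homog (dXi i) (lXi i);
  lX_kX : forall i j, lX i (kX j) = (i == j)%:R;
  lX_kXi : forall i j, lX i (kXi j) = 0;
  lXi_kX : forall i j, lXi i (kX j) = 0;
  lXi_kXi : forall i j, lXi i (kXi j) = (i == j)%:R;
  dXD : forall i, dX i + dXi i = p;
  dX_even : forall i, dotp (dX i) (dX i) = 0;
  dXi_odd : forall i, dotp (dXi i) (dXi i) = 1;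
  frame_span : forall y, exists c d : I -> A,
    y = \sum_i (c i *: kX i + d i *: kXi i) }.

Variable F : koszul_frame.
Hypotheses (k_char0 : [pchar k] =i pred0) (p_odd : dotp p p = 1).

Local Notation K := (symalg P).
Local Notation "s %:S" := (symscal P s) (at level 2, format "s %:S").
Implicit Types (g h : 'rV['F_2]_n) (i j : I) (z w : K) (a : A) (l : seq I).

Definition kx i : K := symgen (kX F i).
Definition kxi i : K := symgen (kXi F i).
Definition Dx i z : K := contract (dX F i) (lX F i) z.
Definition Dxi i z : K := contract (dXi F i) (lXi F i) z.
Definition kom : K := \sum_i kxi i * kx i.

Lemma khomog_kx i : khomog (dX F i) (kx i).
Proof. exact/khomog_gen/homog_kX. Qed.

Lemma khomog_kxi i : khomog (dXi F i) (kxi i).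
Proof. exact/khomog_gen/homog_kXi. Qed.

Lemma khomog_kom : khomog p kom.
Proof.
apply: khomog_sum => i _; rewrite -(dXD F i) addrC.
exact/khomogM/khomog_kx/khomog_kxi.
Qed.

Lemma symscal_nat m : (m%:R)%:S = m%:R.
Proof.
elim: m => [|m IH]; first exact: symscal0.
by rewrite -addn1 natrD symscalD IH symscal1 natrD.
Qed.

Lemma symscal_sign (b : nat) : ((-1) ^+ b)%:S = (-1) ^+ b.
Proof.
rewrite -signr_odd -[RHS]signr_odd; case: odd => //; rewrite !expr1.
by apply/eqP; rewrite -addr_eq0 -symscal1 -symscalD addNr symscal0.
Qed.

(** The inverse of $m+1$ exists in [k], hence among the scalars of [K]. *)
Lemma torsion_free m z : z *+ m.+1 = 0 -> z = 0.
Proof.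
move=> h; have m0 : m.+1%:R != 0 :> k.
  by move: k_char0 => /pcharf0P ->.
pose c := ((m.+1%:R^-1 : k) *: (1 : A)).
have hc : m.+1%:R * c = 1 :> A.
  by rewrite -scaler_nat -scalerAl mul1r scalerA mulfV // scale1r.
rewrite -[z]mulr1 -(symscal1 P) -hc symscalM mulrA symscal_nat.
by rewrite mulr_natr h mul0r.
Qed.

Lemma oppr_eq z : z = - z -> z = 0.
Proof. by move=> h; apply: (@torsion_free 1); rewrite mulr2n {2}h subrr. Qed.

Lemma kom_sq : kom * kom = 0.
Proof.
by apply: oppr_eq; rewrite {1}(khomogC khomog_kom khomog_kom) ksgn_odd // mulN1r.
Qed.

Lemma kxi_sq i : kxi i * kxi i = 0.
Proof.
apply: oppr_eq; rewrite {1}(khomogC (khomog_kxi i) (khomog_kxi i)).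
by rewrite ksgn_odd ?mulN1r // dXi_odd.
Qed.

Lemma Dx_kx i j z :
  Dx i (kx j * z) = (i == j)%:R * z + ksgn _ (dX F i) (dX F j) * (kx j * Dx i z).
Proof.
by rewrite /Dx (contract_genM (homog_lX F i) _ (homog_kX F j)) lX_kX symscal_nat.
Qed.

Lemma Dx_kxi i j z :
  Dx i (kxi j * z) = ksgn _ (dX F i) (dXi F j) * (kxi j * Dx i z).
Proof.
rewrite /Dx (contract_genM (homog_lX F i) _ (homog_kXi F j)) lX_kXi.
by rewrite symscal0 mul0r add0r.
Qed.

Lemma Dxi_kx i j z :
  Dxi i (kx j * z) = ksgn _ (dXi F i) (dX F j) * (kx j * Dxi i z).
Proof.
rewrite /Dxi (contract_genM (homog_lXi F i) _ (homog_kX F j)) lXi_kX.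
by rewrite symscal0 mul0r add0r.
Qed.

Lemma Dxi_kxi i j z :
  Dxi i (kxi j * z) = (i == j)%:R * z + ksgn _ (dXi F i) (dXi F j) * (kxi j * Dxi i z).
Proof.
by rewrite /Dxi (contract_genM (homog_lXi F i) _ (homog_kXi F j)) lXi_kXi symscal_nat.
Qed.

Lemma DxD i z w : Dx i (z + w) = Dx i z + Dx i w.
Proof. exact: contractD (homog_lX F i) _ _. Qed.

Lemma DxiD i z w : Dxi i (z + w) = Dxi i z + Dxi i w.
Proof. exact: contractD (homog_lXi F i) _ _. Qed.

Lemma Dx1 i : Dx i 1 = 0.
Proof. exact: contract_scal (homog_lX F i) 1. Qed.

Lemma Dxi1 i : Dxi i 1 = 0.
Proof. exact: contract_scal (homog_lXi F i) 1. Qed.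

(** * The homotopy and its Laplacian *)

Lemma sum_delta (G : I -> K) j : \sum_i (i == j)%:R * G i = G j.
Proof.
rewrite (bigD1 j) //= eqxx mul1r big1 ?addr0 // => i /negPf ->.
by rewrite mul0r.
Qed.

Definition khtpy z : K := \sum_i Dx i (Dxi i z).

Lemma khtpyD z w : khtpy (z + w) = khtpy z + khtpy w.
Proof. by rewrite -big_split; apply: eq_bigr => i _; rewrite DxiD DxD. Qed.

Lemma khtpy0 : khtpy 0 = 0.
Proof. by apply: (addIr (khtpy 0)); rewrite -khtpyD !add0r. Qed.

Lemma khtpy_ksgn g h z : khtpy (ksgn _ g h * z) = ksgn _ g h * khtpy z.
Proof.
rewrite mulr_sumr; apply: eq_bigr => i _.
by rewrite /Dxi (contract_ksgn (homog_lXi F i)) /Dx (contract_ksgn (homog_lX F i)).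
Qed.

Lemma khtpy_kx j z : khtpy (kx j * z) =
  ksgn _ p (dX F j) * (kx j * khtpy z) + ksgn _ (dXi F j) (dX F j) * Dxi j z.
Proof.
rewrite -[X in _ + X](sum_delta (fun i => ksgn K (dXi F i) (dX F j) * Dxi i z)).
rewrite !mulr_sumr -big_split; apply: eq_bigr => i _ /=.
rewrite Dxi_kx /Dx (contract_ksgn (homog_lX F i)) -/(Dx i _) Dx_kx mulrDr addrC.
rewrite -(dXD F i) [dX F i + _]addrC ksgnDl -mulrA; congr (_ + _).
exact/esym/ksgnCA.
Qed.

Lemma khtpy_kxi j z :
  khtpy (kxi j * z) = ksgn _ p (dXi F j) * (kxi j * khtpy z) + Dx j z.
Proof.
rewrite -[X in _ + X](sum_delta (fun i => Dx i z)).
rewrite !mulr_sumr -big_split; apply: eq_bigr => i _ /=.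
rewrite Dxi_kxi DxD addrC; congr (_ + _).
  by case: (i == j); rewrite /= ?mul1r ?mul0r // /Dx (contract0 (homog_lX F i)).
rewrite /Dx (contract_ksgn (homog_lX F i)) -/(Dx i _) Dx_kxi.
by rewrite -(dXD F i) [dX F i + _]addrC ksgnDl -mulrA.
Qed.

Lemma kom_gen g y z : homog g y ->
  kom * (symgen y * z) = ksgn _ p g * (symgen y * (kom * z)).
Proof. by move=> hy; rewrite mulrA (khomogC khomog_kom (khomog_gen hy)) -!mulrA. Qed.

Lemma Dxi_kom j z :
  Dxi j (kom * z) = kx j * z + ksgn _ (dXi F j) p * (kom * Dxi j z).
Proof.
rewrite /Dxi (contractM (homog_lXi F j) _ khomog_kom) -!/(Dxi j _).
congr (_ * z + _); rewrite /Dxi (contract_sum (homog_lXi F j)).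
rewrite -[RHS](sum_delta kx); apply: eq_bigr => i _; rewrite -/(Dxi j _) Dxi_kxi.
by rewrite eq_sym -[kx i]mulr1 Dxi_kx Dxi1 !mulr0 mulr1 addr0.
Qed.

Lemma Dx_kom j z : Dx j (kom * z) =
  ksgn _ (dX F j) (dXi F j) * (kxi j * z) + ksgn _ (dX F j) p * (kom * Dx j z).
Proof.
rewrite /Dx (contractM (homog_lX F j) _ khomog_kom) -!/(Dx j _) [X in _ = X + _]mulrA.
congr (_ * z + _); rewrite /Dx (contract_sum (homog_lX F j)).
rewrite -[RHS](sum_delta (fun i => ksgn K (dX F j) (dXi F i) * kxi i)).
apply: eq_bigr => i _; rewrite -/(Dx j _) Dx_kxi -[kx i]mulr1 Dx_kx Dx1 !mulr0 addr0.
by rewrite mulr1 eq_sym; case: (i == j); rewrite /= ?(mulr1n, mulr0n) ?mulr1 ?mul1r ?mulr0 ?mul0r.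
Qed.

(* The Laplacian; it multiplies a monomial by r + deg_x - deg_xi, which is     *)
(* positive except on multiples of xi_1 ... xi_r.                              *)
Definition klap z : K := kom * khtpy z + khtpy (kom * z).

Lemma klapD z w : klap (z + w) = klap z + klap w.
Proof. by rewrite /klap khtpyD !mulrDr khtpyD addrACA. Qed.

(** Both halves of the anticommutator produce the term $d\,\partial_{\xi_j}z$; as $p$ is the sum of
    the degrees of $x_j$ (even) and $\xi_j$ (odd), the signs are opposite. Only $x_jz$, from
    differentiating [kom], survives. For [klap_kxi] the oddness of $\xi_j$ turns the surviving term
    negative. *)
Lemma klap_kx j z : klap (kx j * z) = kx j * klap z + kx j * z.
Proof.
have sE : ksgn K p (dX F j) = ksgn K (dXi F j) (dX F j).
  by rewrite -(dXD F j) ksgnDl ksgn_even ?mul1r ?dX_even.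
have sO : ksgn K (dXi F j) p = - ksgn K (dXi F j) (dX F j).
  by rewrite -(dXD F j) ksgnDr (@ksgn_odd _ _ (dXi F j)) ?dXi_odd // mulrN1.
rewrite /klap khtpy_kx (kom_gen _ (homog_kX F j)) khtpy_ksgn khtpy_kx Dxi_kom.
rewrite -sE in sO *; rewrite sO mulNr !mulrDr !ksgnCA ksgnN !ksgnK.
rewrite (kom_gen _ (homog_kX F j)) ksgnK.
rewrite mulrN -[LHS]addrA [kx j * khtpy _ + _]addrA [ksgn _ _ _ * _ + _]addrC subrK.
by rewrite addrA.
Qed.

Lemma klap_kxi j z : klap (kxi j * z) = kxi j * klap z - kxi j * z.
Proof.
have sE : ksgn K p (dXi F j) = - ksgn K (dX F j) (dXi F j).
  by rewrite -(dXD F j) ksgnDl (@ksgn_odd _ _ (dXi F j)) ?dXi_odd // mulrN1.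
have sO : ksgn K (dX F j) p = ksgn K (dX F j) (dXi F j).
  by rewrite -(dXD F j) ksgnDr (@ksgn_even _ _ (dX F j)) ?dX_even // mul1r.
rewrite /klap khtpy_kxi (kom_gen _ (homog_kXi F j)) khtpy_ksgn khtpy_kxi Dx_kom sO.
rewrite !mulrDr (ksgnCA p (dXi F j) kom) (kom_gen _ (homog_kXi F j)) !ksgnK sE.
rewrite !mulNr !ksgnK -[LHS]addrA [kxi j * khtpy _ + _]addrA [kom * Dx _ _ + _]addrC subrK.
by rewrite addrA.
Qed.

Lemma klap0 : klap 0 = 0.
Proof. by apply: (addIr (klap 0)); rewrite -klapD !add0r. Qed.

Lemma klapN z : klap (- z) = - klap z.
Proof. by apply/eqP; rewrite -addr_eq0 -klapD addNr klap0. Qed.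

Lemma klapMn z m : klap (z *+ m) = klap z *+ m.
Proof. by elim: m => [|m IH]; rewrite ?mulr0n ?klap0 // !mulrS klapD IH. Qed.

Lemma khtpy_scalr z a : khtpy (z * a%:S) = khtpy z * a%:S.
Proof.
rewrite mulr_suml; apply: eq_bigr => i _.
by rewrite /Dxi (contract_scalr (homog_lXi F i)) /Dx (contract_scalr (homog_lX F i)).
Qed.

Lemma klap_scalr z a : klap (z * a%:S) = klap z * a%:S.
Proof. by rewrite /klap mulrA !khtpy_scalr mulrDl mulrA. Qed.

Lemma klap1 : klap 1 = #|I|%:R.
Proof.
have khtpy1 : khtpy 1 = 0.
  by apply: big1 => i _; rewrite Dxi1 /Dx (contract0 (homog_lX F i)).
rewrite /klap khtpy1 mulr0 add0r mulr1 (big_morph khtpy khtpyD khtpy0) -sumr_const.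
apply: eq_bigr => i _; rewrite khtpy_kxi -[kx i]mulr1 khtpy_kx khtpy1 Dxi1 !(mulr0, add0r).
by rewrite Dx_kx eqxx mulr1 Dx1 !mulr0 addr0.
Qed.

(** * Monomials and the decomposition of cycles *)

Definition kxis l : K := \prod_(i <- l) kxi i.
Definition kxs l : K := \prod_(i <- l) kx i.

Lemma klap_kxis l z : klap (kxis l * z) = kxis l * klap z - kxis l * z *+ size l.
Proof.
elim: l => [|i l IH] /=; first by rewrite /kxis big_nil !mul1r mulr0n subr0.
rewrite /kxis big_cons -mulrA klap_kxi IH mulrBr -!mulrA mulrnAr -addrA; congr (_ + _).
by rewrite mulrSr opprD.
Qed.

Lemma klap_kxs l z : klap (kxs l * z) = kxs l * klap z + kxs l * z *+ size l.
Proof.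
elim: l => [|i l IH] /=; first by rewrite /kxs big_nil !mul1r mulr0n addr0.
rewrite /kxs big_cons -mulrA klap_kx IH mulrDr -!mulrA mulrnAr -addrA; congr (_ + _).
by rewrite mulrSr.
Qed.

Lemma khomog_kxis l : khomog (\sum_(i <- l) dXi F i) (kxis l).
Proof.
elim: l => [|i l IH]; first by rewrite /kxis !big_nil; apply: khomog1.
by rewrite /kxis !big_cons; apply: khomogM IH; apply: khomog_kxi.
Qed.

(* The factor z is harmless, as xi_i is normal in K. *)
Lemma kxi_kxis i l z : i \in l -> kxi i * z * kxis l = 0.
Proof.
move=> il; have [z' ->] := khomog_norml (khomog_kxi i) z; rewrite -mulrA.
suff -> : kxi i * kxis l = 0 by rewrite mulr0.
elim: l il => // j l IH; rewrite inE /kxis big_cons mulrA.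
have [<- _|_ /= /IH h] := eqVneq i j; first by rewrite kxi_sq mul0r.
by rewrite (khomogC (khomog_kxi i) (khomog_kxi j)) -!mulrA [kxi i * _]h !mulr0.
Qed.

Lemma kxis_nuniq l : ~~ uniq l -> kxis l = 0.
Proof.
elim: l => // i l IH /=; rewrite negb_and negbK /kxis big_cons -/(kxis l) => /orP[il|/IH ->].
  by have := kxi_kxis 1 il; rewrite mulr1.
by rewrite mulr0.
Qed.

Lemma kxis_perm l l' : perm_eq l l' -> exists b : nat, kxis l = (-1) ^+ b * kxis l'.
Proof.
move=> ll'; pose Q s := exists b : nat, kxis l = (-1) ^+ b * kxis s.
apply: (catCA_perm_ind (P := Q)) ll' _ => [s1 s2 s3 [b hb]|]; last first.
  by exists 0%N; rewrite mul1r.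
exists (b + dotp (\sum_(i <- s1) dXi F i)%R (\sum_(i <- s2) dXi F i)%R)%N.
rewrite hb /kxis !big_cat /= exprD -mulrA; congr (_ * _).
by rewrite mulrA (khomogC (khomog_kxis s1) (khomog_kxis s2)) -!mulrA.
Qed.

Lemma kom_kxis s : (forall i, i \in s) -> kom * kxis s = 0.
Proof. by move=> hs; rewrite mulr_suml big1 // => i _; rewrite kxi_kxis. Qed.

(* Annihilates the eigenvectors of [klap] with eigenvalue 1, ..., j, while for a *)
(* cycle z, [kill j z] is homologous to (-1)^j j! z.                            *)
Fixpoint kill (j : nat) z : K :=
  if j is j'.+1 then klap (kill j' z) - kill j' z *+ j else z.

Lemma killD (j : nat) z w : kill j (z + w) = kill j z + kill j w.
Proof.
elim: j => //= j IH; rewrite IH klapD mulrnDl opprD.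
exact: addrACA.
Qed.

Lemma kill0 (j : nat) : kill j 0 = 0.
Proof. by elim: j => //= j ->; rewrite klap0 mul0rn subr0. Qed.

(** [kill j] is the composite of the operators $\Delta-i$ for $1\le i\le j$, and the factor with
    $i=m$ annihilates [z]. *)
Lemma kill_eigen m z (j : nat) : klap z = z *+ m -> (0 < m <= j)%N -> kill j z = 0.
Proof.
move=> hm /andP[m0 mj].
have he (i : nat) : klap (kill i z) = kill i z *+ m.
  elim: i => /= [|i IH]; first exact: hm.
  by rewrite !IH klapD klapN !klapMn !IH mulrnBl; congr (_ - _); apply: mulrnAC.
case: m hm m0 mj he => // m hm _ mj he; rewrite -(subnK mj).
elim: (j - _)%N => [|i IH]; first by rewrite /= he subrr.
by rewrite addSn /= IH klap0 mul0rn subr0.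
Qed.

(** On a cycle $\Delta$ takes values in boundaries, so the factor $\Delta-i$ acts as $-i$ modulo
    boundaries. *)
Lemma kill_cycle z (j : nat) : kom * z = 0 -> exists y : K,
  kill j z = (-1) ^+ j * (z *+ j`!) + kom * y.
Proof.
move=> hz; elim: j => [|j [y hy]] /=; first by exists 0; rewrite mul1r mulr0 addr0.
have hk : kom * kill j z = 0.
  rewrite hy mulrDr (mulrA kom kom) kom_sq mul0r addr0 mulrA (commr_sign kom j).
  by rewrite -mulrA mulrnAr hz mul0rn mulr0.
exists (khtpy (kill j z) - y *+ j.+1); rewrite /klap hk khtpy0 addr0 mulrBr addrCA.
congr (_ + _); rewrite {1}hy mulrnDl opprD; congr (_ - _); last by rewrite mulrnAr.
by rewrite exprS mulN1r mulNr factS mulnC mulrnA [in RHS]mulrnAr.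
Qed.

Variable s : seq I.
Hypotheses (s_uniq : uniq s) (s_all : forall i, i \in s).

(** Graded commutativity sorts every product into $\xi$'s, then $x$'s, then a coefficient. This is
    spanning only; no linear independence is asserted. *)
Lemma symalg_normal_form (Q : K -> Prop) :
  (forall z w, Q z -> Q w -> Q (z + w)) ->
  (forall l l' a, Q (kxis l * (kxs l' * a%:S))) -> forall z, Q z.
Proof.
move=> QD Qm.
(* N is the additive span of the monomials; we show that it is a left ideal. *)
pose N z := forall R : K -> Prop, (forall z w, R z -> R w -> R (z + w)) ->
  (forall l l' a, R (kxis l * (kxs l' * a%:S))) -> R z.
have ND u v : N u -> N v -> N (u + v).
  by move=> hu hv R RD Rm; apply: (RD); [apply: hu | apply: hv].
have Na a w : N w -> N (w * a%:S).
  move=> hw; apply: (hw (fun w => N (w * a%:S))) => [u v|l l' b].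
    by rewrite mulrDl; apply: ND.
  by move=> R _ Rm; rewrite -!mulrA -symscalM.
have Nsign g h w : N w -> N (ksgn _ g h * w).
  by move=> hw; rewrite ksgn_comm -symscal_ksgn; apply: Na.
have Nx i w : N w -> N (kx i * w).
  move=> hw; apply: (hw (fun w => N (kx i * w))) => [u v|l l' b].
    by rewrite mulrDr; apply: ND.
  rewrite mulrA (khomogC (khomog_kx i) (khomog_kxis l)) -!mulrA; apply: Nsign.
  by move=> R _ Rm; have := Rm l (i :: l') b; rewrite /kxs big_cons !mulrA.
have Nxi i w : N w -> N (kxi i * w).
  move=> hw; apply: (hw (fun w => N (kxi i * w))) => [u v|l l' b].
    by rewrite mulrDr; apply: ND.
  by move=> R _ Rm; have := Rm (i :: l) l' b; rewrite /kxis big_cons !mulrA.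
have N0 : N 0 by move=> R _ Rm; have := Rm [::] [::] 0; rewrite symscal0 !mulr0.
have Ns a w : N w -> N (a%:S * w).
  move=> hw; move: a; apply: (homog_ind (n := n)) => [a b ha hb|g a ha].
    by rewrite symscalD mulrDl; apply: ND.
  have hs l : khomog (\sum_(i <- l) dX F i) (kxs l).
    elim: l => [|i l IH]; first by rewrite /kxs !big_nil; apply: khomog1.
    by rewrite /kxs !big_cons; apply: khomogM IH; apply: khomog_kx.
  apply: (hw (fun w => N (a%:S * w))) => [u v|l l' b]; first by rewrite mulrDr; apply: ND.
  rewrite mulrA; have := khomogM (khomog_kxis l) (hs l').
  move=> /(khomogC (khomog_scal P ha)) e.
  rewrite -mulrA [kxis l * _]mulrA [a%:S * _]mulrA e -!mulrA; apply: Nsign.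
  by move=> R _ Rm; rewrite -symscalM.
have NM : forall z w, N w -> N (z * w).
  apply: symalg_ind => [a w|y w|u v hu hv w hw|u v hu hv w hw].
  - exact: Ns.
  - move=> hw; have [c [d ->]] := frame_span F y.
    rewrite symgen_sum mulr_suml; elim/big_ind: _ => // i _.
    rewrite symgenD !symgenZ mulrDl -!mulrA.
    by apply: ND; apply: Ns; [apply: Nx | apply: Nxi].
  - by rewrite mulrDl; apply: ND; [apply: hu | apply: hv].
  - by rewrite -mulrA; apply: (hu _ (hv _ hw)).
move=> z; rewrite -[z]mulr1; apply: NM QD Qm => R _ Rm.
by have := Rm [::] [::] 1; rewrite /kxis /kxs !big_nil !mul1r.
Qed.

(** A monomial without repeated $\xi$ has eigenvalue $m=r-\deg_\xi+\deg_x$. If $m>0$ it is killed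
    from index $m$ on; if $m=0$ it is $\pm\xi_1\cdots\xi_r$ times a scalar and goes into [a]. The
    claim for all larger indices lets sums take the maximum of two bounds. *)
Lemma kill_all z : exists a B,
  forall B', (B <= B')%N -> kill B' (z - kxis s * a%:S) = 0.
Proof.
move: z; apply: symalg_normal_form => [z w [a [B ha]] [b [C hb]]|l l' a].
  exists (a + b), (maxn B C) => B'; rewrite geq_max => /andP[hB hC].
  by rewrite symscalD mulrDr opprD addrACA killD ha // hb // addr0.
have [lu|/kxis_nuniq ->] := boolP (uniq l); last first.
  exists 0, 1%N => B' hB; rewrite symscal0 mulr0 mul0r subr0.
  by apply: (kill_eigen (m := 1)) => //; rewrite klap0 mul0rn.
have ls : (size l <= #|I|)%N by rewrite -(card_uniqP lu) max_card.
pose m := (#|I| - size l + size l')%N.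
have hm : klap (kxis l * (kxs l' * a%:S)) = kxis l * (kxs l' * a%:S) *+ m.
  rewrite klap_kxis klap_kxs -[X in klap X]mul1r klap_scalr klap1 mulr_natl.
  rewrite mulrDr !mulrnAr -mulrnDr -mulrnBr; last exact: leq_trans ls (leq_addr _ _).
  by rewrite /m addnC -addnBA // addnC.
have [m0|m0] := posnP m; last first.
  exists 0, m => B' hB; rewrite symscal0 mulr0 subr0.
  by apply: (kill_eigen hm); rewrite m0.
have /eqP := m0; rewrite addn_eq0 subn_eq0 size_eq0 => /andP[Il /eqP ->].
have hI : size l = #|I| by apply/eqP; rewrite eqn_leq ls.
have ps : perm_eq l s.
  apply: uniq_perm => // i; rewrite s_all.
  by have /= := (subset_cardP _ (subset_predT (mem l))) => ->; rewrite // (card_uniqP lu).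
have [b ->] := kxis_perm ps; exists ((-1) ^+ b * a), 0%N => B' _.
suff -> : (-1) ^+ b * kxis s * (kxs [::] * a%:S) = kxis s * ((-1) ^+ b * a)%:S.
  by rewrite subrr kill0.
rewrite symscalM symscal_sign /kxs big_nil mul1r mulrA; congr (_ * _).
exact/esym/commr_sign.
Qed.

(** Subtracting the top monomial leaves a cycle on which [kill B] vanishes; by [kill_cycle] its
    multiple by $B!$ is a boundary, and $B!$ is invertible. *)
Lemma cycle_decomposition z : kom * z = 0 ->
  exists a y, z = kxis s * a%:S + kom * y.
Proof.
move=> hz; have [a [B hB]] := kill_all z; exists a.
have hw : kom * (z - kxis s * a%:S) = 0.
  by rewrite mulrBr hz mulrA kom_kxis // mul0r subrr.
have [y] := kill_cycle B hw; rewrite hB // => /eqP; rewrite eq_sym addr_eq0 => /eqP h.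
have {}h : (z - kxis s * a%:S) *+ B`! = kom * ((-1) ^+ B * - y).
  rewrite mulrA (commr_sign kom) -mulrA mulrN -h mulrA -exprD -signr_odd oddD addbb.
  by rewrite mul1r.
have [y' hy'] : exists y', z - kxis s * a%:S = kom * y'.
  have B0 : B`!%:R != 0 :> k by move: k_char0 => /pcharf0P ->; rewrite -lt0n fact_gt0.
  pose c := ((B`!%:R^-1 : k) *: (1 : A)).
  have hc : B`!%:R * c = 1 :> A.
    by rewrite -scaler_nat -scalerAl mul1r scalerA mulfV // scale1r.
  exists ((-1) ^+ B * - y * c%:S); rewrite mulrA -h -mulr_natr -mulrA.
  by rewrite -(symscal_nat B`!) -symscalM hc symscal1 mulr1.
by exists y'; rewrite -hy' addrC subrK.
Qed.

(* The coefficient of xi_(i_1) ... xi_(i_m) for l = [i_1, ..., i_m], at x = 0.  *)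
Definition top_coef l z : A := augment (foldl (fun w i => Dxi i w) z l).

Lemma top_coefD l z w : top_coef l (z + w) = top_coef l z + top_coef l w.
Proof.
rewrite /top_coef; elim: l z w => [|i l IH] z w /=; first exact: augmentD.
by rewrite DxiD IH.
Qed.

Lemma top_coef0 l : top_coef l 0 = 0.
Proof. by apply: (addIr (top_coef l 0)); rewrite -top_coefD !add0r. Qed.

Lemma top_coefN l z : top_coef l (- z) = - top_coef l z.
Proof. by apply/eqP; rewrite -addr_eq0 -top_coefD addNr top_coef0. Qed.

Lemma top_coef_sum l J (t : seq J) (Q : pred J) (G : J -> K) :
  top_coef l (\sum_(j <- t | Q j) G j) = \sum_(j <- t | Q j) top_coef l (G j).
Proof. exact: (big_morph _ (top_coefD l) (top_coef0 l)). Qed.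

Lemma top_coef_scalr l z a : top_coef l (z * a%:S) = top_coef l z * a.
Proof.
rewrite /top_coef; elim: l z => [|i l IH] z /=; first by rewrite augmentM augment_scal.
by rewrite /Dxi (contract_scalr (homog_lXi F i)) IH.
Qed.

Lemma top_coef_kx l i z : top_coef l (kx i * z) = 0.
Proof.
rewrite /top_coef; elim: l z => [|j l IH] z /=; first by rewrite augmentM augment_gen mul0r.
by rewrite Dxi_kx -ksgnCA IH.
Qed.

(** Every term of [kom] contains some $x_i$, which survives the derivations $\partial_{\xi_j}$ and
    is set to 0 by the augmentation. Hence [top_coef] depends only on the cohomology class. *)
Lemma top_coef_kom l z : top_coef l (kom * z) = 0.
Proof.
rewrite mulr_suml top_coef_sum big1 // => i _.
rewrite (khomogC (khomog_kxi i) (khomog_kx i)) -!mulrA -ksgnCA.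
exact: top_coef_kx.
Qed.

Lemma Dxi_kxis i l z : i \notin l -> Dxi i (kxis l * z) =
  ksgn _ (dXi F i) (\sum_(j <- l) dXi F j) * (kxis l * Dxi i z).
Proof.
move=> il; rewrite {1}/Dxi (contractM (homog_lXi F i) _ (khomog_kxis l)).
suff -> : contract (dXi F i) (lXi F i) (kxis l) = 0 by rewrite mul0r add0r.
elim: l il => [|j l IH]; first by move=> _; rewrite /kxis big_nil; apply: Dxi1.
rewrite inE negb_or => /andP[/negPf ij /IH h]; rewrite /kxis big_cons.
by rewrite [LHS]Dxi_kxi ij mul0r [Dxi _ _]h !mulr0 addr0.
Qed.

(** The derivations are applied in the order of the factors, so each removes the leading one and no
    sign arises. *)
Lemma top_coef_kxis l a : uniq l -> top_coef l (kxis l * a%:S) = a.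
Proof.
rewrite /top_coef; elim: l => [|i l IH] /=; first by rewrite /kxis big_nil mul1r augment_scal.
move=> /andP[il /IH {2}<-]; congr (augment (foldl _ _ l)).
rewrite /kxis big_cons -mulrA Dxi_kxi eqxx mul1r Dxi_kxis //.
by rewrite [Dxi i _](contract_scal (homog_lXi F i)) !mulr0 addr0.
Qed.

Lemma top_coef_khomog l g z : khomog g z ->
  homog (\sum_(i <- l) dXi F i + g) (top_coef l z).
Proof.
rewrite /top_coef; elim: l g z => [|i l IH] g z hz /=.
  by rewrite big_nil add0r; apply: augment_khomog.
rewrite big_cons -addrA addrCA; apply: IH.
exact: contract_khomog (homog_lXi F i) _ _ hz.
Qed.

End KoszulFrame.

(** * The action on cohomology *)

Section Berezinian.
Variables (n : nat) (k : fieldType) (A : gcAlgType n k) (r : 'I_(2 ^ n) -> nat).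
Variables (M : gmodType A) (e : stdBasis r M) (p : 'rV['F_2]_n).
Hypotheses (k_char0 : [pchar k] =i pred0) (p_odd : dotp p p = 1).

Local Notation P := (parity p M * dual M)%type.
Local Notation I := 'I_(\sum_u r u).
Local Notation "s %:S" := (symscal P s) (at level 2, format "s %:S").
Implicit Types (i j : I) (T : gl0 A r).

Definition ieven i := dotp (bdeg i) (bdeg i) == 0.

Lemma F2_cases (x : 'F_2) : x = 0 \/ x = 1.
Proof.
case: x => -[|[|//]] h; first by left; apply: val_inj.
by right; apply: val_inj.
Qed.

Lemma ievenP i : dotp (bdeg i) (bdeg i) = (~~ ieven i)%:R.
Proof. by rewrite /ieven; case: (F2_cases (dotp (bdeg i) (bdeg i))) => ->. Qed.

Lemma dotp_shift (g : 'rV['F_2]_n) : dotp (g + p) (g + p) = dotp g g + 1.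
Proof.
rewrite dotpDl (dotpC g) (dotpC p) !dotpDl p_odd (dotpC p g) -addrA addrA addrA.
congr (_ + _); rewrite -addrA -[RHS]addr0; congr (_ + _).
by case: (F2_cases (dotp g p)) => ->; apply: val_inj.
Qed.

(** For odd $e_i$ this is $-(-1)^{\langle\tilde e_i,\pi\rangle}$, the sign in the definition of
    $\xi_i$. *)
Definition isgn i : A := ksgn A (bdeg i) (bdeg i + p).

Lemma isgn_sq i : isgn i * isgn i = 1.
Proof. exact: ksgn_sq. Qed.

Lemma homog_isgn i : homog 0 (isgn i).
Proof. exact: homog_ksgn. Qed.

Definition gpar i : P := (Par p (e i), 0).
Definition gdual i : P := (0, dual_vec e i).

Lemma homog_gpar i : homog (bdeg i + p) (gpar i).
Proof. by apply/homog_pair; split; [apply/Par_homog/sb_homog | apply: homog0]. Qed.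

Lemma homog_gdual i : homog (bdeg i) (gdual i).
Proof. by apply/homog_pair; split; [apply: homog0 | apply: homog_dual_vec]. Qed.

Fact fparD i (x y : P) : dual_vec e i (x + y).1 = dual_vec e i x.1 + dual_vec e i y.1.
Proof. exact: (dualD (dual_vec e i)). Qed.
Fact fpar_ract i (x : P) a : dual_vec e i (ract x a).1 = dual_vec e i x.1 * a.
Proof.
case: x => x y; rewrite ract_pair -[x]/(Par p x) -Par_ract.
exact: (dual_ract (dual_vec e i)).
Qed.
Definition fpar i : dual P := Dual (fparD i) (fpar_ract i).

Lemma homog_fpar i : homog (bdeg i + p) (fpar i).
Proof.
apply/homog_dualP => h [x y] /homog_pair[hx _] /=.
have /homog_dualP H := homog_dual_vec e i.
have hx' : homog (h + p) (x : M) by exact: hx.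
by rewrite -addrA [p + h]addrC; apply: H.
Qed.

Fact fdualD i (x y : P) :
  twist (bdeg i) ((x + y).2 (e i)) = twist (bdeg i) (x.2 (e i)) + twist (bdeg i) (y.2 (e i)).
Proof. by rewrite -twistD. Qed.

Lemma twistK (g : 'rV['F_2]_n) : involutive (twist (A := A) g).
Proof.
move=> a; move: a; apply: (homog_ind (n := n)) => [x y hx hy|h a ha].
  by rewrite !twistD hx hy.
by rewrite (twist_homog g ha) (twist_homog g (homog_ksgnM g h ha)) ksgnK.
Qed.

Lemma ract_twist (N : gmodType A) g (m : N) a : homog g m -> ract m a = twist g a *: m.
Proof.
move=> hm; move: a; apply: (homog_ind (n := n)) => [x y hx hy|h a ha].
  by rewrite ractDr hx hy twistD scalerDl.
by rewrite (ract_homog ha hm) (twist_homog g ha) scalerA ksgnC.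
Qed.

Fact fdual_ract i (x : P) a :
  twist (bdeg i) ((ract x a).2 (e i)) = twist (bdeg i) (x.2 (e i)) * a.
Proof.
case: x => x y; rewrite ract_pair /= dual_ractE -{1}[a](twistK (bdeg i)).
by rewrite -(ract_twist _ (sb_homog e i)) dual_ract twistM twistK.
Qed.
(** Evaluation of a functional at $e_i$; since $(\ell\cdot a)(e_i)=\ell(ae_i)$, the twist is what
    makes it right linear. *)
Definition fdual i : dual P := Dual (fdualD i) (fdual_ract i).

Lemma homog_fdual i : homog (bdeg i) (fdual i).
Proof.
apply/homog_dualP => h [x y] /homog_pair[_ /homog_dualP hy] /=.
by rewrite addrC; apply/homog_twist/hy/sb_homog.
Qed.

Lemma fpar_gpar i j : fpar i (gpar j) = (i == j)%:R.
Proof. exact: dual_vecE. Qed.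

Lemma fpar_gdual i j : fpar i (gdual j) = 0.
Proof. exact: (dual0 (dual_vec e i)). Qed.

Lemma fdual_gpar i j : fdual i (gpar j) = 0.
Proof. exact: twist0. Qed.

Lemma fdual_gdual i j : fdual i (gdual j) = (i == j)%:R.
Proof.
rewrite [LHS](_ : _ = twist (bdeg i) (dual_vec e j (e i))) // dual_vecE eq_sym.
by case: (i == j); [apply: twist1 | apply: twist0].
Qed.

(* For odd e_i the sign of xi_i = -(-1)^<e_i,p> eps^i is moved to x_i = Pi e_i,  *)
(* which does not change sum_i xi_i x_i.                                        *)
Definition gX i := if ieven i then gdual i else ract (gpar i) (isgn i).
Definition gXi i := if ieven i then gpar i else gdual i.
Definition gdX i := if ieven i then bdeg i else bdeg i + p.
Definition gdXi i := if ieven i then bdeg i + p else bdeg i.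
Definition glX i : dual P := if ieven i then fdual i else isgn i *: fpar i.
Definition glXi i := if ieven i then fpar i else fdual i.

Fact gX_homog i : homog (gdX i) (gX i).
Proof.
rewrite /gdX /gX; case: ieven; first exact: homog_gdual.
by have := homog_ract (homog_isgn i) (homog_gpar i); rewrite add0r.
Qed.

Fact gXi_homog i : homog (gdXi i) (gXi i).
Proof. by rewrite /gdXi /gXi; case: ieven; [apply: homog_gpar | apply: homog_gdual]. Qed.

Fact glX_homog i : homog (gdX i) (glX i).
Proof.
rewrite /gdX /glX; case: ieven; first exact: homog_fdual.
by have := homogZ (homog_isgn i) (homog_fpar i); rewrite add0r.
Qed.

Fact glXi_homog i : homog (gdXi i) (glXi i).
Proof. by rewrite /gdXi /glXi; case: ieven; [apply: homog_fpar | apply: homog_fdual]. Qed.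

Fact glX_gX i j : glX i (gX j) = (i == j)%:R.
Proof.
rewrite /glX /gX; case: (boolP (ieven i)) (boolP (ieven j)) => [hi|hi] [hj|hj].
- exact: fdual_gdual.
- rewrite dual_ract fdual_gpar mul0r; case: eqP => // ij.
  by rewrite -ij hi in hj.
- rewrite dualZE fpar_gdual mulr0; case: eqP => // ij.
  by rewrite -ij (negPf hi) in hj.
- rewrite dualZE dual_ract fpar_gpar; case: eqP => [->|_]; last by rewrite mul0r mulr0.
  by rewrite mul1r isgn_sq.
Qed.

Fact glX_gXi i j : glX i (gXi j) = 0.
Proof.
rewrite /glX /gXi; case: (boolP (ieven i)) (boolP (ieven j)) => [hi|hi] [hj|hj].
- exact: fdual_gpar.
- by rewrite fdual_gdual; case: eqP => // ij; rewrite -ij hi in hj.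
- rewrite dualZE fpar_gpar; case: eqP => [ij|]; last by rewrite mulr0.
  by rewrite -ij (negPf hi) in hj.
- by rewrite dualZE fpar_gdual mulr0.
Qed.

Fact glXi_gX i j : glXi i (gX j) = 0.
Proof.
rewrite /glXi /gX; case: (boolP (ieven i)) (boolP (ieven j)) => [hi|hi] [hj|hj].
- exact: fpar_gdual.
- rewrite dual_ract fpar_gpar; case: eqP => [ij|]; last by rewrite mul0r.
  by rewrite -ij hi in hj.
- by rewrite fdual_gdual; case: eqP => // ij; rewrite -ij (negPf hi) in hj.
- by rewrite dual_ract fdual_gpar mul0r.
Qed.

Fact glXi_gXi i j : glXi i (gXi j) = (i == j)%:R.
Proof.
rewrite /glXi /gXi; case: (boolP (ieven i)) (boolP (ieven j)) => [hi|hi] [hj|hj].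
- exact: fpar_gpar.
- by rewrite fpar_gdual; case: eqP => // ij; rewrite -ij hi in hj.
- by rewrite fdual_gpar; case: eqP => // ij; rewrite -ij (negPf hi) in hj.
- exact: fdual_gdual.
Qed.

Fact gdX_D i : gdX i + gdXi i = p.
Proof. by rewrite /gdX /gdXi; case: ieven; rewrite ?addKg // addrC addKg. Qed.

Fact gdX_even i : dotp (gdX i) (gdX i) = 0.
Proof.
rewrite /gdX; case: (boolP (ieven i)) => [/eqP //|hi].
by rewrite dotp_shift ievenP hi; apply: val_inj.
Qed.

Fact gdXi_odd i : dotp (gdXi i) (gdXi i) = 1.
Proof.
rewrite /gdXi; case: (boolP (ieven i)) => [/eqP hi|hi]; last by rewrite ievenP hi.
by rewrite dotp_shift hi add0r.
Qed.

Fact g_span (y : P) : exists c d : I -> A, y = \sum_i (c i *: gX i + d i *: gXi i).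
Proof.
case: y => m l.
(* Left coordinates: [dual_vec] gives right ones, converted by the twist of degree $\tilde e_i+\pi$;
   a functional [l] has coordinates $\ell(e_i)$. *)
pose a i := twist (bdeg i + p) (dual_vec e i m); pose b i := l (e i).
exists (fun i => if ieven i then b i else a i * isgn i).
exists (fun i => if ieven i then a i else b i).
transitivity (\sum_i (a i *: gpar i + b i *: gdual i)); last first.
  apply: eq_bigr => i _; rewrite /gX /gXi; case: ieven; first by rewrite addrC.
  congr (_ + _); rewrite (ract_twist _ (homog_gpar i)) scalerA -mulrA.
  by rewrite (twist_homog _ (homog_isgn i)) ksgnC ksgn0l mul1r isgn_sq mulr1.
rewrite big_split /=.
have -> : \sum_i a i *: gpar i = ((Par p m, 0) : P).
  rewrite [in RHS](sb_span_ract e m).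
  transitivity (\sum_i ((Par p (ract (e i) (dual_vec e i m)), 0) : P)).
    apply: eq_bigr => i _; rewrite -(ract_twist _ (homog_gpar i)) ract_pair ract0l.
    by rewrite Par_ract.
  apply/esym/(big_morph (fun x : M => ((Par p x, 0) : P))) => // x y.
  by congr pair; rewrite /= addr0.
have -> : \sum_i b i *: gdual i = ((0, l) : P).
  have -> : l = \sum_i b i *: dual_vec e i.
    apply: dual_ext => x; rewrite dual_sumE {1}(sb_span_ract e x) dual_sum.
    by apply: eq_bigr => i _; rewrite dual_ract.
  transitivity (\sum_i ((0, b i *: dual_vec e i) : P)).
    by apply: eq_bigr => i _; congr pair; apply: scaler0.
  apply/esym/(big_morph (fun x : dual M => ((0, x) : P))) => // x y.
  by congr pair; rewrite /= addr0.
by congr pair; rewrite /= ?addr0 ?add0r.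
Qed.

Definition basis_frame : koszul_frame P I p :=
  KoszulFrame gX_homog gXi_homog glX_homog glXi_homog glX_gX glX_gXi glXi_gX
    glXi_gXi gdX_D gdX_even gdXi_odd g_span.

Local Notation F := basis_frame.

(** For odd $e_i$, exchanging $\Pi e_i$ and $\varepsilon^i$ costs exactly the sign [isgn i] stored
    in [gX]. *)
Lemma omega_kom : omega p e = kom F.
Proof.
apply: eq_bigr => i _; rewrite /kxi /kx /= /gXi /gX; case: ieven => //.
rewrite symgen_ract mulrA [LHS](symgenC (homog_gpar i) (homog_gdual i)).
by rewrite ksgnC ksgn_comm symscal_ksgn.
Qed.

Local Notation idx := (enum I).
Local Notation ktop := (kxis F idx).

(** [spar], [sdual] and [khat] retype [kpar], [kdual] and [hat] over [symalg P], where the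
    contractions live. *)
Definition spar (m : M) : symalg P := symgen ((Par p m, 0) : P).
Definition sdual (l : dual M) : symalg P := symgen ((0, l) : P).

Definition khat T (z : symalg P) : symalg P := hat e T z.

Lemma khatD T z w : khat T (z + w) = khat T z + khat T w.
Proof. exact: (hatD e T). Qed.

Lemma khatM T z w : khat T (z * w) = khat T z * khat T w.
Proof. exact: (hatM e T). Qed.

Lemma khat_scal T a : khat T a%:S = a%:S.
Proof. exact: (hat_scal p e T). Qed.

Lemma khat_spar T m : khat T (spar m) = spar (phi e T m).
Proof. exact: (hat_par p e T). Qed.

Lemma khat_sdual T l : khat T (sdual l) = sdual (pullback (phi_gmap e (gl0_inv_deg T)) l).
Proof. exact: (hat_dual p e T). Qed.

Lemma khat_kom T z : khat T (kom F * z) = kom F * khat T z.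
Proof. by have := hat_kd e T z; rewrite /kd omega_kom. Qed.

Lemma spar_sum J (t : seq J) (Q : pred J) (G : J -> M) :
  spar (\sum_(j <- t | Q j) G j) = \sum_(j <- t | Q j) spar (G j).
Proof. exact: (kpar_sum p). Qed.

Lemma spar_ract m a : spar (ract m a) = spar m * a%:S.
Proof. exact: (kpar_ract p). Qed.

Lemma sdual_sum J (t : seq J) (Q : pred J) (G : J -> dual M) :
  sdual (\sum_(j <- t | Q j) G j) = \sum_(j <- t | Q j) sdual (G j).
Proof. exact: (kdual_sum p). Qed.

Lemma sdualZ a l : sdual (a *: l) = a%:S * sdual l.
Proof. exact: (kdualZ p). Qed.

Lemma symgen_pair (y : P) : symgen y = spar y.1 + sdual y.2.
Proof.
by case: y => m l; rewrite /spar /sdual -symgenD; congr symgen; congr pair;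
  rewrite /= ?addr0 ?add0r.
Qed.

Lemma koszul_ext (f g : symalg P -> symalg P) :
  {morph f : x y / x + y} -> {morph f : x y / x * y} ->
  {morph g : x y / x + y} -> {morph g : x y / x * y} ->
  (forall a, f (a%:S) = g (a%:S)) ->
  (forall m, f (spar m) = g (spar m)) ->
  (forall l, f (sdual l) = g (sdual l)) -> f =1 g.
Proof.
move=> fD fM gD gM fgs fgp fgd; apply: symalg_ind => [//|y|x y hx hy|x y hx hy].
- by rewrite symgen_pair fD gD fgp fgd.
- by rewrite fD gD hx hy.
- by rewrite fM gM hx hy.
Qed.

Lemma khat1 T : khat T 1 = 1.
Proof. exact: (khat_scal T 1). Qed.

Lemma khat0 T : khat T 0 = 0.
Proof. by apply: (addIr (khat T 0)); rewrite -khatD !add0r. Qed.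

Lemma khatN T z : khat T (- z) = - khat T z.
Proof. by apply/eqP; rewrite -addr_eq0 -khatD addNr khat0. Qed.

Lemma khat_sign T (b : nat) z : khat T ((-1) ^+ b * z) = (-1) ^+ b * khat T z.
Proof.
rewrite -signr_odd; case: odd; rewrite ?expr0 ?mul1r // !expr1.
by rewrite !mulN1r khatN.
Qed.

Lemma khat_kxis T l : khat T (kxis F l) = \prod_(i <- l) khat T (kxi F i).
Proof. exact: (big_morph (khat T) (khatM T) (khat1 T)). Qed.

Lemma khat_khomog T g (z : symalg P) : khomog g z -> khomog g (khat T z).
Proof.
elim=> {g z} [g a ha|g y hy|g z w _ hz _ hw|g h z w _ hz _ hw].
- by rewrite khat_scal; apply: khomog_scal.
- rewrite /khat /hat symmap_gen; last exact: hat_gen_gmap.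
  by apply: khomog_gen; case: (hat_gen_gmap p e T) => _ _; apply.
- by rewrite khatD; apply: khomogD.
- by rewrite khatM; apply: khomogM.
Qed.

Lemma khat_mul S T z : khat (gl0_mul S T) z = khat S (khat T z).
Proof.
move: z; apply: koszul_ext => [x y|x y|x y|x y|a|m|l].
- exact: khatD.
- exact: khatM.
- by rewrite !khatD.
- by rewrite !khatM.
- by rewrite !khat_scal.
- by rewrite !khat_spar phi_mul //; apply: gl0_deg.
- rewrite !khat_sdual; congr sdual; apply: dual_ext => x /=.
  by rewrite phi_mul //; apply: gl0_inv_deg.
Qed.

Lemma khat_id T z : T = 1%:M :> 'M_(_) -> khat T z = z.
Proof.
move=> T1; have V1 : gl0_inv T = 1%:M by rewrite -[LHS]mul1mx -T1 gl0_mulV.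
move: z; apply: koszul_ext => [x y|x y|//|//|a|m|l].
- exact: khatD.
- exact: khatM.
- exact: khat_scal.
- by rewrite khat_spar T1 phi1.
- by rewrite khat_sdual; congr sdual; apply: dual_ext => x /=; rewrite V1 phi1.
Qed.

(** * The coefficient of the transformed top monomial *)

Definition cber T : A := top_coef F idx (khat T ktop).

Lemma ktop_cycle : kom F * ktop = 0.
Proof. by apply: kom_kxis => // i; rewrite mem_enum. Qed.

(** The action commutes with $d$, so the image of the top monomial is a cycle; the coefficient in
    its decomposition is the one read by [top_coef]. *)
Lemma khat_ktop T : exists y, khat T ktop = ktop * (cber T)%:S + kom F * y.
Proof.
have hc : kom F * khat T ktop = 0 by rewrite -khat_kom ktop_cycle khat0.
have [a [y h]] := cycle_decomposition k_char0 p_odd (enum_uniq I) (mem_enum I) hc.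
exists y; rewrite {1}h /cber h top_coefD top_coef_kom addr0 top_coef_kxis //.
exact: enum_uniq.
Qed.

(** The action preserves degrees and [top_coef] shifts them by the degree of the top monomial, which
    is its own negative. *)
Lemma cber_homog T : homog 0 (cber T).
Proof.
rewrite -(addgg (\sum_(i <- idx) dXi F i)).
exact/top_coef_khomog/khat_khomog/khomog_kxis.
Qed.

Lemma cberC T a : a * cber T = cber T * a.
Proof.
move: a; apply: (homog_ind (n := n)) => [a b ha hb|g a ha].
  by rewrite mulrDl ha hb mulrDr.
by rewrite (gcC ha (cber_homog T)) ksgnC ksgn0l mul1r.
Qed.

(** Apply [S] to the decomposition of the image under [T]: scalars are fixed and boundaries go to
    boundaries. *)
Lemma cber_mul S T : cber (gl0_mul S T) = cber S * cber T.
Proof.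
rewrite {1}/cber khat_mul; have [y ->] := khat_ktop T.
rewrite khatD khatM khat_scal top_coefD top_coef_scalr.
by rewrite khat_kom top_coef_kom addr0.
Qed.

Lemma cber_id T : T = 1%:M :> 'M_(_) -> cber T = 1.
Proof.
move=> T1; rewrite /cber khat_id // -[kxis F _]mulr1 -symscal1 top_coef_kxis //.
exact: enum_uniq.
Qed.

Lemma cber_unit T : exists b, [/\ homog 0 b, cber T * b = 1 & b * cber T = 1].
Proof.
pose T' := GL0 (gl0_inv_deg T) (gl0_deg T) (gl0_Vmul T) (gl0_mulV T).
exists (cber T'); split; first exact: cber_homog.
  by rewrite -cber_mul cber_id //= gl0_mulV.
by rewrite -cber_mul cber_id //= gl0_Vmul.
Qed.

(** Represent the class by the top monomial times [a]. The action inserts [cber T] before [a], and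
    centrality moves it to the right. *)
Lemma Phi_cber T (h : cohom p e) : Phi T h = hract h (cber T).
Proof.
rewrite -(krepK h); case: (krep h) => z hz; rewrite PhiE hractE; apply/kclassP => /=.
suff [w hw] : exists w, khat T z - z * (cber T)%:S = kom F * w.
  by exists w; rewrite /kd omega_kom; exact: hw.
move: hz => /eqP; rewrite /kd omega_kom => /cycle_decomposition.
move=> /(_ k_char0 p_odd idx (enum_uniq I) (mem_enum I)) [a [y ->]].
have [y' hy'] := khat_ktop T.
exists (y' * a%:S + khat T y - y * (cber T)%:S).
rewrite khatD khatM khat_scal khat_kom hy' mulrBr mulrDr !mulrDl -!mulrA.
rewrite -!symscalM cberC opprD !addrA; congr (_ - _).
by rewrite -[X in X - _]addrA [X in X - _]addrC addrK.
Qed.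

(* Reordering the xi_i only changes the sign of both sides. *)
Lemma cber_eq T l a : perm_eq idx l ->
  top_coef F idx (khat T (kxis F l)) = top_coef F idx (kxis F l * a%:S) -> cber T = a.
Proof.
move=> /(kxis_perm F) [b hb]; rewrite /cber hb khat_sign => h.
transitivity (top_coef F idx (ktop * a%:S)); last first.
  by rewrite top_coef_kxis // enum_uniq.
rewrite hb -mulrA -signr_odd; case: odd; rewrite ?expr0 ?mul1r // expr1.
by rewrite !mulN1r !top_coefN h.
Qed.

Lemma spar_vec j : spar (e j) = if ieven j then kxi F j else kx F j * (isgn j)%:S.
Proof.
rewrite /kxi /kx /= /gXi /gX; case: ieven => //.
by rewrite symgen_ract -mulrA -symscalM isgn_sq symscal1 mulr1.
Qed.

Lemma sdual_vec j : sdual (dual_vec e j) = if ieven j then kx F j else kxi F j.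
Proof. by rewrite /kxi /kx /= /gXi /gX; case: ieven. Qed.

Lemma khat_kxi_even T i : ieven i ->
  khat T (kxi F i) = \sum_j spar (e j) * (T j i)%:S.
Proof.
move=> hi; rewrite /kxi /= /gXi hi -[symgen _]/(spar (e i)) khat_spar phiE spar_sum.
by apply: eq_bigr => j _; rewrite spar_ract.
Qed.

(** Here $\xi_i=\varepsilon^i$, and its pullback along $\varphi^{-1}$ reads row [i] of the inverse
    matrix. *)
Lemma khat_kxi_odd T i : ~~ ieven i ->
  khat T (kxi F i) = \sum_j (gl0_inv T i j)%:S * sdual (dual_vec e j).
Proof.
move=> /negPf hi; rewrite /kxi /= /gXi hi -[symgen _]/(sdual (dual_vec e i)) khat_sdual.
transitivity (sdual (\sum_j gl0_inv T i j *: dual_vec e j)); last first.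
  by rewrite sdual_sum; apply: eq_bigr => j _; rewrite sdualZ.
congr sdual; apply: dual_ext => m; rewrite dual_sumE {1}(sb_span_ract e m).
rewrite (dual_sum (pullback _ _)); apply: eq_bigr => j _; rewrite dual_ract dualZE.
congr (_ * _); rewrite [LHS](_ : _ = dual_vec e i (phi e (gl0_inv T) (e j))) //.
rewrite phiE dual_sum (bigD1 i) //= [X in _ + X]big1 => [|l /negPf li].
  by rewrite addr0 -[dual_vec_fun e i _]/(dual_vec e i _) dual_ract dual_vecE eqxx mul1r.
by rewrite -[dual_vec_fun e i _]/(dual_vec e i _) dual_ract dual_vecE eq_sym li mul0r.
Qed.

End Berezinian.

(** * Even and odd degrees in the enumeration *)

Section Parity.
Variable n : nat.
Hypothesis n_gt0 : (0 < n)%N.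

Let even_g := [pred g : 'rV['F_2]_n | dotp g g == 0].
Let odd_g := [pred g : 'rV['F_2]_n | dotp g g == 1].

Let expnE : (2 ^ n = (2 ^ n.-1).*2)%N.
Proof. by rewrite -mul2n -expnS prednK. Qed.

(** Translation by an odd element exchanges even and odd elements; $n>0$ provides a unit vector for
    it. *)
Lemma card_degrees : #|even_g| = (2 ^ n.-1)%N /\ #|odd_g| = (2 ^ n.-1)%N.
Proof.
pose i0 := Ordinal n_gt0; pose d : 'rV['F_2]_n := delta_mx ord0 i0.
have dd : dotp d d = 1.
  rewrite /dotp (bigD1 i0) //= big1 => [|i ii0]; first by rewrite !mxE !eqxx mulr1 addr0.
  by rewrite !mxE (negPf ii0) andbF mul0r.
have oE g : (g \in odd_g) = (g \notin even_g).
  by rewrite !inE; case: (F2_cases (dotp g g)) => ->.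
have e1 : #|even_g| = #|odd_g|.
  rewrite -(card_image (addIr d) odd_g); apply: eq_card => g.
  rewrite -{2}[g](addgK d) (mem_image (addIr d)) !inE (dotp_shift dd).
  by case: (F2_cases (dotp g g)) => ->.
have : (#|even_g| + #|odd_g|)%N = (2 ^ n)%N.
  have <- : #|{: 'rV['F_2]_n}| = (2 ^ n)%N by rewrite card_mx card_Fp // mul1n.
  by rewrite -(cardC even_g); congr (_ + _)%N; apply: eq_card.
by rewrite -e1 addnn expnE => /double_inj.
Qed.

(** Reconciles the parity of degrees, used by the frame, with the cut at $2^{n-1}$ in [is_gber]. *)
Lemma rdeg_even (u : 'I_(2 ^ n)) :
  (dotp (rdeg u) (rdeg u) == 0) = (u < 2 ^ n.-1)%N.
Proof.
pose E := [seq g <- enum 'rV['F_2]_n | dotp g g == 0].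
pose O := [seq g <- enum 'rV['F_2]_n | dotp g g == 1].
have [cE cO] := card_degrees.
have sE : size (sort (@lexle n) E) = (2 ^ n.-1)%N.
  by rewrite size_sort -cE cardE /enum_mem -enumT.
have sO : size (sort (@lexle n) O) = (2 ^ n.-1)%N.
  by rewrite size_sort -cO cardE /enum_mem -enumT.
rewrite /rdeg /degrees nth_cat sE; case: ltnP => hu.
  have : nth 0 (sort (@lexle n) E) u \in E by rewrite -(mem_sort (@lexle n)) mem_nth // sE.
  by rewrite mem_filter => /andP[].
have : nth 0 (sort (@lexle n) O) (u - 2 ^ n.-1) \in O.
  by rewrite -(mem_sort (@lexle n)) mem_nth // sO ltn_subLR // addnn -expnE.
by rewrite mem_filter => /andP[/eqP -> _].
Qed.

End Parity.

(** * Products modulo the ideal of the even variables *)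

Section Triangular.
Variables (n : nat) (k : fieldType) (A : gcAlgType n k) (P : gmodType A).
Variables (I : finType) (p : 'rV['F_2]_n) (F : koszul_frame P I p).
Hypothesis k_char0 : [pchar k] =i pred0.
Local Notation K := (symalg P).
Implicit Types (i j : I) (z w : K) (l : seq I).

Definition kx_ideal z := exists w : I -> K, z = \sum_i kx F i * w i.

Lemma kx_idealD z w : kx_ideal z -> kx_ideal w -> kx_ideal (z + w).
Proof.
move=> [u ->] [v ->]; exists (fun i => u i + v i); rewrite -big_split.
by apply: eq_bigr => i _; rewrite mulrDr.
Qed.

Lemma kx_ideal0 : kx_ideal 0.
Proof. by exists (fun=> 0); rewrite big1 // => i _; rewrite mulr0. Qed.

Lemma kx_ideal_sum J (t : seq J) (Q : pred J) (G : J -> K) :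
  (forall x, Q x -> kx_ideal (G x)) -> kx_ideal (\sum_(x <- t | Q x) G x).
Proof. by move=> h; apply: big_ind => //; [exact: kx_ideal0 | exact: kx_idealD]. Qed.

Lemma kx_ideal_kx i w : kx_ideal (kx F i * w).
Proof.
exists (fun j => (i == j)%:R * w); rewrite (bigD1 i) //= eqxx mul1r big1 ?addr0 //.
by move=> j /negPf ji; rewrite eq_sym ji mul0r mulr0.
Qed.

Lemma kx_idealMr z w : kx_ideal z -> kx_ideal (z * w).
Proof.
move=> [u ->]; exists (fun i => u i * w); rewrite mulr_suml.
by apply: eq_bigr => i _; rewrite mulrA.
Qed.

Lemma kx_idealMl z w : kx_ideal z -> kx_ideal (w * z).
Proof.
move=> [u ->]; rewrite mulr_sumr; apply: kx_ideal_sum => i _.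
by have [w' h] := khomog_normr (khomog_kx F i) w; rewrite mulrA h -mulrA; apply: kx_ideal_kx.
Qed.

Lemma top_coef_ideal l z : kx_ideal z -> top_coef F l z = 0.
Proof.
by move=> [w ->]; rewrite top_coef_sum big1 // => i _; rewrite top_coef_kx.
Qed.

(** The corrections to $\xi_i$ are multiples of $\xi_j$ with larger [g]. In the sorted list such
    $\xi_j$ occur again further right, and $\xi_j^2=0$ removes the corrections. *)
Lemma prod_triangular (g : I -> nat) (f : I -> K) l :
  sorted (fun i j => g i <= g j)%N l ->
  (forall i j, i \in l -> (g i < g j)%N -> j \in l) ->
  (forall i, i \in l -> exists b c : I -> K,
     kx_ideal (f i - kxi F i - \sum_(j | (g i < g j)%N) b j * (kxi F j * c j))) ->
  kx_ideal (\prod_(i <- l) f i - kxis F l).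
Proof.
elim: l => [|i l IH] sl cl hf.
  by rewrite /kxis !big_nil subrr; apply: kx_ideal0.
have tr : transitive (fun i j => g i <= g j)%N by move=> a b c; apply: leq_trans.
have /allP hm := order_path_min tr sl.
have {}IH : kx_ideal (\prod_(i <- l) f i - kxis F l).
  apply: IH => [|a b al ab|a al]; first exact: path_sorted sl.
    have := cl a b; rewrite !inE al orbT ab => /(_ isT isT) /orP[/eqP bi|//].
    by move: (hm _ al); rewrite -bi leqNgt ab.
  by apply: hf; rewrite inE al orbT.
rewrite /kxis !big_cons -/(kxis F l).
have -> : f i * \prod_(j <- l) f j - kxi F i * kxis F l =
    f i * (\prod_(j <- l) f j - kxis F l) + (f i - kxi F i) * kxis F l.
  by rewrite mulrBr mulrBl addrA subrK.
apply: kx_idealD; first exact: kx_idealMl.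
have [b [c hc]] := hf i (mem_head _ _).
suff -> : (f i - kxi F i) * kxis F l =
    (f i - kxi F i - \sum_(j | (g i < g j)%N) b j * (kxi F j * c j)) * kxis F l.
  exact: kx_idealMr.
rewrite [RHS]mulrBl mulr_suml big1 ?subr0 // => j gj.
have := cl i j (mem_head _ _) gj; rewrite inE => /orP[/eqP ji|jl].
  by rewrite ji ltnn in gj.
by rewrite -mulrA kxi_kxis // mulr0.
Qed.

End Triangular.

(** * Unitriangular and block-diagonal matrices *)

Section Unitriangular.
Variables (n : nat) (k : fieldType) (A : gcAlgType n k) (r : 'I_(2 ^ n) -> nat).
Variables (M : gmodType A) (e : stdBasis r M) (p : 'rV['F_2]_n).
Hypotheses (k_char0 : [pchar k] =i pred0) (p_odd : dotp p p = 1).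

Local Notation P := (parity p M * dual M)%type.
Local Notation I := 'I_(\sum_u r u).
Local Notation "s %:S" := (symscal P s) (at level 2, format "s %:S").
Local Notation F := (basis_frame e p_odd).
Implicit Types (i j : I) (T : gl0 A r).

(** The weight [f] covers both triangular shapes: it is the block index for lower matrices and the
    reversed index for upper ones. *)
Definition unitri (f : I -> nat) (X : 'M[A]_(\sum_u r u)) : Prop :=
  forall i j, (f i <= f j)%N -> X i j = (i == j)%:R.

(** Forward substitution in row [i] of $XY=1$, by induction on [f i]. *)
Lemma unitri_inv f (X Y : 'M[A]_(\sum_u r u)) :
  unitri f X -> X *m Y = 1%:M -> unitri f Y.
Proof.
move=> hX XY i; have [m] := ubnP (f i); elim: m i => // m IH i; rewrite ltnS => im j ij.
have := congr1 (fun Z : 'M_(_) => Z i j) XY; rewrite !mxE (bigD1 i) //= hX // eqxx mul1r.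
rewrite [X in _ + X]big1 ?addr0 // => l li; have [il|il] := leqP (f i) (f l).
  by rewrite hX // eq_sym (negPf li) mul0r.
rewrite (IH l (leq_trans il im)); last exact: ltnW (leq_trans il ij).
have [lj|_] := eqVneq l j; last by rewrite mulr0.
by move: il; rewrite lj ltnNge ij.
Qed.

(** Terms of the opposite parity are multiples of some $x_j$, so modulo these the parities do not
    mix. Transposition reverses the triangular shape on the odd part, whence the reversed weight
    there, and [prod_triangular] applies to all $\xi_i$ at once. *)
Lemma cber_unitri (f : I -> nat) T : unitri f T -> cber e p_odd T = 1.
Proof.
move=> hT; have hS := unitri_inv hT (gl0_mulV T).
pose C := \max_i f i; have fC i : (f i <= C)%N by apply: leq_bigmax.
(* The even part transforms by T, the odd one by the transpose of T^-1. *)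
pose g i := if ieven i then f i else (C - f i)%N.
pose l := sort (fun i j => g i <= g j)%N (enum I).
have pl : perm_eq (enum I) l by rewrite perm_sym perm_sort.
apply: (cber_eq (l := l)) => //; rewrite symscal1 mulr1; apply/eqP.
rewrite -subr_eq0 -top_coefN -top_coefD khat_kxis; apply/eqP/(top_coef_ideal (F := F)).
apply: (prod_triangular k_char0 (g := g)) => //.
- by apply: sort_sorted => i j; apply: leq_total.
- by move=> i j _ _; rewrite -(perm_mem pl) mem_enum.
move=> i _; have [hi|hi] := boolP (ieven i).
- exists (fun j => (ieven j)%:R), (fun j => (T j i)%:S).
  rewrite khat_kxi_even // [X in _ - X]big_mkcond /= -(sum_delta (kxi F) i) -!sumrB.
  apply: kx_ideal_sum => j _; rewrite spar_vec; have [hj|hj] := boolP (ieven j); last first.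
    rewrite mul0r if_same subr0; have [ij|_] := eqVneq j i; first by rewrite ij hi in hj.
    by rewrite mul0r subr0 -mulrA; apply: kx_ideal_kx.
  rewrite mul1r /g hi hj ltnNge; have [ji|ji] := leqP (f j) (f i).
    rewrite hT // subr0; have [_|_] := eqVneq j i.
      by rewrite symscal1 mulr1 mul1r subrr; apply: kx_ideal0.
    by rewrite symscal0 mulr0 mul0r subrr; apply: kx_ideal0.
  have [ij|_] := eqVneq j i; first by rewrite ij ltnn in ji.
  by rewrite mul0r subr0 subrr; apply: kx_ideal0.
- exists (fun j => (~~ ieven j)%:R * (gl0_inv T i j)%:S), (fun=> 1).
  rewrite khat_kxi_odd // [X in _ - X]big_mkcond /= -(sum_delta (kxi F) i) -!sumrB.
  apply: kx_ideal_sum => j _; rewrite sdual_vec; have [hj|hj] := boolP (ieven j).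
    rewrite !mul0r if_same subr0; have [ij|_] := eqVneq j i; first by rewrite -ij hj in hi.
    by rewrite mul0r subr0; apply/kx_idealMl; rewrite -[kx _ _]mulr1; apply: kx_ideal_kx.
  rewrite mul1r mulr1 /g (negPf hi) (negPf hj) ltnNge leq_sub2lE //.
  have [ij|ij] := leqP (f i) (f j).
    rewrite hS // subr0 eq_sym; have [_|_] := eqVneq j i.
      by rewrite symscal1 !mul1r subrr; apply: kx_ideal0.
    by rewrite symscal0 !mul0r subrr; apply: kx_ideal0.
  have [e'|_] := eqVneq j i; first by rewrite e' ltnn in ij.
  by rewrite mul0r subr0 subrr; apply: kx_ideal0.
Qed.

End Unitriangular.

Lemma split_two (T : eqType) (x y : T) (l : seq T) :
  x \in l -> y \in l -> x != y -> exists s1 s2 s3,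
  l = s1 ++ x :: s2 ++ y :: s3 \/ l = s1 ++ y :: s2 ++ x :: s3.
Proof.
case/splitPr=> s t; rewrite mem_cat inE eq_sym => + /negPf xy; rewrite xy /=.
case/orP; case/splitPr=> s' t'.
  by exists s', t', t; right; rewrite -catA.
by exists s, s', t'; left.
Qed.

(** * Determinants from anticommuting elements *)

Section Grassmann.
Variables (K : pzRingType) (I : finType) (v : I -> K).
Hypotheses (v_anti : forall i j, v i * v j = - (v j * v i)) (v_sq : forall i, v i * v i = 0).
Implicit Types (i : I) (l : seq I).

Local Notation vprod l := (\prod_(i <- l) v i).

Lemma anti_pull i l : v i * vprod l = (-1) ^+ size l * (vprod l * v i).
Proof.
elim: l => [|j l IH] /=; first by rewrite big_nil mulr1 !mul1r.
rewrite big_cons mulrA v_anti mulNr -mulrA IH mulrA (commr_sign (v j)).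
by rewrite exprS mulN1r mulNr -!mulrA.
Qed.

Lemma anti_dup s1 s2 s3 i : vprod (s1 ++ i :: s2 ++ i :: s3) = 0.
Proof.
rewrite !(big_cat, big_cons) /= (mulrA (v i) (vprod s2)) anti_pull.
by rewrite -!mulrA (mulrA (v i) (v i)) v_sq mul0r !mulr0.
Qed.

Lemma anti_swap s1 s2 s3 i j :
  vprod (s1 ++ i :: s2 ++ j :: s3) = - vprod (s1 ++ j :: s2 ++ i :: s3).
Proof.
rewrite !(big_cat, big_cons) /= -mulrN; congr (_ * _).
rewrite (mulrA (v i)) (anti_pull i s2) (mulrA (v j) (vprod s2)) (anti_pull j s2).
rewrite -!mulrA -!mulrN; do 2!congr (_ * _).
by rewrite !mulrA v_anti mulNr mulrN.
Qed.

Lemma map_tperm i j s1 s2 s3 : uniq (s1 ++ i :: s2 ++ j :: s3) ->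
  map (tperm i j) (s1 ++ i :: s2 ++ j :: s3) = s1 ++ j :: s2 ++ i :: s3.
Proof.
have fixs (s : seq I) : i \notin s -> j \notin s -> map (tperm i j) s = s.
  move=> ni nj; apply: map_id_in => h hs; apply: tpermD.
    by apply: contraNneq ni => ->.
  by apply: contraNneq nj => ->.
move=> u; have := u; rewrite uniq_catC /= !mem_cat !inE !negb_or => /andP[+ _].
case/andP=> /andP[i2 /andP[_ i3]] i1; move: u.
rewrite -cat_cons catA uniq_catC /= !mem_cat !inE !negb_or => /andP[+ _].
case/andP=> j3 /andP[j1 /andP[_ j2]].
by rewrite !map_cat /= tpermL tpermR !fixs // -catA.
Qed.

Lemma anti_tperm i j l : uniq l -> (forall h, h \in l) -> i != j ->
  \prod_(h <- l) v (tperm i j h) = - vprod l.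
Proof.
move=> ul hl ij; rewrite -(big_map (tperm i j) xpredT v).
have [s1 [s2 [s3 [E|E]]]] := split_two (hl i) (hl j) ij; move: ul; rewrite E => u.
  by rewrite map_tperm // anti_swap.
by rewrite tpermC map_tperm // anti_swap.
Qed.

End Grassmann.

Section GrassmannDeterminant.
Variables (K : pzRingType) (m : nat) (v : 'I_m -> K).
Hypotheses (v_anti : forall i j, v i * v j = - (v j * v i)) (v_sq : forall i, v i * v i = 0).

Lemma anti_perm (s : 'S_m) : \prod_i v (s i) = (-1) ^+ s * \prod_i v i.
Proof.
have uI : uniq (index_enum 'I_m) by exact: index_enum_uniq.
have aI i : i \in index_enum 'I_m by exact: mem_index_enum.
have [ts -> dts] := prod_tpermP s.
elim: ts dts => [|[x y] ts IH] /=.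
  move=> _; rewrite big_nil odd_perm1 mul1r; apply: eq_bigr => i _.
  by rewrite perm1.
case/andP=> xy /IH h; rewrite big_cons odd_mul_tperm /= signr_addb xy.
transitivity (\prod_i v ((\prod_(t <- ts) tperm t.1 t.2)%g (tperm x y i))).
  by apply: eq_bigr => i _; rewrite permM.
set w := (\prod_(t <- ts) _)%g in h *.
rewrite (anti_tperm (v := v \o w)) //= ?h.
  by rewrite expr1 mulN1r mulNr.
Qed.

Variables (R : comPzRingType) (f : R -> K).
Hypotheses (fD : {morph f : x y / x + y}) (fM : {morph f : x y / x * y}) (f1 : f 1 = 1)
  (f_central : forall a z, f a * z = z * f a).

(** Expand over all choice functions: a non-injective one repeats some [v] and gives 0, and the
    permutations give the Leibniz formula by [anti_perm]. *)
Lemma grassmann_det (t : 'M[R]_m) :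
  \prod_i \sum_j v j * f (t i j) = (\prod_i v i) * f (\det t).
Proof.
have f0 : f 0 = 0 by apply: (addIr (f 0)); rewrite -fD !add0r.
have fN a : f (- a) = - f a by apply/eqP; rewrite -addr_eq0 -fD addNr f0.
have fs (b : bool) : f ((-1) ^+ b) = (-1) ^+ b by case: b; rewrite ?expr1 ?fN ?f1.
have prodE (g : 'I_m -> 'I_m) : \prod_i (v (g i) * f (t i (g i))) =
    (\prod_i v (g i)) * f (\prod_i t i (g i)).
  rewrite (big_morph f fM f1); elim/big_rec3: _ => [|i x y z _ ->]; first by rewrite mulr1.
  by rewrite -!mulrA; congr (_ * _); rewrite mulrA f_central -mulrA.
rewrite bigA_distr_bigA /=; under eq_bigr do rewrite prodE.
rewrite (bigID (fun g : {ffun 'I_m -> 'I_m} => injectiveb g)) /= addrC big1 ?add0r.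
  rewrite (reindex (@pval _)) /=; last first.
    exists (insubd (1%g : 'S_m)) => /= g gi; first exact: val_inj (insubdK _ _).
    exact: insubdK.
  rewrite /determinant (big_morph f fD f0) mulr_sumr.
  apply: eq_big => /= [s|s _]; first exact: (valP s).
  rewrite fM fs mulrA [X in _ = X * _]commr_sign; congr (_ * _); last first.
    by congr f; apply: eq_bigr => i _; rewrite pvalE.
  by rewrite -anti_perm; apply: eq_bigr => i _; rewrite pvalE.
move=> g /injectivePn [i1 [i2 Di12 Ef12]].
have [s1 [s2 [s3 E]]] := split_two (mem_index_enum i1) (mem_index_enum i2) Di12.
suff -> : \prod_i v (g i) = 0 by rewrite mul0r.
rewrite -(big_map g xpredT v).
by case: E => ->; rewrite map_cat /= map_cat /= Ef12 anti_dup.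
Qed.

End GrassmannDeterminant.

(** * The commutative subring of degree 0 *)

Section DegreeZero.
Variables (n : nat) (k : fieldType) (A : gcAlgType n k).

Definition deg0_pred : {pred A} := fun a => gcomp 0 a == a.

Lemma deg0P a : reflect (homog 0 a) (a \in deg0_pred).
Proof. exact: eqP. Qed.

Fact deg0_subring : subring_closed deg0_pred.
Proof.
split=> [|a b /deg0P ha /deg0P hb|a b /deg0P ha /deg0P hb]; apply/deg0P.
- exact: homog1.
- by apply: homogD => //; rewrite /homog gcompN hb.
- by have := homogM ha hb; rewrite addr0.
Qed.
HB.instance Definition _ := GRing.isSubringClosed.Build A deg0_pred deg0_subring.

(** Diagonal blocks have entries of degree 0, so their determinants can be handled over this
    commutative ring although $A$ is only graded commutative. *)
Record deg0 := Deg0 {deg0_val :> A; _ : deg0_val \in deg0_pred}.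
HB.instance Definition _ := [isSub for deg0_val].
HB.instance Definition _ := [Choice of deg0 by <:].
HB.instance Definition _ := [SubChoice_isSubNzRing of deg0 by <:].

Lemma deg0_homog (a : deg0) : homog 0 (val a).
Proof. exact/deg0P/(valP a). Qed.

Fact deg0_mulC : commutative (@GRing.mul deg0).
Proof.
move=> a b; apply: val_inj.
by rewrite !rmorphM /= (gcC (deg0_homog a) (deg0_homog b)) ksgn0l mul1r.
Qed.
HB.instance Definition _ := GRing.PzRing_hasCommutativeMul.Build deg0 deg0_mulC.

Definition deg0_lift m (X : 'M[A]_m) : 'M[deg0]_m := \matrix_(i, j) insubd 0 (X i j).

Lemma deg0_liftE m (X : 'M[A]_m) i j : homog 0 (X i j) -> val (deg0_lift X i j) = X i j.
Proof. by move=> h; rewrite mxE insubdK //; apply/deg0P. Qed.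

Lemma det_deg0 m (X : 'M[A]_m) : (forall i j, homog 0 (X i j)) ->
  val (\det (deg0_lift X)) = \det X.
Proof.
move=> hX; rewrite -[LHS]/(\val _) -det_map_mx; congr (\det _).
by apply/matrixP => i j; rewrite mxE; apply: deg0_liftE.
Qed.

Lemma rinv_eq (a b : A) : a * b = 1 -> b * a = 1 -> rinv a = b.
Proof.
move=> ab ba; apply: classical_sets.xget_unique => // c [ac ca].
by rewrite -[c]mul1r -ba -mulrA ac mulr1.
Qed.

End DegreeZero.

(** * Block-diagonal matrices and the characterization *)

Section Diagonal.
Variables (n : nat) (k : fieldType) (A : gcAlgType n k) (r : 'I_(2 ^ n) -> nat).
Local Notation I := 'I_(\sum_u r u).
Implicit Types (i j : I) (u v : 'I_(2 ^ n)).

Definition blockdiag (X : 'M[A]_(\sum_u r u)) : Prop :=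
  forall i j, tagnat.sig1 i != tagnat.sig1 j -> X i j = 0.

(** A block-diagonal matrix commutes with the projector [diag_mx d] onto the block of [i], hence so
    does its inverse. *)
Lemma blockdiag_inv (X Y : 'M[A]_(\sum_u r u)) :
  blockdiag X -> X *m Y = 1%:M -> Y *m X = 1%:M -> blockdiag Y.
Proof.
move=> hX XY YX i j ij; pose d : 'rV[A]_(\sum_u r u) :=
  \row_l (tagnat.sig1 l == tagnat.sig1 i)%:R.
have XD : X *m diag_mx d = diag_mx d *m X.
  apply/matrixP => a b; rewrite mul_mx_diag mul_diag_mx !mxE.
  have [<-|ab] := eqVneq (tagnat.sig1 a) (tagnat.sig1 b).
    by case: eqP; rewrite ?mulr1 ?mul1r ?mulr0 ?mul0r.
  by rewrite hX // mulr0 mul0r.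
have YD : Y *m diag_mx d = diag_mx d *m Y.
  by rewrite -[LHS]mulmx1 -XY mulmxA -(mulmxA Y) -XD !mulmxA YX mul1mx.
have := congr1 (fun Z : 'M_(_) => Z i j) YD.
rewrite mul_mx_diag mul_diag_mx !mxE eqxx mul1r [_ == tagnat.sig1 i]eq_sym (negPf ij).
by rewrite mulr0.
Qed.

Lemma sum_blocks (V : nmodType) (G : I -> V) :
  \sum_i G i = \sum_u \sum_(a < r u) G (tagnat.Rank u a).
Proof.
rewrite sig_big_dep (reindex _ tagnat.sig_bij_on) /=.
by apply: eq_bigr => i _; rewrite tagnat.sig2K.
Qed.

Lemma blockdiag_sum (V : nmodType) (G : I -> V) u :
  (forall i, tagnat.sig1 i != u -> G i = 0) -> \sum_i G i = \sum_(a < r u) G (tagnat.Rank u a).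
Proof.
move=> h; rewrite sum_blocks (bigD1 u) //= [X in _ + X]big1 ?addr0 // => v vu.
by apply: big1 => a _; rewrite h // tagnat.Rank1K.
Qed.

Lemma blockdiag_mulmx (X Y : 'M[A]_(\sum_u r u)) u : blockdiag X -> X *m Y = 1%:M ->
  submxblock X u u *m submxblock Y u u = 1%:M.
Proof.
move=> hX XY; apply/matrixP => a b; rewrite mxE.
have := congr1 (fun Z : 'M_(_) => Z (tagnat.Rank u a) (tagnat.Rank u b)) XY.
rewrite !mxE (blockdiag_sum (u := u)) => [|l lu]; last first.
  by rewrite hX ?mul0r // tagnat.Rank1K eq_sym.
rewrite -val_eqE /= tagnat.eq_Rank eqxx /= => <-.
by apply: eq_bigr => l _; rewrite !mxE.
Qed.

Variables (M : gmodType A) (e : stdBasis r M) (p : 'rV['F_2]_n).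
Hypotheses (k_char0 : [pchar k] =i pred0) (p_odd : dotp p p = 1).
Local Notation P := (parity p M * dual M)%type.
Local Notation "s %:S" := (symscal P s) (at level 2, format "s %:S").
Local Notation F := (basis_frame e p_odd).
Local Notation Rk := (@tagnat.Rank _ r).

Lemma deg0_block (X : 'M[A]_(\sum_u r u)) : deg0_mx X ->
  forall u a b, homog 0 (submxblock X u u a b).
Proof.
move=> hX u a b; rewrite mxE; have := hX (Rk u a) (Rk u b).
by rewrite /bdeg !tagnat.Rank1K addgg.
Qed.

Definition ueven u := dotp (rdeg u) (rdeg u) == 0.

Lemma ieven_Rank u a : ieven (Rk u a) = ueven u.
Proof. by rewrite /ieven /bdeg tagnat.Rank1K. Qed.

Lemma kxi_anti u (a b : 'I_(r u)) :
  kxi F (Rk u a) * kxi F (Rk u b) = - (kxi F (Rk u b) * kxi F (Rk u a)).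
Proof.
have d : dXi F (Rk u a) = dXi F (Rk u b).
  by rewrite /= /gdXi !ieven_Rank /bdeg !tagnat.Rank1K.
rewrite (khomogC (khomog_kxi F _) (khomog_kxi F _)) d ksgn_odd ?mulN1r //.
exact: dXi_odd.
Qed.

Definition blocks_enum : seq I :=
  [seq Rk u a | u <- index_enum 'I_(2 ^ n), a <- index_enum 'I_(r u)].

Lemma perm_blocks_enum : perm_eq (enum I) blocks_enum.
Proof.
apply: uniq_perm; first exact: enum_uniq.
  apply: allpairs_uniq_dep => [|u _|[u a] [v b] _ _ /= h]; try exact: index_enum_uniq.
  exact: (bij_inj (@tagnat.rank_bij _ r)).
move=> i; rewrite mem_enum; apply/esym/allpairsPdep.
exists (tagnat.sig1 i), (tagnat.sig2 i); split; rewrite ?mem_index_enum //.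
exact/esym/tagnat.sig2K.
Qed.

Lemma prod_blocks (K : pzRingType) (G : I -> K) :
  \prod_(i <- blocks_enum) G i = \prod_u \prod_(a < r u) G (Rk u a).
Proof.
exact: big_allpairs_dep.
Qed.

Lemma mul_prod_central (K : pzRingType) J (s : seq J) (x c : J -> K) :
  (forall h z, c h * z = z * c h) ->
  \prod_(h <- s) (x h * c h) = \prod_(h <- s) x h * \prod_(h <- s) c h.
Proof.
move=> hc; elim: s => [|h s IH]; first by rewrite !big_nil mulr1.
rewrite !big_cons IH -!mulrA; congr (_ * _).
by rewrite mulrA hc -mulrA; congr (_ * _); rewrite hc.
Qed.

(** Each block transforms its own $\xi$'s, which anticommute and share one degree, so
    [grassmann_det] applies blockwise and the central determinants are collected on the right. *)
Lemma cber_blockdiag (T : gl0 A r) : blockdiag T ->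
  cber e p_odd T = val (\prod_u
    (if ueven u then \det (deg0_lift (submxblock T u u))
     else \det (deg0_lift (submxblock (gl0_inv T) u u)))).
Proof.
move=> hT; have hS := blockdiag_inv hT (gl0_mulV T) (gl0_Vmul T).
apply: (cber_eq perm_blocks_enum).
congr (top_coef _ _ _); rewrite khat_kxis /kxis !prod_blocks.
pose f (a : deg0 A) := (val a)%:S.
have fD : {morph f : x y / x + y} by move=> x y; rewrite /f raddfD symscalD.
have fM : {morph f : x y / x * y} by move=> x y; rewrite /f rmorphM symscalM.
have f1 : f 1 = 1 by rewrite /f rmorph1 symscal1.
have fC a z : f a * z = z * f a.
  by apply: khomog0_central; apply/khomog_scal/deg0_homog.
rewrite -/(f _) (big_morph f fM f1) -mul_prod_central //; apply: eq_bigr => u _.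
have gd := grassmann_det (@kxi_anti u) (fun a => kxi_sq F k_char0 (Rk u a)) fD fM f1 fC.
case: (boolP (ueven u)) => hu.
(* On even blocks $\xi_i$ maps to a combination with coefficients from column [i], hence the
   transpose. *)
- rewrite -det_tr -gd; apply: eq_bigr => a _; rewrite khat_kxi_even ?ieven_Rank //.
  rewrite (blockdiag_sum (u := u)) => [|i iu]; last first.
    by rewrite hT ?symscal0 ?mulr0 // tagnat.Rank1K.
  apply: eq_bigr => b _; rewrite spar_vec ieven_Rank hu /f mxE deg0_liftE ?[in RHS]mxE //.
  exact/deg0_block/gl0_deg.
- rewrite -gd; apply: eq_bigr => a _; rewrite khat_kxi_odd ?ieven_Rank //.
  rewrite (blockdiag_sum (u := u)) => [|i iu]; last first.
    by rewrite hS ?symscal0 ?mul0r // tagnat.Rank1K eq_sym.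
  apply: eq_bigr => b _; rewrite sdual_vec ieven_Rank (negPf hu) -fC /f.
  rewrite deg0_liftE ?[in LHS]mxE //; first by rewrite mxE.
  exact/deg0_block/gl0_inv_deg.
Qed.

Lemma cber_diag (n_gt0 : (0 < n)%N) (T : gl0 A r) :
  (forall u v, u != v -> submxblock T u v = 0) ->
  cber e p_odd T = (\prod_(u : 'I_(2 ^ n) | (u < 2 ^ n.-1)%N) \det (submxblock T u u))
    * (\prod_(u : 'I_(2 ^ n) | (2 ^ n.-1 <= u)%N) rinv (\det (submxblock T u u))).
Proof.
move=> h; have hT : blockdiag T.
  move=> i j ij; have := congr1 (fun Z : 'M_(_, _) => Z (tagnat.sig2 i) (tagnat.sig2 j)) (h _ _ ij).
  by rewrite !mxE !tagnat.sig2K.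
rewrite cber_blockdiag // (bigID (fun u : 'I_(2 ^ n) => (u < 2 ^ n.-1)%N)) rmorphM !rmorph_prod /=.
congr (_ * _).
  apply: eq_bigr => u hu; rewrite /ueven rdeg_even // hu det_deg0 // => a b.
  exact/deg0_block/gl0_deg.
apply: eq_big => [u|u hu]; first by rewrite -leqNgt.
rewrite /ueven rdeg_even // (negPf hu); apply/esym.
have dT a b : homog 0 (submxblock T u u a b) := deg0_block (gl0_deg T) a b.
have dS a b : homog 0 (submxblock (gl0_inv T) u u a b) := deg0_block (gl0_inv_deg T) a b.
(* Turns the determinant of the inverse block into the inverse determinant that [rinv] selects. *)
have dd : \det (deg0_lift (submxblock T u u)) *
    \det (deg0_lift (submxblock (gl0_inv T) u u)) = 1.
  rewrite -det_mulmx -[RHS](det1 _ (r u)); congr (\det _).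
  apply/matrixP => a b; apply: val_inj.
  have -> : val ((1%:M : 'M[deg0 A]_(r u)) a b) = (1%:M : 'M[A]_(r u)) a b.
    by rewrite !mxE; case: eqP.
  rewrite -(blockdiag_mulmx u hT (gl0_mulV T)) [RHS]mxE (mxE _ _ a b) rmorph_sum.
  by apply: eq_bigr => l _; rewrite rmorphM; congr (_ * _); apply: deg0_liftE.
rewrite -(det_deg0 dT); apply: rinv_eq.
  exact: (congr1 val dd).
by move: dd; rewrite mulrC => /(congr1 val).
Qed.

Lemma cber_gber (n_gt0 : (0 < n)%N) : is_gber (cber e p_odd).
Proof.
have hu (X : gl0 A r) : (forall u, submxblock X u u = 1%:M) -> forall i j,
    tagnat.sig1 i = tagnat.sig1 j -> X i j = (i == j)%:R.
  move=> h i j ij; rewrite -(tagnat.sig2K i) -(tagnat.sig2K j).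
  move: (tagnat.sig2 i) (tagnat.sig2 j); rewrite ij => a b.
  have := congr1 (fun Z : 'M_(_) => Z a b) (h (tagnat.sig1 j)); rewrite !mxE => ->.
  by rewrite -[RHS](_ : (val (Rk _ a) == val (Rk _ b))%:R = _) // tagnat.eq_Rank eqxx.
have h0 (X : gl0 A r) i j : submxblock X (tagnat.sig1 i) (tagnat.sig1 j) = 0 -> X i j = 0.
  move=> h; have := congr1 (fun Z : 'M_(_, _) => Z (tagnat.sig2 i) (tagnat.sig2 j)) h.
  by rewrite !mxE !tagnat.sig2K.
split.
- by move=> T; split; [apply: cber_homog | apply: cber_unit].
- by move=> S T; apply: cber_mul.
- exact: cber_diag.
- move=> X X1 X0; apply: (cber_unitri e k_char0 p_odd (f := fun i => tagnat.sig1 i)) => // i j.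
  rewrite leq_eqVlt => /orP[/eqP/val_inj|ij]; first exact: hu.
  by rewrite h0 ?X0 //; case: eqP ij => // ->; rewrite ltnn.
- move=> X X1 X0.
  apply: (cber_unitri e k_char0 p_odd (f := fun i => (2 ^ n - tagnat.sig1 i)%N)) => // i j.
  rewrite leq_sub2lE; last exact: ltnW (ltn_ord _).
  rewrite leq_eqVlt.
  move=> /orP[/eqP/val_inj/esym|ij]; first exact: hu.
  by rewrite h0 ?X0 //; case: eqP ij => // ->; rewrite ltnn.
Qed.

End Diagonal.

(** The first conjunct exhibits a map satisfying [is_gber], namely [cber]; the second concerns the
    graded Berezinian, specified as the unique such map and therefore equal to [cber]. *)
Theorem proposition4 (n : nat) (n_gt0 : (0 < n)%N)
    (k : fieldType) (k_char0 : [pchar k] =i pred0) (A : gcAlgType n k)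
    (r : 'I_(2 ^ n) -> nat) (M : gmodType A) (e : stdBasis r M)
    (p : 'rV['F_2]_n) (p_odd : dotp p p = 1) :
  (exists2 GBer : gl0 A r -> A, is_gber GBer &
     forall (T : gl0 A r) (h : cohom p e), Phi T h = hract h (GBer T)) /\
  (forall GBer : gl0 A r -> A, unique (@is_gber n k A r) GBer ->
     forall (T : gl0 A r) (h : cohom p e), Phi T h = hract h (GBer T)).
Proof.
have hc := cber_gber e k_char0 p_odd n_gt0.
split=> [|GBer [_ /(_ _ hc) ->] T h]; last exact: Phi_cber.
by exists (cber e p_odd) => // T h; apply: Phi_cber.
Qed.
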